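(* Let $\mathbf{x}^{*}(\widehat{\mathbb{B}})$ and $\lambda^{*}(\widehat{\mathbb{B}})$ be the unique optimal solution and Lagrange multiplier of the convex program $$\min_{\mathbf{x}} f\big(\widehat{\mathbf{Y}}(\mathbf{x})\big)\quad\text{subject to}\quad \|\mathbf{x}\|^{2}\le c^{2},\qquad \widehat{\mathbf{Y}}(\mathbf{x})=\widehat{\mathbb{B}}'\mathbf{z}(\mathbf{x}),\qquad(\mathcal{P})$$ with Lagrangian $L(\mathbf{x},\lambda;\widehat{\mathbb{B}})=f\big(\widehat{\mathbf{Y}}(\mathbf{x})\big)+\lambda(\|\mathbf{x}\|^{2}-c^{2})$, and let $\mathbf{x}^{*}(\mathbb{B}),\lambda^{*}(\mathbb{B})$ be the corresponding quantities at the true parameter $\mathbb{B}$ (all objects as described in the context). Assume: 1. For any $\widehat{\mathbb{B}}\in V_{\varepsilon}(\mathbb{B})$, the second-order sufficient condition is fulfilled for the convex program $(\mathcal{P})$, such that the second-order derivatives $$\frac{\partial^{2}L(\mathbf{x},\lambda;\widehat{\mathbb{B}})}{\partial\mathbf{x}\,\partial\mathbf{x}'},\quad \frac{\partial^{2}L(\mathbf{x},\lambda;\widehat{\mathbb{B}})}{\partial\mathbf{x}\,\partial\,\mathrm{vec}'\widehat{\mathbb{B}}},\quad \frac{\partial^{2}L(\mathbf{x},\lambda;\widehat{\mathbb{B}})}{\partial\mathbf{x}\,\partial\lambda},\quad \frac{\partial^{2}L(\mathbf{x},\lambda;\widehat{\mathbb{B}})}{\partial\lambda\,\partial\mathbf{x}'},\quad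 \frac{\partial^{2}L(\mathbf{x},\lambda;\widehat{\mathbb{B}})}{\partial\lambda\,\partial\,\mathrm{vec}\,\widehat{\mathbb{B}}}$$ exist and are continuous in $[\mathbf{x}^{*}(\widehat{\mathbb{B}}),\lambda^{*}(\widehat{\mathbb{B}})]'\in V_{\varepsilon}([\mathbf{x}^{*}(\mathbb{B}),\lambda^{*}(\mathbb{B})]')$, and $\partial^{2}L(\mathbf{x},\lambda;\widehat{\mathbb{B}})/\partial\mathbf{x}\,\partial\mathbf{x}'$ is positive definite. 2. $\widehat{\mathbb{B}}_{\nu}$, the estimator of the true parameter $\mathbb{B}_{\nu}$, is based on a sample of size $N_{\nu}$ such that $$\sqrt{N_{\nu}}(\widehat{\mathbb{B}}_{\nu}-\mathbb{B}_{\nu})\sim\mathcal{N}_{p\times r}(\mathbf{0},\boldsymbol{\Theta}),\qquad \frac{1}{N_{\nu}}\boldsymbol{\Theta}=(\mathbf{X}'\mathbf{X})^{-1}\otimes\boldsymbol{\Sigma}.$$ 3. Strict complementary slackness holds at $\mathbf{x}^{*}(\mathbb{B})$ with respect to $\lambda^{*}(\mathbb{B})$: $\lambda^{*}(\mathbb{B})>0\Leftrightarrow\|\mathbf{x}^{*}(\mathbb{B})\|^{2}-c^{2}=0$. Then asymptotically (in $N_\nu$) $$\sqrt{N_{\nu}}\left[\mathbf{x}^{*}(\widehat{\mathbb{B}})-\mathbf{x}^{*}(\mathbb{B})\right]\xrightarrow{d}\mathcal{N}_{n}(\mathbf{0}_{n},\boldsymbol{\Xi}),$$ where the $n\times n$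 variance-covariance matrix is $$\boldsymbol{\Xi}=\left(\frac{\partial\mathbf{x}^{*}(\widehat{\mathbb{B}})}{\partial\,\mathrm{vec}\,\widehat{\mathbb{B}}}\right)\widehat{\boldsymbol{\Theta}}\left(\frac{\partial\mathbf{x}^{*}(\widehat{\mathbb{B}})}{\partial\,\mathrm{vec}\,\widehat{\mathbb{B}}}\right)',\qquad \frac{1}{N_{\nu}}\widehat{\boldsymbol{\Theta}}=(\mathbf{X}'\mathbf{X})^{-1}\otimes\widehat{\boldsymbol{\Sigma}},$$ such that all elements of $\partial\mathbf{x}^{*}(\widehat{\mathbb{B}})/\partial\,\mathrm{vec}\,\widehat{\mathbb{B}}$ are continuous on any $\widehat{\mathbb{B}}\in V_{\varepsilon}(\mathbb{B})$; furthermore $$\frac{\partial\mathbf{x}^{*}(\widehat{\mathbb{B}})}{\partial\,\mathrm{vec}\,\widehat{\mathbb{B}}}=-\left[\mathbf{I}-\mathbf{P}^{-1}\mathbf{Q}(\mathbf{Q}'\mathbf{P}^{-1}\mathbf{Q})^{-1}\mathbf{Q}'\right]\mathbf{P}^{-1}\mathbf{G},$$ where $$\mathbf{P}=\frac{\partial^{2}L(\mathbf{x},\lambda;\widehat{\mathbb{B}})}{\partial\mathbf{x}\,\partial\mathbf{x}'},\qquad \mathbf{Q}=\frac{\partial^{2}L(\mathbf{x},\lambda;\widehat{\mathbb{B}})}{\partial\lambda\,\partial\mathbf{x}},\qquad \mathbf{G}=\frac{\partial^{2}L(\mathbf{x},\lambda;\widehat{\mathbb{B}})}{\partial\mathbf{x}\,\partial\,\mathrm{vec}'\widehat{\mathbb{B}}},$$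 evaluated at $[\mathbf{x}^{*}(\widehat{\mathbb{B}}),\lambda^{*}(\widehat{\mathbb{B}})]'$.
   Context: A prime denotes transpose; $\mathrm{vec}\,A$ stacks the columns of $A$ and $\mathrm{vec}'A=(\mathrm{vec}\,A)'$; $\otimes$ is the Kronecker product; $\|\cdot\|$ is the Euclidean norm; $V_{\varepsilon}(\cdot)$ is an $\varepsilon$-neighbourhood (open ball); $\xrightarrow{d}$ is convergence in distribution; $\mathbf{I}$ is an identity matrix. Model: there are $n$ controllable variables $\mathbf{x}=(x_1,\dots,x_n)'$, $r$ responses, and $p=1+n+n(n+1)/2$. Put $\mathbf{z}(\mathbf{x})=(1,x_1,\dots,x_n,x_1^2,\dots,x_n^2,x_1x_2,x_1x_3,\dots,x_{n-1}x_n)'$. The model is $\mathbf{Y}=\mathbf{X}\mathbb{B}+\mathbb{E}$, where $\mathbf{Y}$ is the $N\times r$ matrix of observations, $\mathbf{X}$ is an $N\times p$ design matrix of rank $p$, $\mathbb{B}$ is the $p\times r$ matrix of unknown parameters, and $\mathbb{E}\sim\mathcal{N}_{N\times r}(\mathbf{0},\mathbf{I}_N\otimes\boldsymbol{\Sigma})$, that is, $\mathbb{E}$ is matrix normal with mean $\mathbf{0}$ and $\mathrm{Cov}(\mathrm{vec}\,\mathbb{E}')=\mathbf{I}_N\otimes\boldsymbol{\Sigma}$, with $\boldsymbol{\Sigma}$ an $r\times r$ positive definite matrix. The same convention is used for $\mathcal{N}_{p\times r}$: the second argument is the covariance of the vec of the transpose. The least squares estimator is $\widehat{\mathbb{B}}=(\mathbf{X}'\mathbf{X})^{-1}\mathbf{X}'\mathbf{Y}$,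 so that $\widehat{\mathbb{B}}\sim\mathcal{N}_{p\times r}(\mathbb{B},(\mathbf{X}'\mathbf{X})^{-1}\otimes\boldsymbol{\Sigma})$, and $\widehat{\boldsymbol{\Sigma}}=\mathbf{Y}'(\mathbf{I}_N-\mathbf{X}(\mathbf{X}'\mathbf{X})^{-1}\mathbf{X}')\mathbf{Y}/(N-p)$. The predicted multiresponse surface is $\widehat{\mathbf{Y}}(\mathbf{x})=(\widehat{Y}_1(\mathbf{x}),\dots,\widehat{Y}_r(\mathbf{x}))'=\widehat{\mathbb{B}}'\mathbf{z}(\mathbf{x})$. The subscript $\nu$ marks quantities based on the sample of size $N_\nu$ and is suppressed elsewhere. Program: $f$ is a real-valued functional on a set of multiresponse surface functions such that $\min\widehat{\mathbf{Y}}(\mathbf{x}^{*})<\min\widehat{\mathbf{Y}}(\mathbf{x}_1)\Leftrightarrow f(\widehat{\mathbf{Y}}(\mathbf{x}^{*}))<f(\widehat{\mathbf{Y}}(\mathbf{x}_1))$ for $\mathbf{x}^{*}\ne\mathbf{x}_1$. It is used to replace the multiobjective problem of minimizing the vector $\widehat{\mathbf{Y}}(\mathbf{x})$ over the region $\|\mathbf{x}\|^2\le c^2$, $c\in\mathbb{R}$, by a scalar one. The scalar program is taken to be convex, with strictly convex objective and constraint. $\mathbf{x}^{*}(\widehat{\mathbb{B}})\in\mathbb{R}^n$ is its unique optimal solution, with multiplier $\lambda^{*}(\widehat{\mathbb{B}})\in\mathbb{R}$, characterized by the Kuhn-Tucker conditions $\nabla_{\mathbf{x}}f(\widehat{\mathbf{Y}}(\mathbf{x}))+2\lambda\mathbf{x}=\mathbf{0}$,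 $\|\mathbf{x}\|^2-c^2\le0$, $\lambda(\|\mathbf{x}\|^2-c^2)=0$, $\lambda\ge0$. Similarly, $\mathbf{x}^{*}(\mathbb{B})\in\mathbb{R}^n$ and $\lambda^{*}(\mathbb{B})\in\mathbb{R}$ are the unique optimal solution and Lagrange multiplier of the problem of minimizing the true response surfaces $(Y_1(\mathbf{x}),\dots,Y_r(\mathbf{x}))'=\mathbb{B}'\mathbf{z}(\mathbf{x})$ over the same region, characterized by the same Kuhn-Tucker conditions with $\widehat{\mathbb{B}}=\mathbb{B}$, that is, with Lagrangian $L(\mathbf{x},\lambda;\mathbb{B})$.
   Formalization: Jacobian is −P⁻¹G where ‖x*‖²<c² (printed formula false there); it is continuous on some V_δ(B), δ≤ε; Θ is reordered to match vec B; the limit Ξ uses true B, Θ, and the hatted Ξ converges to it in probability; x*(B̂_ν) is assumed measurable. *)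

(* Defs.v *)
From HB Require Import structures.
From mathcomp Require Export all_boot all_order all_algebra.
From mathcomp Require Export all_classical all_reals all_analysis.
From mathcomp Require Export mxtens.

Set Implicit Arguments.
Unset Strict Implicit.
Unset Printing Implicit Defensive.

Export Order.TTheory GRing.Theory Num.Theory.
Export numFieldNormedType.Exports.

Global Open Scope classical_set_scope.
Global Open Scope ring_scope.

(** * Matrices *)

(* The library norm `|A| on matrices is the sup norm. *)
Definition enorm {R : realType} {m n : nat} (A : 'M[R]_(m, n)) : R :=
  Num.sqrt (\sum_i \sum_j A i j ^+ 2).

Definition Vnbhd {R : realType} {m n : nat} (eps : R) (A0 : 'M[R]_(m, n)) :
  set 'M[R]_(m, n) := [set A | enorm (A - A0) < eps].

Definition psdmx {R : realType} {n : nat} (S : 'M[R]_n) : Prop :=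
  S^T = S /\ forall t : 'cV[R]_n, 0 <= (t^T *m S *m t) 0 0.

Definition pdmx {R : realType} {n : nat} (S : 'M[R]_n) : Prop :=
  S^T = S /\ forall t : 'cV[R]_n, t != 0 -> 0 < (t^T *m S *m t) 0 0.

(* Columns stacked: A i j is entry j * m + i of vec A (mxvec stacks rows). *)
Definition vec {R : realType} {m n : nat} (A : 'M[R]_(m, n)) : 'cV[R]_(n * m) :=
  \col_k A (mxtens_unindex k).2 (mxtens_unindex k).1.

Definition vec_basis {R : realType} {m n : nat} (k : 'I_(n * m)) :
  'M[R]_(m, n) := delta_mx (mxtens_unindex k).2 (mxtens_unindex k).1.

Lemma vec_basisE {R : realType} {m n : nat} (k : 'I_(n * m)) :
  vec (vec_basis k : 'M[R]_(m, n)) = delta_mx k 0.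
Proof.
apply/colP => l; rewrite !mxE andbT.
case: (mxtens_indexP k) => j i; case: (mxtens_indexP l) => j' i'.
by rewrite !mxtens_indexK /= (can_eq (@mxtens_indexK n m)) xpair_eqE andbC.
Qed.

(* The commutation matrix, which turns vec A^T into vec A. *)
Definition commutation {R : realType} (m n : nat) : 'M[R]_(n * m, m * n) :=
  \matrix_(k, l) (((mxtens_unindex k).1 == (mxtens_unindex l).2) &&
                  ((mxtens_unindex k).2 == (mxtens_unindex l).1))%:R.

Lemma commutation_vec {R : realType} {m n : nat} (A : 'M[R]_(m, n)) :
  commutation m n *m vec A^T = vec A.
Proof.
apply/colP => k; case: (mxtens_indexP k) => j i.
rewrite !mxE !mxtens_indexK (bigD1 (mxtens_index (i, j))) //= big1 => [|l].
  by rewrite !mxE !mxtens_indexK !eqxx mul1r addr0.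
case: (mxtens_indexP l) => i' j'; rewrite !mxE !mxtens_indexK /=.
rewrite (can_eq (@mxtens_indexK m n)) xpair_eqE [i' == _]eq_sym [j' == _]eq_sym.
by rewrite andbC => /negPf->; rewrite mul0r.
Qed.

(** * Partial derivatives *)

Definition has_grad {R : realType} {n : nat} (g : 'cV[R]_n -> R)
    (x : 'cV[R]_n) : Prop :=
  forall i, derivable g x (delta_mx i 0).

Definition grad {R : realType} {n : nat} (g : 'cV[R]_n -> R)
    (x : 'cV[R]_n) : 'cV[R]_n :=
  \col_i 'D_(delta_mx i 0) g x.

Definition has_jac {R : realType} {m n : nat} (F : 'cV[R]_n -> 'cV[R]_m)
    (x : 'cV[R]_n) : Prop :=
  forall i j, derivable (fun y => F y i 0) x (delta_mx j 0).

Definition jac {R : realType} {m n : nat} (F : 'cV[R]_n -> 'cV[R]_m)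
    (x : 'cV[R]_n) : 'M[R]_(m, n) :=
  \matrix_(i, j) 'D_(delta_mx j 0) (fun y => F y i 0) x.

(* d F / d vec' C *)
Definition has_jacvec {R : realType} {q m n : nat}
    (F : 'M[R]_(m, n) -> 'cV[R]_q) (C : 'M[R]_(m, n)) : Prop :=
  forall i k, derivable (fun D => F D i 0) C (vec_basis k).

Definition jacvec {R : realType} {q m n : nat}
    (F : 'M[R]_(m, n) -> 'cV[R]_q) (C : 'M[R]_(m, n)) : 'M[R]_(q, n * m) :=
  \matrix_(i, k) 'D_(vec_basis k) (fun D => F D i 0) C.

(** * Normal distributions and convergence *)

Definition random_matrix {R : realType} {d : measure_display}
    {T : measurableType d} {m n : nat} (X : T -> 'M[R]_(m, n)) : Prop :=
  forall i j, measurable_fun setT (fun w => X w i j).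

(* Normal law of mean m and variance v.  In the library, normal_prob takes the
   standard deviation, and normal_prob m 0 is not the point mass at m. *)
Definition normal_law {R : realType} (m v : R) : set R -> \bar R :=
  fun A => if v == 0 then dirac m A else normal_prob m (Num.sqrt v) A.

(* X ~ N_k(m, S), S possibly singular: S is symmetric positive semidefinite and
   every t'X has the univariate law N(t'm, t'St). *)
Definition mvnormal {R : realType} {d : measure_display} {T : measurableType d}
    {k : nat} (P : probability T R) (X : T -> 'cV[R]_k) (m : 'cV[R]_k)
    (S : 'M[R]_k) : Prop :=
  [/\ random_matrix X, psdmx S &
      forall (t : 'cV[R]_k) (A : set R), measurable A ->
        pushforward P (fun w => (t^T *m X w) 0 0) A =
        normal_law ((t^T *m m) 0 0) ((t^T *m S *m t) 0 0) A].

(* X ~ N_(m x n)(M, S): the second argument is the covariance of vec X'. *)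
Definition matrix_normal {R : realType} {d : measure_display}
    {T : measurableType d} {m n : nat} (P : probability T R)
    (X : T -> 'M[R]_(m, n)) (M : 'M[R]_(m, n)) (S : 'M[R]_(m * n)) : Prop :=
  mvnormal P (fun w => vec (X w)^T) (vec M^T) S.

(* The terms of the sequence may live on different probability spaces. *)
Definition cvg_in_distribution {R : realType} {d : nat -> measure_display}
    {T : forall nu, measurableType (d nu)} {d' : measure_display}
    {T' : measurableType d'} {k : nat} (P : forall nu, probability (T nu) R)
    (X : forall nu, T nu -> 'cV[R]_k)
    (Q : probability T' R) (Z : T' -> 'cV[R]_k) : Prop :=
  forall h : 'cV[R]_k -> R, continuous h ->
    (exists K : R, forall x, `|h x| <= K) ->
    'E_(P nu)[fun w => h (X nu w)]%E @[nu --> \oo] --> 'E_Q[fun w => h (Z w)]%E.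

Definition cvg_to_normal {R : realType} {d : nat -> measure_display}
    {T : forall nu, measurableType (d nu)} {k : nat}
    (P : forall nu, probability (T nu) R) (X : forall nu, T nu -> 'cV[R]_k)
    (m : 'cV[R]_k) (S : 'M[R]_k) : Prop :=
  exists (d' : measure_display) (T' : measurableType d') (Q : probability T' R)
    (Z : T' -> 'cV[R]_k), mvnormal Q Z m S /\ cvg_in_distribution P X Q Z.

(* Convergence in probability to a constant.  The outer measure makes this
   meaningful without measurability of S nu. *)
Definition cvg_in_outer_probability {R : realType} {d : nat -> measure_display}
    {T : forall nu, measurableType (d nu)} {m n : nat}
    (P : forall nu, probability (T nu) R) (S : forall nu, T nu -> 'M[R]_(m, n))
    (S0 : 'M[R]_(m, n)) : Prop :=
  forall e : R, 0 < e ->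
    mu_ext (P nu) [set w | e <= enorm (S nu w - S0)] @[nu --> \oo] --> 0%E.

(** * The second-order polynomial model *)

Definition nbterms (n : nat) : nat := (1 + n + (n * (n + 1)) %/ 2)%N.

Definition monomials {R : realType} {n : nat} (x : 'cV[R]_n) : seq R :=
  [:: 1] ++ [seq x i 0 | i <- enum 'I_n] ++ [seq x i 0 ^+ 2 | i <- enum 'I_n] ++
  [seq x i 0 * x j 0 | i <- enum 'I_n, j <- [seq j : 'I_n <- enum 'I_n | (i < j)%N]].

Lemma size_monomials {R : realType} {n : nat} (x : 'cV[R]_n) :
  size (monomials x) = nbterms n.
Proof.
rewrite /monomials /nbterms !size_cat size_allpairs_dep !(size_map _ (enum _)) size_enum_ord.
have filterE (i : 'I_n) :
    size [seq j : 'I_n <- enum 'I_n | (i < j)%N] = (n - i.+1)%N.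
  rewrite -(size_map val) -filter_map val_enum_ord -[n in iota 0 n](subnKC (ltn_ord i)).
  rewrite iotaD filter_cat size_cat -[in RHS](size_iota i.+1 (n - i.+1)).
  rewrite (@eq_in_filter _ _ pred0) => [|j]; last first.
    by rewrite mem_iota /= add0n ltnS ltnNge => ->.
  rewrite filter_pred0 (@eq_in_filter _ _ predT) ?filter_predT // => j.
  by rewrite mem_iota => /andP[].
rewrite (eq_map filterE) sumnE big_map big_enum /=.
have -> : (\sum_(i < n) (n - i.+1) = 'C(n, 2))%N.
  rewrite -bin2_sum big_mkord (reindex_inj rev_ord_inj) /=.
  by apply: eq_bigr => i _; rewrite subnS subKn.
rewrite bin2 -!addnA; congr (_ + (_ + _))%N.
have : (n * n.-1 + n.*2 = n * (n + 1))%N.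
  by case: n {x filterE} => //= n; rewrite -muln2 -mulnDr addn2 addn1.
by move=> <-; rewrite divn2 halfD odd_double andbF doubleK add0n addnC.
Qed.

Definition zvec {R : realType} {n : nat} (x : 'cV[R]_n) : 'cV[R]_(nbterms n) :=
  \col_k nth 0 (monomials x) k.

(* Y(x) = B' z(x) *)
Definition surface {R : realType} {n r : nat} (B : 'M[R]_(nbterms n, r))
    (x : 'cV[R]_n) : 'cV[R]_r := B^T *m zvec x.

Definition lse {R : realType} {N p r : nat} (X : 'M[R]_(N, p))
    (Y : 'M[R]_(N, r)) : 'M[R]_(p, r) := invmx (X^T *m X) *m X^T *m Y.

Definition sigma_hat {R : realType} {N p r : nat} (X : 'M[R]_(N, p))
    (Y : 'M[R]_(N, r)) : 'M[R]_r :=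
  (N%:R - p%:R)^-1 *:
    (Y^T *m (1%:M - X *m invmx (X^T *m X) *m X^T) *m Y).

Definition theta_hat {R : realType} {N p r : nat} (X : 'M[R]_(N, p))
    (Y : 'M[R]_(N, r)) : 'M[R]_(p * r) :=
  N%:R *: (invmx (X^T *m X) *t sigma_hat X Y).

(** * The scalar program *)

Definition strictly_convex {R : realType} {n : nat} (g : 'cV[R]_n -> R) : Prop :=
  forall (x y : 'cV[R]_n) (t : R), x != y -> 0 < t -> t < 1 ->
    g (t *: x + (1 - t) *: y) < t * g x + (1 - t) * g y.

Definition unique_minimizer {R : realType} {n r : nat} (f : 'cV[R]_r -> R)
    (c : R) (B : 'M[R]_(nbterms n, r)) (x : 'cV[R]_n) : Prop :=
  enorm x ^+ 2 <= c ^+ 2 /\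
  forall y : 'cV[R]_n, enorm y ^+ 2 <= c ^+ 2 -> y != x ->
    f (surface B x) < f (surface B y).

Definition kuhn_tucker {R : realType} {n r : nat} (f : 'cV[R]_r -> R) (c : R)
    (B : 'M[R]_(nbterms n, r)) (x : 'cV[R]_n) (lam : R) : Prop :=
  [/\ has_grad (fun y => f (surface B y)) x /\
      grad (fun y => f (surface B y)) x + (2 * lam) *: x = 0,
      enorm x ^+ 2 - c ^+ 2 <= 0,
      lam * (enorm x ^+ 2 - c ^+ 2) = 0 &
      0 <= lam].

Definition lagrangian {R : realType} {n r : nat} (f : 'cV[R]_r -> R) (c : R)
    (B : 'M[R]_(nbterms n, r)) (x : 'cV[R]_n) (lam : R) : R :=
  f (surface B x) + lam * (enorm x ^+ 2 - c ^+ 2).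

Section LagrangianDerivatives.
Context {R : realType} {n r : nat} (f : 'cV[R]_r -> R) (c : R).
Implicit Types (B : 'M[R]_(nbterms n, r)) (x : 'cV[R]_n) (lam : R).
Notation L := (lagrangian f c).

Definition L_x B x lam : 'cV[R]_n := grad (fun y => L B y lam) x.

Definition L_lam B x lam : R := 'D_1 (fun l : R => L B x l) lam.

(* d^2 L / dx dx' *)
Definition L_xx B x lam : 'M[R]_n := jac (fun y => L_x B y lam) x.

(* d^2 L / dx dvec'B, the Jacobian in vec B of the gradient in x *)
Definition L_xB B x lam : 'M[R]_(n, r * nbterms n) :=
  jacvec (fun C => L_x C x lam) B.

(* d^2 L / dx dlam *)
Definition L_xlam B x lam : 'cV[R]_n :=
  \col_i 'D_1 (fun l : R => L_x B x l i 0) lam.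

(* d^2 L / dlam dx; its transpose is d^2 L / dlam dx' *)
Definition L_lamx B x lam : 'cV[R]_n := grad (fun y => L_lam B y lam) x.

(* d^2 L / dlam dvec B *)
Definition L_lamB B x lam : 'cV[R]_(r * nbterms n) :=
  \col_k 'D_(vec_basis k) (fun C => L_lam C x lam) B.

Definition has_second_derivatives B x lam : Prop :=
  [/\ has_grad (fun y => L B y lam) x, derivable (fun l : R => L B x l) lam 1,
      has_jac (fun y => L_x B y lam) x & has_jacvec (fun C => L_x C x lam) B] /\
  [/\ forall i, derivable (fun l : R => L_x B x l i 0) lam 1,
      has_grad (fun y => L_lam B y lam) x &
      forall k, derivable (fun C => L_lam C x lam) B (vec_basis k)].

(* Joint continuity in (x, lam, B). *)
Definition second_derivatives_continuous B x lam : Prop :=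
  let T := ('cV[R]_n * R * 'M[R]_(nbterms n, r))%type in
  [/\ {for (x, lam, B), continuous (fun u : T => L_xx u.2 u.1.1 u.1.2)},
      {for (x, lam, B), continuous (fun u : T => L_xB u.2 u.1.1 u.1.2)},
      {for (x, lam, B), continuous (fun u : T => L_xlam u.2 u.1.1 u.1.2)},
      {for (x, lam, B), continuous (fun u : T => L_lamx u.2 u.1.1 u.1.2)} &
      {for (x, lam, B), continuous (fun u : T => L_lamB u.2 u.1.1 u.1.2)}].

(* Directions d with g'd = 0 if lam > 0 and g'd <= 0 if lam = 0, where g = 2x
   is the gradient of the constraint, when the constraint is active. *)
Definition critical_direction x lam (d : 'cV[R]_n) : Prop :=
  enorm x ^+ 2 = c ^+ 2 ->
  (x^T *m d) 0 0 <= 0 /\ (0 < lam -> (x^T *m d) 0 0 = 0).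

Definition second_order_sufficient B x lam : Prop :=
  kuhn_tucker f c B x lam /\
  forall d : 'cV[R]_n, d != 0 -> critical_direction x lam d ->
    0 < (d^T *m L_xx B x lam *m d) 0 0.

End LagrangianDerivatives.

(* [x', lam]' *)
Definition stack {R : realType} {n : nat} (x : 'cV[R]_n) (lam : R) :
  'cV[R]_(n + 1) := col_mx x lam%:M.

(* J Theta J' for J = d x / d vec B.  Theta is the covariance of vec B', ordered
   differently from vec B, hence the commutation matrix. *)
Definition delta_covariance {R : realType} {n p r : nat}
    (J : 'M[R]_(n, r * p)) (Theta : 'M[R]_(p * r)) : 'M[R]_n :=
  J *m (commutation p r *m Theta *m (commutation p r)^T) *m J^T.

(* Main.v *)
Require Import Defs.
From mathcomp Require Import all_boot all_order all_algebra.
From mathcomp Require Import all_classical all_reals all_analysis.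
From mathcomp Require Import mxtens ring lra.
From mathcomp Require Import measurable_realfun.

Set Implicit Arguments.
Unset Strict Implicit.
Unset Printing Implicit Defensive.

(* The maps [xs] and [ls] are given, so no implicit function theorem is needed.
   Near [x], the Lagrangian is strongly convex in [x] along the segment from one
   optimum to another, which makes [xs] and then [ls] continuous.  Subtracting the
   Kuhn-Tucker equations at two parameters [C] and [Bh] and writing increments of the
   gradient as mean-value matrices gives
   [S (xs C - xs Bh) + 2 (ls C - ls Bh) xs C = - N vec (C - Bh)] with [S -> L_xx] and
   [N -> L_xB]; when the constraint is active at both, also
   [(xs C + xs Bh)' (xs C - xs Bh) = 0].  Solving this bordered system exhibits
   [xs C - xs Bh] as [K C vec (C - Bh)] with [K] continuous at [Bh]: the limit of [K]
   is the Jacobian, and [xs] is Frechet differentiable.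
   The law of [Z = sqrt N (lse - B)] does not depend on [nu], so that [Z] is tight and
   [sqrt N (xs lse - xs B)] differs from [J vec Z] by a term vanishing in probability.
   Equality of the projections of [Z] implies equality of expectations of bounded
   continuous functions (Cramer-Wold) by approximation with trigonometric polynomials,
   obtained from Bernstein polynomials in [sin].
   Consistency of [theta_hat] reduces to [E'E / N -> Sigma], which follows from
   the fourth moments of the normal law by Chebyshev's inequality and polarization. *)

(** * Mean values and Jacobians *)

(** The differentiability hypotheses concern coordinate partial derivatives only, so every statement
    on total derivatives is derived from continuity of the partials. Mean values are then taken one
    coordinate at a time: the entries of [S] and [N] are partials at different points and [S] need
    not be symmetric. The bordered system therefore carries two distinct borders, and only its limit
    has the symmetric form. Convergence of [S] presupposes that [xs C] tends to [xs Bh], so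
    continuity of [xs] has to come from convexity before any differentiation. Strict complementary
    slackness keeps the constraint active, or keeps it inactive, on a whole neighbourhood of [B], so
    that a single formula applies there. A covariance written with [lse] and [theta_hat] is random
    and cannot be that of a limit law: the limit law uses the values at [B] and [Theta], and the
    random covariance is shown to converge to that covariance in outer probability. *)

Section MeanValue.
Context {R : realType} {V : normedModType R}.
Implicit Types (f : V -> R) (x v : V).

Lemma is_derive_line f x v (t : R) : derivable f (x + t *: v) v ->
  is_derive t 1 (fun s : R => f (x + s *: v)) ('D_v f (x + t *: v)).
Proof.
have E : (fun h : R => h^-1 *: (f (x + (h *: (1 : R) + t) *: v) - f (x + t *: v))) =
    (fun h : R => h^-1 *: (f (h *: v + (x + t *: v)) - f (x + t *: v))).
  apply/funext => h; congr (_ *: (f _ - _)).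
  by rewrite scalerDl addrCA [(_ *: 1)%R]mulr1.
by move=> df; split; [rewrite /derivable E|rewrite /derive E].
Qed.

Lemma mvt_line f x v (u : R) :
  (forall s : R, 0 <= s <= 1 -> derivable f (x + (s * u) *: v) v) ->
  exists2 s : R, 0 <= s <= 1 &
    f (x + u *: v) - f x = u * 'D_v f (x + (s * u) *: v).
Proof.
move=> df; have [->|u0] := eqVneq u 0.
  exists 0; first by rewrite lexx ler01.
  by rewrite scale0r addr0 subrr mul0r.
pose h := fun t : R => f (x + t *: v).
have D (t : R) : 0 <= t / u <= 1 -> is_derive t 1 h ('D_v f (x + t *: v)).
  by move=> tu; apply: is_derive_line; have := df _ tu; rewrite divfK.
have cont (t : R) : 0 <= t / u <= 1 -> {for t, continuous h}.
  by move=> /D [/derivable1_diffP/differentiable_continuous].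
have key (a b : R) : a < b -> (forall t, a <= t <= b -> 0 <= t / u <= 1) ->
    exists2 t, 0 <= t / u <= 1 & h b - h a = 'D_v f (x + t *: v) * (b - a).
  move=> ab sub.
  have [||t] := @MVT _ h (fun t => 'D_v f (x + t *: v)) a b ab.
  - by move=> t; rewrite in_itv/= => /andP[/ltW ? /ltW ?]; apply/D/sub/andP.
  - apply: continuous_in_subspaceT => t; rewrite inE/= in_itv/= => tab.
    exact/cont/sub.
  rewrite in_itv/= => /andP[/ltW ? /ltW ?]; exists t => //.
  by apply/sub/andP.
have [u_gt0|u_lt0|/eqP] := ltgtP 0 u; last by rewrite eq_sym (negbTE u0).
  have [t /andP[t0 tu]|t tu E] := key 0 u u_gt0.
    by rewrite ler_pdivrMr// mul1r tu andbT divr_ge0// ltW.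
  exists (t / u) => //; rewrite divfK// mulrC.
  by move: E; rewrite /h scale0r addr0 subr0.
have [t /andP[ut t0]|t tu E] := key u 0 u_lt0.
  by rewrite ler_ndivlMr// mul0r t0/= ler_ndivrMr// mul1r.
exists (t / u) => //; rewrite divfK//.
move: E; rewrite /h scale0r addr0 sub0r => E.
by rewrite -opprB E mulrN opprK mulrC.
Qed.

(** Travel from [x] to the endpoint along edges of a box, one coordinate at a time. Each partial
    derivative is taken at its own point of the box, so no total differentiability enters. *)
Lemma mvt_box (K : nat) (e : 'I_K -> V) (f : V -> R) (x : V) (u : 'I_K -> R) :
  (forall s : 'I_K -> R, (forall k, 0 <= s k <= 1) -> forall k,
     derivable f (x + \sum_j (s j * u j) *: e j) (e k)) ->
  exists2 s : 'I_K -> 'I_K -> R, (forall k j, 0 <= s k j <= 1) &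
    f (x + \sum_k u k *: e k) - f x =
    \sum_k u k * 'D_(e k) f (x + \sum_j (s k j * u j) *: e j).
Proof.
move=> df.
(* Position while coordinate [k] moves: earlier coordinates have arrived, [k] is at fraction [a],
   later ones have not left. *)
pose w (k : 'I_K) (a : R) (j : 'I_K) : R :=
  if (j < k)%N then 1 else if j == k then a else 0.
have w01 k a : 0 <= a <= 1 -> forall j, 0 <= w k a j <= 1.
  by move=> a01 j; rewrite /w; case: ifP => _; [|case: ifP => _]; rewrite ?lexx ?ler01.
pose y (m : nat) := x + \sum_(j < K | (j < m)%N) u j *: e j.
have wE k a : x + \sum_j (w k a j * u j) *: e j = y k + (a * u k) *: e k.
  rewrite /y -addrA; congr (_ + _).
  rewrite (bigID (fun j : 'I_K => (j < k)%N))/=; congr (_ + _).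
    by apply: eq_bigr => j jk; rewrite /w jk mul1r.
  rewrite (bigD1 k) ?ltnn//= big1 => [|j /andP[jk njk]].
    by rewrite /w ltnn eqxx addr0.
  by rewrite /w (negbTE jk) (negbTE njk) mul0r scale0r.
have step (k : 'I_K) : exists a : R, 0 <= a <= 1 /\
    f (y k.+1) - f (y k) = u k * 'D_(e k) f (x + \sum_j (w k a j * u j) *: e j).
  have yS : y k.+1 = y k + u k *: e k.
    rewrite /y -addrA; congr (_ + _).
    rewrite (bigD1 k)//= addrC; congr (_ + _); apply: eq_bigl => j.
    by rewrite ltnS [RHS]ltn_neqAle andbC.
  have [|a a01 E] := @mvt_line f (y k) (e k) (u k).
    by move=> s s01; rewrite -wE; apply: df; exact: w01.
  by exists a; split => //; rewrite yS wE.
have [a aP] := choice step.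
exists (fun k => w k (a k)); first by move=> k; apply: w01; case: (aP k).
have -> : x + \sum_k u k *: e k = y K.
  by rewrite /y; congr (_ + _); apply: eq_bigl => j; rewrite ltn_ord.
have {1}-> : x = y 0%N by rewrite /y big_pred0 ?addr0// => j; rewrite ltn0.
rewrite -(telescope_sumr (fun m => f (y m)) (leq0n K)) big_mkord.
by apply: eq_bigr => k _; case: (aP k).
Qed.

End MeanValue.

(** * Entrywise bounds and limits of matrices *)

Lemma ler_mxE_norm {R : realType} {m n : nat} (A : 'M[R]_(m, n)) i j :
  `|A i j| <= `|A|.
Proof.
rewrite [leRHS]/Num.norm/= mx_normrE.
exact: (@le_bigmax _ _ _ 0 (fun ij : 'I_m * 'I_n => `|A ij.1 ij.2|) (i, j)).
Qed.

Lemma mx_norm_le {R : realType} {m n : nat} (A : 'M[R]_(m, n)) (e : R) :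
  0 <= e -> (forall i j, `|A i j| <= e) -> `|A| <= e.
Proof.
move=> e0 H; rewrite [leLHS]/Num.norm/= mx_normrE.
by apply/bigmax_leP; split => // -[i j] _.
Qed.

Lemma mx_norm_lt {R : realType} {m n : nat} (A : 'M[R]_(m, n)) (e : R) :
  0 < e -> (forall i j, `|A i j| < e) -> `|A| < e.
Proof.
move=> e0 H; rewrite [ltLHS]/Num.norm/= mx_normrE.
by apply/bigmax_ltP; split => // -[i j] _.
Qed.

Section MatrixConvergence.
Context {R : realType} {T : Type} {F : set_system T} {FF : Filter F}.

Lemma cvg_mxP {m n : nat} (A_ : T -> 'M[R]_(m, n)) (A : 'M[R]_(m, n)) :
  (A_ @ F --> A) <-> forall i j, A_ t i j @[t --> F] --> A i j.
Proof.
split=> [cA i j|H].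
  exact: (cvg_comp _ _ cA (@coord_continuous _ m n i j A)).
apply/cvgrPdist_lt => e e0.
have : \forall t \near F, forall ij : 'I_m * 'I_n, `|A ij.1 ij.2 - A_ t ij.1 ij.2| < e.
  by apply: filter_forall => -[i j]; move/cvgrPdist_lt: (H i j) => /(_ _ e0).
apply: filterS => t Ht; apply: mx_norm_lt => // i j.
by rewrite !mxE; exact: (Ht (i, j)).
Qed.

Lemma cvg_bigsum {V : normedModType R} {I : Type} (r : seq I) (P : pred I) (f : I -> T -> V)
    (a : I -> V) : (forall i, P i -> f i t @[t --> F] --> a i) ->
  (\sum_(i <- r | P i) f i t) @[t --> F] --> \sum_(i <- r | P i) a i.
Proof. exact: (cvg_big (@add_continuous V)). Qed.

Lemma cvg_bigprod {I : Type} (r : seq I) (P : pred I) (f : I -> T -> R)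
    (a : I -> R) : (forall i, P i -> f i t @[t --> F] --> a i) ->
  (\prod_(i <- r | P i) f i t) @[t --> F] --> \prod_(i <- r | P i) a i.
Proof. exact: (cvg_big (@mul_continuous R)). Qed.

Lemma cvg_mulmx {m n p : nat} (A_ : T -> 'M[R]_(m, n)) (B_ : T -> 'M[R]_(n, p))
    (A : 'M[R]_(m, n)) (B : 'M[R]_(n, p)) :
  A_ @ F --> A -> B_ @ F --> B -> (A_ t *m B_ t) @[t --> F] --> A *m B.
Proof.
move=> /cvg_mxP cA /cvg_mxP cB; apply/cvg_mxP => i j.
under eq_fun do rewrite mxE; rewrite mxE; apply: cvg_bigsum => k _.
exact: cvgM.
Qed.

Lemma cvg_trmx {m n : nat} (A_ : T -> 'M[R]_(m, n)) (A : 'M[R]_(m, n)) :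
  A_ @ F --> A -> (A_ t)^T @[t --> F] --> A^T.
Proof.
move=> /cvg_mxP cA; apply/cvg_mxP => i j; under eq_fun do rewrite mxE.
by rewrite mxE; exact: cA.
Qed.

Lemma cvg_det {n : nat} (A_ : T -> 'M[R]_n) (A : 'M[R]_n) :
  A_ @ F --> A -> \det (A_ t) @[t --> F] --> \det A.
Proof.
move=> /cvg_mxP cA; rewrite /determinant; apply: cvg_bigsum => s _.
by apply: cvgM; [exact: cvg_cst|apply: cvg_bigprod].
Qed.

(** Cramer's formula. [invmx] returns its argument on singular matrices, so the adjugate expression
    agrees with it only eventually, once the determinant is nonzero. *)
Lemma cvg_invmx {n : nat} (A_ : T -> 'M[R]_n) (A : 'M[R]_n) :
  A \in unitmx -> A_ @ F --> A -> invmx (A_ t) @[t --> F] --> invmx A.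
Proof.
move=> uA cA; have cdet := cvg_det cA.
have dA : \det A != 0 by rewrite -unitfE.
have uA_ : \forall t \near F, A_ t \in unitmx.
  have : \forall t \near F, \det (A_ t) != 0.
    exact: (cvgr_neq0 (\det A)).
  by apply: filterS => t; rewrite unitmxE unitfE.
have cadj : (\det (A_ t))^-1 *: \adj (A_ t) @[t --> F] --> (\det A)^-1 *: \adj A.
  apply: cvgZ; first exact: cvgV.
  apply/cvg_mxP => i j; under eq_fun do rewrite mxE; rewrite mxE /cofactor.
  apply: cvgM; first exact: cvg_cst.
  apply/cvg_det/cvg_mxP => k l; under eq_fun do rewrite !mxE; rewrite !mxE.
  by move/cvg_mxP: cA; apply.
rewrite {2}/invmx uA; apply: cvg_trans cadj; apply: near_eq_cvg.
by apply: filterS uA_ => t ut; rewrite /invmx ut.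
Qed.

Lemma cvg_tensmx {m n p q : nat} (A_ : T -> 'M[R]_(m, n)) (B_ : T -> 'M[R]_(p, q))
    (A : 'M[R]_(m, n)) (B : 'M[R]_(p, q)) :
  A_ @ F --> A -> B_ @ F --> B -> (A_ t *t B_ t) @[t --> F] --> A *t B.
Proof.
move=> /cvg_mxP cA /cvg_mxP cB; apply/cvg_mxP => i j.
under eq_fun do rewrite mxE; rewrite mxE.
exact: cvgM.
Qed.

End MatrixConvergence.

(** * The Euclidean norm and its neighbourhoods *)

Section EuclideanNorm.
Context {R : realType}.

Lemma enorm_ge0 {m n : nat} (A : 'M[R]_(m, n)) : 0 <= enorm A.
Proof. exact: sqrtr_ge0. Qed.

Lemma enorm2E {m n : nat} (A : 'M[R]_(m, n)) :
  enorm A ^+ 2 = \sum_i \sum_j A i j ^+ 2.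
Proof.
by rewrite sqr_sqrtr// sumr_ge0// => i _; rewrite sumr_ge0// => j _; exact: sqr_ge0.
Qed.

Lemma enorm2_tr {n : nat} (x : 'cV[R]_n) : enorm x ^+ 2 = (x^T *m x) 0 0.
Proof.
by rewrite enorm2E mxE; apply: eq_bigr => i _; rewrite big_ord1 !mxE expr2.
Qed.

Lemma enorm0 {m n : nat} : enorm (0 : 'M[R]_(m, n)) = 0.
Proof.
rewrite /enorm big1 ?sqrtr0// => i _; rewrite big1// => j _.
by rewrite mxE expr0n.
Qed.

Lemma mx_norm_le_enorm {m n : nat} (A : 'M[R]_(m, n)) : `|A| <= enorm A.
Proof.
apply: mx_norm_le (enorm_ge0 A) _ => i j.
rewrite -sqrtr_sqr ler_wsqrtr// (bigD1 i)//= (bigD1 j)//= -addrA lerDl.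
apply: addr_ge0; first by apply: sumr_ge0 => k _; exact: sqr_ge0.
by apply: sumr_ge0 => k _; apply: sumr_ge0 => l _; exact: sqr_ge0.
Qed.

Lemma enorm_continuous {m n : nat} : continuous (@enorm R m n).
Proof.
move=> A; rewrite /enorm; apply: continuous_comp; last exact: sqrt_continuous.
apply: (@cvg_bigsum _ _ (nbhs A)) => i _; apply: (@cvg_bigsum _ _ (nbhs A)) => j _.
rewrite expr2; under eq_fun do rewrite expr2.
by apply: (@cvgM _ _ (nbhs A)); exact: coord_continuous.
Qed.

Lemma Vnbhd_nbhs {m n : nat} (eps : R) (A0 A : 'M[R]_(m, n)) :
  Vnbhd eps A0 A -> nbhs A (Vnbhd eps A0).
Proof.
move=> eA; have c : enorm (C - A0) @[C --> A] --> enorm (A - A0).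
  apply: (@cvg_comp _ _ _ (fun C => C - A0) enorm); last exact: enorm_continuous.
  by apply: (@cvgB _ _ _ (nbhs A)); [exact: cvg_id|exact: cvg_cst].
exact: (cvgr_lt _ c _ eA).
Qed.

Lemma Vnbhd_center {m n : nat} (eps : R) (A : 'M[R]_(m, n)) :
  0 < eps -> Vnbhd eps A A.
Proof. by rewrite /Vnbhd/= subrr enorm0. Qed.

Lemma nbhs_Vnbhd {m n : nat} (A : 'M[R]_(m, n)) (U : set 'M[R]_(m, n)) :
  nbhs A U -> exists2 eps : R, 0 < eps & Vnbhd eps A `<=` U.
Proof.
move=> /nbhs_normP[e /= e0 eU]; exists e => // C; rewrite /Vnbhd/= => AC.
by apply: eU => /=; rewrite distrC (le_lt_trans (mx_norm_le_enorm _)).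
Qed.

End EuclideanNorm.

(** Common form of [jac] and [jacvec]: with the directions [e] as a parameter, the mean-value
    argument is made once for vectors and for matrices in [vec] coordinates. *)
Definition coord_jac {R : realType} {V : normedModType R} {K m : nat}
    (e : 'I_K -> V) (F : V -> 'cV[R]_m) (x : V) : 'M[R]_(m, K) :=
  \matrix_(i, k) 'D_(e k) (fun y => F y i 0) x.

Definition has_coord_jac {R : realType} {V : normedModType R} {K m : nat}
    (e : 'I_K -> V) (F : V -> 'cV[R]_m) (x : V) : Prop :=
  forall i k, derivable (fun y => F y i 0) x (e k).

(* [co] gives the coordinates in the basis [e]; shrinking coordinates does not
   increase the norm. *)
Definition unconditional_basis {R : realType} {V : normedModType R} {K : nat}
    (e : 'I_K -> V) (co : V -> 'cV[R]_K) : Prop :=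
  (forall x, \sum_k co x k 0 *: e k = x) /\
  (forall (s : 'I_K -> R) x, (forall k, 0 <= s k <= 1) ->
     `|\sum_k (s k * co x k 0) *: e k| <= `|x|) /\
  (forall x, `|co x| <= `|x|) /\ (forall a x, co (a *: x) = a *: co x).

Lemma cV_unconditional_basis {R : realType} {n : nat} :
  unconditional_basis (fun k : 'I_n => delta_mx k 0) (@id 'cV[R]_n).
Proof.
have E (u : 'I_n -> R) : \sum_k u k *: (delta_mx k 0 : 'cV[R]_n) = \col_k u k.
  apply/colP => i; rewrite summxE (bigD1 i)//= big1 => [|j ji].
    by rewrite !mxE !eqxx mulr1 addr0.
  by rewrite !mxE eq_sym (negbTE ji) mulr0.
split; first by move=> x; rewrite E; apply/colP => i; rewrite mxE.
split=> [s x s01|//]; rewrite E.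
apply: mx_norm_le => // i j; rewrite mxE normrM.
have /andP[s0 s1] := s01 i.
by rewrite ger0_norm// (le_trans (ler_piMl _ s1))// ler_mxE_norm.
Qed.

Lemma vec_unconditional_basis {R : realType} {m n : nat} :
  unconditional_basis (@vec_basis R m n) vec.
Proof.
have E (u : 'I_(n * m) -> R) : \sum_k u k *: (vec_basis k : 'M[R]_(m, n)) =
    \matrix_(i, j) u (mxtens_index (j, i)).
  apply/matrixP => i j; rewrite summxE (bigD1 (mxtens_index (j, i)))//= big1.
    by rewrite !mxE mxtens_indexK/= !eqxx mulr1 addr0.
  move=> k; case: (mxtens_indexP k) => j' i'.
  rewrite (can_eq (@mxtens_indexK n m)) xpair_eqE => ne.
  by rewrite !mxE mxtens_indexK/= andbC eq_sym [i == _]eq_sym (negbTE ne) mulr0.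
split; first by move=> x; rewrite E; apply/matrixP => i j; rewrite !mxE mxtens_indexK.
split; last first.
  split=> [x|a x]; last by apply/colP => k; rewrite !mxE.
  by apply: mx_norm_le => // i j; rewrite mxE ler_mxE_norm.
move=> s x s01; rewrite E.
apply: mx_norm_le => // i j; rewrite !mxE mxtens_indexK/= normrM.
have /andP[s0 s1] := s01 (mxtens_index (j, i)).
by rewrite ger0_norm// (le_trans (ler_piMl _ s1))// ler_mxE_norm.
Qed.

Section Hadamard.
Context {R : realType} {V : normedModType R} {K : nat}.
Variables (e : 'I_K -> V) (co : V -> 'cV[R]_K).
Hypothesis bas : unconditional_basis e co.

(** [mvt_box] for each component gives one row of [M]. Since the basis is unconditional, the
    intermediate points stay within distance [|x - x0|] of [x0]. *)
Lemma hadamard_point {m : nat} (F : V -> 'cV[R]_m) (x0 x : V) :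
  (forall y, `|y - x0| <= `|x - x0| -> has_coord_jac e F y) ->
  exists2 M : 'M[R]_(m, K), F x - F x0 = M *m co (x - x0) &
    forall i k, exists2 y, `|y - x0| <= `|x - x0| & M i k = coord_jac e F y i k.
Proof.
case: bas => bas1 [bas2 _] dF.
have row i : exists2 y : 'I_K -> V, (forall k, `|y k - x0| <= `|x - x0|) &
    F x i 0 - F x0 i 0 = \sum_k co (x - x0) k 0 * coord_jac e F (y k) i k.
  have [|s s01] := @mvt_box R V K e (fun y => F y i 0) x0 (fun k => co (x - x0) k 0).
    by move=> s s01 k; apply: dF; rewrite addrC addKr; exact: bas2.
  rewrite bas1 [x0 + (x - x0)]addrC subrK => E.
  exists (fun k => x0 + \sum_j (s k j * co (x - x0) j 0) *: e j).
    by move=> k; rewrite addrC addKr; exact: bas2.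
  by rewrite E; apply: eq_bigr => k _; rewrite mxE.
have /choice[y yP] : forall i, exists y : 'I_K -> V,
    (forall k, `|y k - x0| <= `|x - x0|) /\
    F x i 0 - F x0 i 0 = \sum_k co (x - x0) k 0 * coord_jac e F (y k) i k.
  by move=> i; have [y ? ?] := row i; exists y.
exists (\matrix_(i, k) coord_jac e F (y i k) i k).
  apply/colP => i; case: (yP i) => _ E; rewrite !mxE E.
  by apply: eq_bigr => k _; rewrite !mxE mulrC.
by move=> i k; exists (y i k); [case: (yP i)|rewrite mxE].
Qed.

(** The parameter [w] moves together with [x]: in the application [w] is the matrix of coefficients
    [C] and [x] is the optimum [xs C]. *)
Lemma hadamard {W : topologicalType} {m : nat} (H : W -> V -> 'cV[R]_m)
    (w0 : W) (x0 : V) :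
  (\forall u \near (w0, x0), has_coord_jac e (H u.1) u.2) ->
  coord_jac e (H u.1) u.2 @[u --> (w0, x0)] --> coord_jac e (H w0) x0 ->
  exists2 M : W -> V -> 'M[R]_(m, K),
    M u.1 u.2 @[u --> (w0, x0)] --> coord_jac e (H w0) x0 &
    \forall u \near (w0, x0), H u.1 u.2 - H u.1 x0 = M u.1 u.2 *m co (u.2 - x0).
Proof.
move=> dH cH.
pose good (u : W * V) := forall y, `|y - x0| <= `|u.2 - x0| ->
  has_coord_jac e (H u.1) y.
have near_ball (U : set (W * V)) : nbhs (w0, x0) U ->
    \forall u \near (w0, x0), forall y, `|y - x0| <= `|u.2 - x0| -> U (u.1, y).
  move=> [[A C] /= [Aw /nbhs_normP[r /= r0 Cx]] AC].
  exists (A, ball_ Num.norm x0 r) => /=.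
    by split => //; apply/nbhs_normP; exists r.
  move=> -[w x]/= [Aw' xr] y yx; apply: AC; split => //=; apply: Cx => /=.
  by rewrite distrC (le_lt_trans yx)// distrC.
have nearg : \forall u \near (w0, x0), good u by have := near_ball _ dH.
have /choice[M MP] : forall u : W * V, exists M : 'M[R]_(m, K), good u ->
    H u.1 u.2 - H u.1 x0 = M *m co (u.2 - x0) /\
    forall i k, exists2 y, `|y - x0| <= `|u.2 - x0| &
      M i k = coord_jac e (H u.1) y i k.
  move=> u; have [g|ng] := pselect (good u); last by exists 0 => /ng.
  by have [M ? ?] := hadamard_point g; exists M.
exists (fun w x => M (w, x)); last first.
  by apply: filterS nearg => -[w x] /MP[].
apply/cvg_mxP => i k; apply/cvgrPdist_lt => eps eps0.
move/cvg_mxP: cH => /(_ i k) /cvgrPdist_lt/(_ _ eps0)/near_ball.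
apply: filterS2 nearg => -[w x] /MP[_ /(_ i k)[y yx E]] /(_ _ yx) /=.
by rewrite E.
Qed.

Lemma hadamard1 {m : nat} (F : V -> 'cV[R]_m) (x0 : V) :
  (\forall y \near x0, has_coord_jac e F y) ->
  coord_jac e F y @[y --> x0] --> coord_jac e F x0 ->
  exists2 M : V -> 'M[R]_(m, K), M x @[x --> x0] --> coord_jac e F x0 &
    \forall x \near x0, F x - F x0 = M x *m co (x - x0).
Proof.
move=> dF cF.
have nbhs_snd (U : set V) : nbhs x0 U -> \forall u \near ((0 : R), x0), U u.2.
  by move=> nU; exists (setT, U); [split => //; exact: filterT|move=> u []].
(* A dummy real parameter, frozen at 0, reduces this to the parametric version. *)
have [||M cM ME] := @hadamard R m (fun _ => F) 0 x0.
- exact: nbhs_snd dF.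
- by move=> U /cF; exact: nbhs_snd.
have pair_cvg : (fun x : V => (0 : R, x)) @ x0 --> (0 : R, x0).
  apply: (@cvg_pair _ _ _ _ (nbhs (0 : R)) (nbhs x0)).
  exact: cvg_cst.
  exact: cvg_id.
exists (M 0); last exact: (pair_cvg _ ME).
exact: cvg_comp pair_cvg cM.
Qed.

(** * Differentiability through a slope that has a limit (Caratheodory) *)

Section Caratheodory.
Context {m : nat}.
Variables (F : V -> 'cV[R]_m) (x0 : V) (M : V -> 'M[R]_(m, K)) (J : 'M[R]_(m, K)).
Hypothesis cM : M x @[x --> x0] --> J.
Hypothesis ME : \forall x \near x0, F x - F x0 = M x *m co (x - x0).

Lemma continuous_of_slope : {for x0, continuous F}.
Proof.
case: bas => _ [_ [co_le _]].
have cco : co (x - x0) @[x --> x0] --> (0 : 'cV[R]_K).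
  apply/cvgrPdist_lt => r r0; apply/nbhs_normP; exists r => // x /= xr.
  by rewrite sub0r normrN (le_lt_trans (co_le _))// distrC.
have c0 : F x0 + M x *m co (x - x0) @[x --> x0] --> F x0.
  rewrite -[X in _ --> X]addr0 -(mulmx0 _ J).
  apply: cvgD; first exact: cvg_cst.
  exact: cvg_mulmx.
apply: cvg_trans c0; apply: near_eq_cvg.
by apply: filterS ME => x Ex; rewrite -Ex addrC subrK.
Qed.

Lemma is_derive_of_slope (v : V) i :
  is_derive x0 v (fun y => F y i 0) ((J *m co v) i 0).
Proof.
case: bas => _ [_ [_ coZ]].
have cv : (fun h : R => h *: v + x0) @ 0^' --> x0.
  rewrite -[X in _ --> X]add0r -(scale0r v).
  apply: (@cvgD _ _ _ (0^')); last exact: cvg_cst.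
  apply: cvgZr_tmp; exact: nbhs_dnbhs.
have c : (M (h *: v + x0) *m co v) i 0 @[h --> 0^'] --> (J *m co v) i 0.
  have : M (h *: v + x0) *m co v @[h --> 0^'] --> J *m co v.
    by apply: cvg_mulmx; [exact: cvg_comp cv cM|exact: cvg_cst].
  by move/cvg_mxP; exact.
have E : \forall h \near 0^', h^-1 *: (F (h *: v + x0) i 0 - F x0 i 0) =
    (M (h *: v + x0) *m co v) i 0.
  have ME' : \forall h \near 0^', F (h *: v + x0) - F x0 = M (h *: v + x0) *m co (h *: v + x0 - x0).
    exact: (cv _ ME).
  have h_neq0 : \forall h \near (0 : R)^', h != 0 by exact: nbhs_dnbhs_neq.
  apply: filterS2 ME' h_neq0 => h Eh h0.
  have -> : F (h *: v + x0) i 0 - F x0 i 0 = (F (h *: v + x0) - F x0) i 0.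
    by rewrite !mxE.
  by rewrite Eh addrK coZ -scalemxAr mxE [_ *: _]mulrA mulVf// mul1r.
have cc : h^-1 *: (F (h *: v + x0) i 0 - F x0 i 0) @[h --> 0^'] --> (J *m co v) i 0.
  apply: cvg_trans c; apply: near_eq_cvg.
  by apply: filterS E => h ->.
split; first by apply/cvg_ex; exists ((J *m co v) i 0).
exact/cvg_lim.
Qed.

Lemma frechet_of_slope (eps : R) : 0 < eps -> \forall x \near x0,
    `|F x - F x0 - J *m co (x - x0)| <= eps * `|x - x0|.
Proof.
move=> eps0; case: bas => _ [_ [co_le _]].
(* Each of the [K] terms of a row may use this share of [eps]; [K.+1] keeps the denominator positive
   when [K] is 0. *)
have d0 : 0 < eps / K.+1%:R by rewrite divr_gt0// ltr0n.
move/cvgrPdist_lt: cM => /(_ _ d0); apply: filterS2 ME => x -> Mx.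
rewrite -mulmxBl; apply: mx_norm_le => [|i j].
  by rewrite mulr_ge0// ltW.
rewrite mxE (le_trans (ler_norm_sum _ _ _))//.
apply: (@le_trans _ _ (\sum_(k < K) eps / K.+1%:R * `|x - x0|)).
  apply: ler_sum => k _; rewrite normrM ler_pM//.
    by rewrite (le_trans (ler_mxE_norm _ _ _))// distrC ltW.
  by rewrite (le_trans (ler_mxE_norm _ _ _)).
rewrite sumr_const card_ord -[_ *+ K]mulr_natr.
have -> : eps / K.+1%:R * `|x - x0| * K%:R = K%:R / K.+1%:R * (eps * `|x - x0|) by ring.
rewrite ler_piMl//; first by rewrite mulr_ge0// ltW.
by rewrite ler_pdivrMr ?ltr0n// mul1r ler_nat leqnSn.
Qed.

Hypothesis co_e : forall k, co (e k) = delta_mx k 0.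

Lemma coord_jac_of_slope : has_coord_jac e F x0 /\ coord_jac e F x0 = J.
Proof.
split=> [i k|]; first by case: (is_derive_of_slope (e k) i).
apply/matrixP => i k; rewrite mxE.
have -> := @derive_val _ _ _ _ _ _ _ (is_derive_of_slope (e k) i).
rewrite co_e mxE (bigD1 k)//= big1 => [|l lk].
  by rewrite mxE !eqxx mulr1 addr0.
by rewrite mxE (negbTE lk) mulr0.
Qed.

End Caratheodory.

Lemma continuous_of_coord_jac {m : nat} (F : V -> 'cV[R]_m) (x0 : V) :
  (\forall y \near x0, has_coord_jac e F y) ->
  coord_jac e F y @[y --> x0] --> coord_jac e F x0 ->
  {for x0, continuous F}.
Proof. by move=> dF cF; have [M cM ME] := hadamard1 dF cF; exact: continuous_of_slope cM ME. Qed.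

Lemma is_derive_coord_jac {m : nat} (F : V -> 'cV[R]_m) (x0 v : V) i :
  (\forall y \near x0, has_coord_jac e F y) ->
  coord_jac e F y @[y --> x0] --> coord_jac e F x0 ->
  is_derive x0 v (fun y => F y i 0) ((coord_jac e F x0 *m co v) i 0).
Proof. by move=> dF cF; have [M cM ME] := hadamard1 dF cF; exact: is_derive_of_slope cM ME v i. Qed.

End Hadamard.

Lemma sum_ord_const {R : realType} (n : nat) (a : R) : \sum_(i < n) a = n%:R * a.
Proof. by rewrite sumr_const card_ord mulr_natl. Qed.

(** * Quadratic forms and second-order growth *)

Section QuadraticForms.
Context {R : realType} {n : nat}.
Implicit Types (P D : 'M[R]_n) (t v : 'cV[R]_n).

Definition quadratic (P : 'M[R]_n) (t : 'cV[R]_n) : R := (t^T *m P *m t) 0 0.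

Definition vdot (u v : 'cV[R]_n) : R := (u^T *m v) 0 0.

Lemma vdotE (u v : 'cV[R]_n) : vdot u v = \sum_i u i 0 * v i 0.
Proof. by rewrite /vdot mxE; apply: eq_bigr => i _; rewrite mxE. Qed.

Lemma vdotC (u v : 'cV[R]_n) : vdot u v = vdot v u.
Proof. by rewrite !vdotE; apply: eq_bigr => i _; rewrite mulrC. Qed.

Lemma vdotDr (u v w : 'cV[R]_n) : vdot u (v + w) = vdot u v + vdot u w.
Proof. by rewrite /vdot mulmxDr mxE. Qed.

Lemma vdotZr (a : R) (u v : 'cV[R]_n) : vdot u (a *: v) = a * vdot u v.
Proof. by rewrite /vdot -scalemxAr mxE. Qed.

Lemma vdotNr (u v : 'cV[R]_n) : vdot u (- v) = - vdot u v.
Proof. by rewrite -scaleN1r vdotZr mulN1r. Qed.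

Lemma vdotDl (u v w : 'cV[R]_n) : vdot (v + w) u = vdot v u + vdot w u.
Proof. by rewrite ![vdot _ u]vdotC vdotDr. Qed.

Lemma vdotZl (a : R) (u v : 'cV[R]_n) : vdot (a *: v) u = a * vdot v u.
Proof. by rewrite ![vdot _ u]vdotC vdotZr. Qed.

Lemma vdotNl (u v : 'cV[R]_n) : vdot (- v) u = - vdot v u.
Proof. by rewrite ![vdot _ u]vdotC vdotNr. Qed.

Lemma vdot_sum_sqr t : vdot t t = \sum_i t i 0 ^+ 2.
Proof. by rewrite vdotE; apply: eq_bigr => i _; rewrite expr2. Qed.

Lemma vdot_ge0 t : 0 <= vdot t t.
Proof. by rewrite vdot_sum_sqr sumr_ge0// => i _; exact: sqr_ge0. Qed.

Lemma sqr_le_vdot t i : t i 0 ^+ 2 <= vdot t t.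
Proof.
rewrite vdot_sum_sqr (bigD1 i)//= lerDl sumr_ge0// => j _; exact: sqr_ge0.
Qed.

Lemma sqr_norm_le_vdot t : `|t| ^+ 2 <= vdot t t.
Proof.
rewrite -[leRHS](sqr_sqrtr (vdot_ge0 t)) ler_sqr ?nnegrE ?sqrtr_ge0//.
apply: mx_norm_le (sqrtr_ge0 _) _ => i j; rewrite (ord1 j) -sqrtr_sqr.
by rewrite ler_wsqrtr// sqr_le_vdot.
Qed.

Lemma vdot_gt0 t : t != 0 -> 0 < vdot t t.
Proof.
move=> t0; apply: lt_le_trans (sqr_norm_le_vdot t).
by rewrite exprn_gt0// normr_gt0.
Qed.

Lemma normr_vdot (u v : 'cV[R]_n) : `|vdot u v| <= n%:R * (`|u| * `|v|).
Proof.
rewrite vdotE (le_trans (ler_norm_sum _ _ _))//.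
apply: (@le_trans _ _ (\sum_(k < n) `|u| * `|v|)).
  by apply: ler_sum => k _; rewrite normrM ler_pM// ler_mxE_norm.
by rewrite sum_ord_const.
Qed.

Lemma quadraticE P t : quadratic P t = \sum_i \sum_j P i j * (t i 0 * t j 0).
Proof.
rewrite /quadratic -mulmxA mxE; apply: eq_bigr => i _.
rewrite !mxE mulr_sumr; apply: eq_bigr => j _; ring.
Qed.

Lemma quadraticD P D t : quadratic (P + D) t = quadratic P t + quadratic D t.
Proof. by rewrite /quadratic mulmxDr mulmxDl mxE. Qed.

Lemma quadraticN P t : quadratic (- P) t = - quadratic P t.
Proof. by rewrite /quadratic mulmxN mulNmx mxE. Qed.

Lemma normr_quadratic P t :
  `|quadratic P t| <= n%:R ^+ 2 * `|P| * vdot t t.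
Proof.
rewrite quadraticE (le_trans (ler_norm_sum _ _ _))//.
apply: (@le_trans _ _ (\sum_(i < n) \sum_(j < n) `|P| * vdot t t)); last first.
  by rewrite !sum_ord_const mulrA mulrA expr2.
apply: ler_sum => i _; rewrite (le_trans (ler_norm_sum _ _ _))//.
apply: ler_sum => j _; rewrite normrM ler_pM ?ler_mxE_norm//.
have hi := sqr_le_vdot t i; have hj := sqr_le_vdot t j.
have h1 := sqr_ge0 (t i 0 - t j 0); have h2 := sqr_ge0 (t i 0 + t j 0).
by rewrite ler_norml; apply/andP; split; nra.
Qed.

Lemma pdmx_unit P : pdmx P -> P \in unitmx.
Proof.
move=> [PT Ppos]; rewrite -row_free_unit -kermx_eq0; apply: contraT => K0.
have [i Hi] : exists i, row i (kermx P) != 0.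
  by apply/existsP; rewrite -negb_forall; apply: contraNN K0 => /forallP H;
    apply/eqP/row_matrixP => i; rewrite row0; apply/eqP.
have t0 : (row i (kermx P))^T != 0.
  by apply: contraNneq Hi => /(congr1 trmx); rewrite trmxK trmx0 => ->.
have := Ppos _ t0; rewrite trmxK.
have -> : row i (kermx P) *m P = 0 by rewrite -row_mul mulmx_ker row0.
by rewrite mul0mx mxE ltxx.
Qed.

(* With [K >= t' P^-1 t / t't], expand the form at [t - (1/K) P^-1 t]. *)
Lemma pdmx_lower P : pdmx P ->
  exists2 m : R, 0 < m & forall t, m * vdot t t <= quadratic P t.
Proof.
move=> pdP; have [PT Ppos] := pdP; have uP := pdmx_unit pdP.
have Pge0 t : 0 <= quadratic P t.
  have [->|/Ppos/ltW//] := eqVneq t 0.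
  by rewrite /quadratic mulmx0 mxE.
pose K : R := n%:R ^+ 2 * `|invmx P| + 1.
have K0 : 0 < K by rewrite ltr_wpDl// mulr_ge0// exprn_ge0.
exists (K^-1)%R; first by rewrite invr_gt0.
move=> t; pose s := invmx P *m t.
have ts : vdot t s <= K * vdot t t.
  have -> : vdot t s = quadratic (invmx P) t by rewrite /vdot /quadratic mulmxA.
  rewrite (le_trans (ler_norm _))// (le_trans (normr_quadratic _ _))//.
  by rewrite ler_wpM2r ?vdot_ge0// lerDl.
have Ps : P *m s = t by rewrite mulmxA mulmxV// mul1mx.
have sP : s^T *m P = t^T.
  by rewrite -[LHS]trmxK trmx_mul trmxK PT Ps.
have := Pge0 (t - K^-1 *: s).
have -> : quadratic P (t - K^-1 *: s) =
    quadratic P t - 2 * K^-1 * vdot t t + K^-1 ^+ 2 * vdot t s.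
  have quadE u : quadratic P u = vdot u (P *m u) by rewrite /quadratic /vdot mulmxA.
  have sPt : vdot s (P *m t) = vdot t t by rewrite /vdot mulmxA sP.
  rewrite !quadE mulmxBr -scalemxAr Ps !(vdotDl, vdotDr, vdotNl, vdotNr, vdotZl, vdotZr).
  by rewrite sPt [vdot s t]vdotC; ring.
have : K^-1 ^+ 2 * vdot t s <= K^-1 * vdot t t.
  rewrite expr2 -mulrA ler_wpM2l ?invr_ge0//; first exact: ltW.
  by rewrite ler_pdivrMl.
lra.
Qed.

(** Replacing [P] by [D] changes the form at [t] by at most [n^2 |P - D| t't], which is absorbed by
    giving up half of the constant. This supplies strong convexity uniformly around an optimum. *)
Lemma pdmx_lower_nbhs P : pdmx P ->
  exists2 m : R, 0 < m & \forall D \near P, forall t, m * vdot t t <= quadratic D t.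
Proof.
move=> /pdmx_lower[m m0 mP]; exists (m / 2); first by rewrite divr_gt0.
have n0 : 0 < n.+1%:R ^+ 2 :> R by rewrite exprn_gt0// ltr0n.
apply/nbhs_normP; exists (m / 2 / n.+1%:R ^+ 2); first by rewrite /= !divr_gt0.
move=> D /= PD t; have := mP t.
have -> : D = P - (P - D) by rewrite opprB addrC subrK.
rewrite quadraticD quadraticN; set Q := P - D.
have : `|quadratic Q t| <= m / 2 * vdot t t.
  rewrite (le_trans (normr_quadratic _ _))// ler_wpM2r ?vdot_ge0//.
  rewrite (@le_trans _ _ (n.+1%:R ^+ 2 * (m / 2 / n.+1%:R ^+ 2)))//.
    rewrite ler_pM ?exprn_ge0//; last exact: ltW.
    by rewrite ler_sqr ?nnegrE// ler_nat.
  by rewrite mulrC divfK// gt_eqF.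
rewrite ler_norml => /andP[_]; lra.
Qed.

End QuadraticForms.

Lemma taylor2_ge {R : realType} (l q h : R -> R) (m : R) :
  (forall t : R, 0 <= t <= 1 -> is_derive t 1 l (q t)) ->
  (forall t : R, 0 <= t <= 1 -> is_derive t 1 q (h t)) ->
  (forall t : R, 0 <= t <= 1 -> m <= h t) ->
  l 0 + q 0 + m / 2 <= l 1.
Proof.
move=> dl dq mh.
have mvt01 (g dg : R -> R) (b : R) : 0 <= b <= 1 ->
    (forall t : R, 0 <= t <= 1 -> is_derive t 1 g (dg t)) ->
    exists2 c, 0 <= c <= b & g b - g 0 = dg c * b.
  move=> /andP[b0 b1] dg'.
  have le1 t : t <= b -> t <= 1 by move=> /le_trans; apply.
  have [||c] := @MVT_segment _ g dg 0 b b0.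
  - move=> t; rewrite in_itv/= => /andP[/ltW ? /ltW/le1 ?].
    by apply: dg'; apply/andP.
  - apply: continuous_in_subspaceT => t; rewrite inE/= in_itv/= => /andP[? /le1 ?].
    by have [|/derivable1_diffP/differentiable_continuous//] := dg' t; first exact/andP.
  - by rewrite in_itv/= => ?; rewrite subr0; exists c.
(* Subtracting the quadratic leaves a function with derivative [q t - q 0 - m t], which the mean
   value theorem for [q] shows to be nonnegative. *)
pose k t := l t - t * q 0 - m / 2 * t ^+ 2.
have dk (t : R) : 0 <= t <= 1 -> is_derive t 1 k (q t - q 0 - m * t).
  move=> t01; have := dl t t01 => ?.
  apply: is_derive_eq; rewrite /GRing.scale/=; lra.
have [|c /andP[c0 c1]] := mvt01 k _ 1 _ dk; first by rewrite ler01 lexx.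
have [|b /andP[b0 bc]] := mvt01 q h c _ dq; first by rewrite c0.
have : m <= h b by apply: mh; rewrite b0 (le_trans bc).
rewrite /k => mb E1 E2; nra.
Qed.

Lemma is_derive_grad {R : realType} {n : nat} (g : 'cV[R]_n -> R) (y v : 'cV[R]_n) :
  (\forall x \near y, has_grad g x) -> {for y, continuous (grad g)} ->
  is_derive y v g (vdot (grad g y) v).
Proof.
move=> dg cg.
have E x : coord_jac (fun k : 'I_n => delta_mx k 0) (fun x => \col_(_ < 1) g x) x = (grad g x)^T.
  apply/matrixP => i k; rewrite !mxE; congr ('D_(_) _ x).
  by apply/funext => z; rewrite mxE.
have gE (i : 'I_1) : (fun x => (\col_(_ < 1) g x) i 0) = g.
  by apply/funext => z; rewrite mxE.
have := @is_derive_coord_jac R _ n _ _ cV_unconditional_basis 1 (fun x => \col_(_ < 1) g x) y v 0.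
rewrite gE E; apply.
  by apply: filterS dg => x dx i k; rewrite gE; exact: dx.
by rewrite (_ : coord_jac _ _ = fun x => (grad g x)^T); [exact: (@cvg_trmx _ _ (nbhs y))|exact/funext].
Qed.

Lemma second_order_growth {R : realType} {n : nat} (g : 'cV[R]_n -> R)
    (U : set 'cV[R]_n) (x v : 'cV[R]_n) (m : R) :
  open U ->
  (forall y, U y -> [/\ has_grad g y, has_jac (grad g) y &
     {for y, continuous (jac (grad g))}]) ->
  (forall t : R, 0 <= t <= 1 -> U (x + t *: v)) ->
  (forall y, U y -> m <= quadratic (jac (grad g) y) v) ->
  g x + vdot (grad g x) v + m / 2 <= g (x + v).
Proof.
move=> oU dU sU mU.
have nU y : U y -> \forall z \near y, U z by move=> Uy; exact: open_nbhs_nbhs.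
have cgrad y : U y -> {for y, continuous (grad g)}.
  move=> Uy; apply: (@continuous_of_coord_jac R _ n _ _ cV_unconditional_basis n (grad g) y).
    by apply: filterS (nU y Uy) => z /dU[].
  by case: (dU y Uy).
have D1 (t : R) : 0 <= t <= 1 ->
    is_derive t 1 (fun s : R => g (x + s *: v)) (vdot (grad g (x + t *: v)) v).
  move=> /sU Ut.
  have [|dg <-] := @is_derive_grad R n g (x + t *: v) v _ (cgrad _ Ut).
    by apply: filterS (nU _ Ut) => z /dU[].
  exact: is_derive_line.
have D2 (t : R) : 0 <= t <= 1 ->
    is_derive t 1 (fun s : R => vdot (grad g (x + s *: v)) v)
      (quadratic (jac (grad g) (x + t *: v)) v).
  move=> /sU Ut.
  have Di (i : 'I_n) : is_derive t 1 (fun s : R => v i 0 * grad g (x + s *: v) i 0)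
      (v i 0 * (jac (grad g) (x + t *: v) *m v) i 0).
    have [||dg <-] := @is_derive_coord_jac R _ n _ _ cV_unconditional_basis n (grad g) (x + t *: v) v i.
    - by apply: filterS (nU _ Ut) => z /dU[].
    - by case: (dU _ Ut).
    have := is_derive_line dg => ?.
    exact: (is_deriveZ (v i 0)).
  have -> : (fun s : R => vdot (grad g (x + s *: v)) v) =
      \sum_i (fun s : R => v i 0 * grad g (x + s *: v) i 0).
    apply/funext => s; rewrite fct_sumE vdotE; apply: eq_bigr => i _.
    by rewrite mulrC.
  have -> : quadratic (jac (grad g) (x + t *: v)) v =
      \sum_i v i 0 * (jac (grad g) (x + t *: v) *m v) i 0.
    by rewrite -vdotE /quadratic /vdot mulmxA.
  exact: is_derive_sum.
have := taylor2_ge D1 D2 (fun t t01 => mU _ (sU t t01)).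
by rewrite scale0r addr0 scale1r.
Qed.

(** * Dependence of the optimum on the parameter *)

Section Lagrangian.
Context {R : realType} {n r : nat} (f : 'cV[R]_r -> R) (c : R).
Implicit Types (Bh : 'M[R]_(nbterms n, r)) (x : 'cV[R]_n) (lam : R).

Lemma enorm2_vdot x : enorm x ^+ 2 = vdot x x.
Proof. exact: enorm2_tr. Qed.

Lemma is_derive_enorm2 x (v : 'cV[R]_n) :
  is_derive x v (fun y : 'cV[R]_n => enorm y ^+ 2) (2 * vdot x v).
Proof.
have Dc (i : 'I_n) : is_derive x v (fun y : 'cV[R]_n => y i 0) (v i 0).
  have cv : h^-1 *: ((h *: v + x) i 0 - x i 0) @[h --> 0^'] --> v i 0.
    apply: (@cvg_trans _ (v i 0 @[h --> (0 : R)^'])); last exact: cvg_cst.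
    apply: near_eq_cvg; apply: filterS (nbhs_dnbhs_neq (0 : R)) => h h0.
    by rewrite !mxE addrK [_ *: _]mulrA mulVf// mul1r.
  by split; [apply/cvg_ex; exists (v i 0)|exact/cvg_lim].
have -> : (fun y : 'cV[R]_n => enorm y ^+ 2) = \sum_i (fun y : 'cV[R]_n => y i 0) ^+ 2.
  by apply/funext => y; rewrite enorm2_vdot vdot_sum_sqr fct_sumE.
have -> : 2 * vdot x v = \sum_i (2%:R * x i 0 ^+ 1) *: v i 0.
  by rewrite vdotE mulr_sumr; apply: eq_bigr => i _; rewrite expr1; exact: mulrA.
apply: is_derive_sum => i.
exact: is_deriveX (Dc i).
Qed.

Lemma L_lamE Bh x lam : L_lam f c Bh x lam = enorm x ^+ 2 - c ^+ 2.
Proof.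
rewrite /L_lam.
have -> : (fun l : R => lagrangian f c Bh x l) =
    (fun=> f (surface Bh x)) + (enorm x ^+ 2 - c ^+ 2) *: (@id R).
  by apply/funext => l; rewrite /lagrangian [X in _ = _ + X]mulrC.
have -> := @derive_val _ _ _ _ _ _ _ (is_deriveD (is_derive_cst (f (surface Bh x)) lam (1 : R))
  (is_deriveZ (enorm x ^+ 2 - c ^+ 2) (is_derive_id lam (1 : R)))).
by rewrite add0r [LHS]mulr1.
Qed.

Lemma L_lamxE Bh x lam : L_lamx f c Bh x lam = 2 *: x.
Proof.
apply/colP => i; rewrite !mxE.
have -> : (fun y => L_lam f c Bh y lam) =
    (fun y : 'cV[R]_n => enorm y ^+ 2) - cst (c ^+ 2).
  by apply/funext => y; rewrite L_lamE.
have dx := is_derive_enorm2 x (delta_mx i 0).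
have -> := @derive_val _ _ _ _ _ _ _ (is_deriveB dx (is_derive_cst (c ^+ 2) x (delta_mx i 0))).
rewrite subr0 vdotE (bigD1 i)//= big1 => [|j ji].
  by rewrite mxE !eqxx mulr1 addr0.
by rewrite mxE (negbTE ji) mulr0.
Qed.

Lemma L_xE Bh x lam : has_grad (fun y => f (surface Bh y)) x ->
  L_x f c Bh x lam = grad (fun y => f (surface Bh y)) x + (2 * lam) *: x.
Proof.
move=> dg; apply/colP => i; rewrite !mxE.
have dx := is_derive_enorm2 x (delta_mx i 0).
have D := is_deriveD (derivableP (dg i))
  (is_deriveZ lam (is_deriveB dx (is_derive_cst (c ^+ 2) x (delta_mx i 0)))).
rewrite (_ : (fun y => lagrangian f c Bh y lam) = (fun y => f (surface Bh y)) +
    lam *: ((fun y : 'cV[R]_n => enorm y ^+ 2) - cst (c ^+ 2)))//.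
have -> := @derive_val _ _ _ _ _ _ _ D.
congr (_ + _); rewrite subr0 vdotE (bigD1 i)//= big1 => [|j ji].
  by rewrite mxE !eqxx mulr1 addr0 [LHS]mulrA [lam * 2]mulrC.
by rewrite mxE (negbTE ji) mulr0.
Qed.

(** The gradient is affine in the multiplier. This permits freezing the multiplier at its old value
    while the parameter and the point vary. *)
Lemma L_x_lam Bh x lam lam' : has_grad (fun y => f (surface Bh y)) x ->
  L_x f c Bh x lam = L_x f c Bh x lam' + (2 * (lam - lam')) *: x.
Proof.
by move=> dg; rewrite !L_xE// -addrA -scalerDl; congr (_ + _ *: _); ring.
Qed.

End Lagrangian.

Lemma enorm2_convex {R : realType} {n : nat} (x y : 'cV[R]_n) (t : R) :
  0 <= t <= 1 ->
  enorm (t *: x + (1 - t) *: y) ^+ 2 <= t * enorm x ^+ 2 + (1 - t) * enorm y ^+ 2.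
Proof.
move=> /andP[t0 t1]; rewrite !enorm2_vdot.
have : 0 <= t * (1 - t) * vdot (x - y) (x - y).
  by rewrite mulr_ge0 ?vdot_ge0// mulr_ge0// subr_ge0.
rewrite !(vdotDl, vdotDr, vdotNl, vdotNr, vdotZl, vdotZr) [vdot y x]vdotC; nra.
Qed.

Lemma cvg_pair_map {T : Type} {U V : topologicalType} {F : set_system T} {FF : Filter F}
    (f : T -> U) (g : T -> V) (x : U) (y : V) :
  f @ F --> x -> g @ F --> y -> (f t, g t) @[t --> F] --> (x, y).
Proof.
exact: cvg_pair.
Qed.

Lemma cvg_stack {R : realType} {n : nat} {T : Type} {F : set_system T} {FF : Filter F}
    (x_ : T -> 'cV[R]_n) (l_ : T -> R) x l :
  x_ @ F --> x -> l_ @ F --> l -> stack (x_ t) (l_ t) @[t --> F] --> stack x l.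
Proof.
move=> cx cl; apply/cvg_mxP => i j; rewrite /stack.
under eq_fun do rewrite mxE; rewrite mxE; case: (fintype.split i) => k.
  by move/cvg_mxP: cx; exact.
by under eq_fun do rewrite mxE; rewrite mxE (ord1 k) (ord1 j) eqxx.
Qed.

(** * Continuity of the optimal solution *)

Section Program.
Context {R : realType} {n r : nat}.
Variables (f : 'cV[R]_r -> R) (c : R) (B : 'M[R]_(nbterms n, r)).
Variables (xs : 'M[R]_(nbterms n, r) -> 'cV[R]_n) (ls : 'M[R]_(nbterms n, r) -> R).
Variable eps : R.
Hypothesis eps_gt0 : 0 < eps.
Hypothesis f_convex : forall Bh, Vnbhd eps B Bh ->
  strictly_convex (fun x : 'cV[R]_n => f (surface Bh x)).
Hypothesis xs_opt : forall Bh, Vnbhd eps B Bh -> unique_minimizer f c Bh (xs Bh).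
Hypothesis xs_ls_kkt : forall Bh, Vnbhd eps B Bh -> forall x lam,
  kuhn_tucker f c Bh x lam <-> x = xs Bh /\ lam = ls Bh.
Hypothesis L_C2 : forall Bh, Vnbhd eps B Bh -> forall x lam,
  Vnbhd eps (stack (xs B) (ls B)) (stack x lam) ->
  [/\ has_second_derivatives f c Bh x lam,
      second_derivatives_continuous f c Bh x lam &
      pdmx (L_xx f c Bh x lam)].

(** The parameters at whose optimum and multiplier [L_C2] can be invoked. The second condition holds
    near [B] only once [xs] and [ls] are known to be continuous. *)
Definition regular (Bh : 'M[R]_(nbterms n, r)) : Prop :=
  Vnbhd eps B Bh /\ Vnbhd eps (stack (xs B) (ls B)) (stack (xs Bh) (ls Bh)).

Lemma regular_center : regular B.
Proof. by split; exact: Vnbhd_center. Qed.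

Lemma kkt_solution Bh : Vnbhd eps B Bh -> kuhn_tucker f c Bh (xs Bh) (ls Bh).
Proof. by move=> VB; apply/xs_ls_kkt. Qed.

Lemma cvg_L_xx_comp {T : Type} {F : set_system T} {FF : Filter F}
    (B_ : T -> 'M[R]_(nbterms n, r)) (x_ : T -> 'cV[R]_n) (l_ : T -> R) Bh x l :
  Vnbhd eps B Bh -> Vnbhd eps (stack (xs B) (ls B)) (stack x l) ->
  B_ @ F --> Bh -> x_ @ F --> x -> l_ @ F --> l ->
  L_xx f c (B_ t) (x_ t) (l_ t) @[t --> F] --> L_xx f c Bh x l.
Proof.
move=> VB Vx cB cx cl; have [_ [C _ _ _ _] _] := L_C2 VB Vx.
exact: (cvg_comp _ _ (cvg_pair_map (cvg_pair_map cx cl) cB) C).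
Qed.

Lemma cvg_L_xB_comp {T : Type} {F : set_system T} {FF : Filter F}
    (B_ : T -> 'M[R]_(nbterms n, r)) (x_ : T -> 'cV[R]_n) (l_ : T -> R) Bh x l :
  Vnbhd eps B Bh -> Vnbhd eps (stack (xs B) (ls B)) (stack x l) ->
  B_ @ F --> Bh -> x_ @ F --> x -> l_ @ F --> l ->
  L_xB f c (B_ t) (x_ t) (l_ t) @[t --> F] --> L_xB f c Bh x l.
Proof.
move=> VB Vx cB cx cl; have [_ [_ C _ _ _] _] := L_C2 VB Vx.
exact: (cvg_comp _ _ (cvg_pair_map (cvg_pair_map cx cl) cB) C).
Qed.

Lemma near_domain Bh : regular Bh ->
  \forall u \near (Bh, xs Bh), Vnbhd eps B u.1 /\
    Vnbhd eps (stack (xs B) (ls B)) (stack u.2 (ls Bh)).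
Proof.
move=> [/Vnbhd_nbhs VB /Vnbhd_nbhs Vx].
have cs : stack x (ls Bh) @[x --> xs Bh] --> stack (xs Bh) (ls Bh).
  apply: (@cvg_stack _ _ _ (nbhs (xs Bh))); last exact: cvg_cst.
  exact: cvg_id.
exists (Vnbhd eps B, fun x => Vnbhd eps (stack (xs B) (ls B)) (stack x (ls Bh))).
  by split => //; exact: cs.
by move=> u [].
Qed.

Lemma L_x_solution Bh : Vnbhd eps B Bh -> L_x f c Bh (xs Bh) (ls Bh) = 0.
Proof. by move=> /kkt_solution[[dg E] _ _ _]; rewrite L_xE. Qed.

Lemma near_has_jac Bh : regular Bh ->
  \forall u \near (Bh, xs Bh),
    has_coord_jac (fun k : 'I_n => delta_mx k 0) (fun x => L_x f c u.1 x (ls Bh)) u.2.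
Proof.
by move=> /near_domain; apply: filterS => u [VB Vx]; have [[[_ _ ? _] _] _ _] := L_C2 VB Vx.
Qed.

Lemma cvg_L_xx Bh : regular Bh ->
  L_xx f c u.1 u.2 (ls Bh) @[u --> (Bh, xs Bh)] --> L_xx f c Bh (xs Bh) (ls Bh).
Proof.
move=> [VB Vx]; apply: cvg_L_xx_comp => //; last exact: cvg_cst.
  exact: cvg_fst.
exact: cvg_snd.
Qed.

Lemma near_has_jacvec Bh : regular Bh ->
  \forall C \near Bh, has_coord_jac (@vec_basis R _ _) (fun C => L_x f c C (xs Bh) (ls Bh)) C.
Proof.
move=> [VB Vx]; apply: filterS (Vnbhd_nbhs VB) => C VC.
by have [[[_ _ _ ?] _] _ _] := L_C2 VC Vx.
Qed.

Lemma cvg_L_xB Bh : regular Bh ->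
  L_xB f c C (xs Bh) (ls Bh) @[C --> Bh] --> L_xB f c Bh (xs Bh) (ls Bh).
Proof.
move=> [VB Vx]; apply: (@cvg_L_xB_comp _ (nbhs Bh)) => //; first [exact: cvg_cst|exact: cvg_id].
Qed.

Lemma cvg_L_x_parameter Bh : regular Bh ->
  L_x f c C (xs Bh) (ls Bh) @[C --> Bh] --> (0 : 'cV[R]_n).
Proof.
move=> rB; rewrite -(L_x_solution (proj1 rB)).
apply: (@continuous_of_coord_jac R _ _ _ _ vec_unconditional_basis n
  (fun C => L_x f c C (xs Bh) (ls Bh)) Bh).
  exact: near_has_jacvec.
exact: cvg_L_xB.
Qed.

(** New parameter [C], old multiplier [ls Bh]. The objective does not increase, by convexity and
    because [xs Bh] is feasible for the program at [C]. The penalty term vanishes at [xs Bh] by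
    complementary slackness and is nonpositive on the segment, whose points are feasible, since
    [ls Bh] is nonnegative. *)
Lemma lagrangian_segment Bh C (t : R) : Vnbhd eps B Bh -> Vnbhd eps B C -> 0 <= t <= 1 ->
  lagrangian f c C (xs Bh + t *: (xs C - xs Bh)) (ls Bh) <= lagrangian f c C (xs Bh) (ls Bh).
Proof.
move=> VB VC t01; have /andP[t0 t1] := t01.
have -> : xs Bh + t *: (xs C - xs Bh) = t *: xs C + (1 - t) *: xs Bh.
  by apply/colP => i; rewrite !mxE; ring.
have [_ feas compl l0] := kkt_solution VB.
have [feasC minC] := xs_opt VC.
have fle : f (surface C (xs C)) <= f (surface C (xs Bh)).
  have [->//|ne] := eqVneq (xs Bh) (xs C).
  by apply/ltW/minC => //; rewrite -subr_le0.
have phi : f (surface C (t *: xs C + (1 - t) *: xs Bh)) <=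
    t * f (surface C (xs C)) + (1 - t) * f (surface C (xs Bh)).
  have [->|ne] := eqVneq (xs C) (xs Bh).
    by rewrite -scalerDl -mulrDl addrC subrK scale1r mul1r.
  move: t0; rewrite le_eqVlt => /orP[/eqP<-|t0].
    by rewrite !subr0 scale0r scale1r add0r mul0r mul1r add0r.
  move: t1; rewrite le_eqVlt => /orP[/eqP->|t1].
    by rewrite !subrr scale0r scale1r addr0 mul0r mul1r addr0.
  exact/ltW/(f_convex VC).
have := enorm2_convex (xs C) (xs Bh) t01.
rewrite /lagrangian; set N := enorm (_ + _) ^+ 2; move: compl feasC fle phi.
set a := enorm (xs Bh) ^+ 2; set b := enorm (xs C) ^+ 2; set L := ls Bh.
move=> compl feasC fle phi Nle.
have h1 : L * (N - c ^+ 2) <= 0.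
  have : L * (N - c ^+ 2) <= L * (t * (b - c ^+ 2) + (1 - t) * (a - c ^+ 2)).
    by rewrite ler_wpM2l//; lra.
  have h2 : 0 <= L * (t * (c ^+ 2 - b)) by rewrite !mulr_ge0// subr_ge0.
  move: h2 compl; set w := c ^+ 2; move=> h2 compl h3.
  have -> : 0 = (1 - t) * (L * (a - w)) by rewrite compl mulr0.
  nra.
have h4 : t * f (surface C (xs C)) <= t * f (surface C (xs Bh)) by rewrite ler_wpM2l.
rewrite compl; lra.
Qed.

(** Quadratic growth around [xs Bh], set against the absence of increase along the segment, bounds
    the step by a multiple of the gradient [w] at the old optimum, and [w] tends to 0 with
    [C - Bh]. *)
Lemma solution_continuous Bh : regular Bh -> {for Bh, continuous xs}.
Proof.
move=> rB; have [VB Vx] := rB.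
have [_ _ /pdmx_lower_nbhs[m m0 mP]] := L_C2 VB Vx.
have : \forall u \near (Bh, xs Bh), (Vnbhd eps B u.1 /\
    Vnbhd eps (stack (xs B) (ls B)) (stack u.2 (ls Bh))) /\
    forall t, m * vdot t t <= quadratic (L_xx f c u.1 u.2 (ls Bh)) t.
  by apply: filterI (near_domain rB) _; exact: (cvg_L_xx rB mP).
move=> [[A D] /= [AB /nbhs_normP[q /= q0 Dq]] ADP].
apply/(@cvgrPdist_lt _ _ _ (nbhs Bh)) => e e0.
(* Threshold for [w] that makes [(2 n / m) |w|] smaller than both [e] and [q / 2]. *)
have d0 : 0 < m / (2 * n.+1%:R) * Num.min e (q / 2).
  by rewrite mulr_gt0 ?divr_gt0// ?lt_min ?e0 ?divr_gt0// mulr_gt0.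
move/cvgrPdist_lt: (cvg_L_x_parameter rB) => /(_ _ d0).
apply: filterS2 AB => C AC; rewrite sub0r normrN.
set w := L_x f c C (xs Bh) (ls Bh); set v := xs C - xs Bh => wlt.
have VC : Vnbhd eps B C.
  have : (A `*` D) (C, xs Bh).
    by split => //=; apply: Dq; rewrite /= subrr normr0.
  by move=> /ADP[[]].
rewrite distrC -/v.
have [->|v0] := eqVneq v 0; first by rewrite normr0.
have nv : 0 < `|v| by rewrite normr_gt0.
(* Growth is known only in the ball of radius [q], while [xs C] is not yet known to be near: if the
   full step leaves the ball, only a length [q / 2] is travelled. *)
pose t : R := if `|v| < q then 1 else q / 2 / `|v|.
have [t0 t1 tq] : [/\ 0 < t, t <= 1 & t * `|v| < q].
  rewrite /t; case: ifPn => [vq|]; rewrite -?leNgt; [by rewrite ltr01 lexx mul1r|move=> vq].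
  split; first by rewrite !divr_gt0.
    rewrite ler_pdivrMr// mul1r; lra.
  rewrite divfK ?gt_eqF//; lra.
have growth : lagrangian f c C (xs Bh) (ls Bh) + vdot w (t *: v) + (m * vdot (t *: v) (t *: v)) / 2
    <= lagrangian f c C (xs Bh + t *: v) (ls Bh).
  apply: (@second_order_growth R n (fun x => lagrangian f c C x (ls Bh))
    (ball_ Num.norm (xs Bh) q)).
  - by rewrite ball_normE; exact: ball_open.
  - move=> y /Dq Dy; have /ADP/= [[_ Vy] _] : (A `*` D) (C, y) by split.
    have [[[dg _ dj _] _] [cj _ _ _ _] _] := L_C2 VC Vy.
    split => //.
    apply: (@cvg_L_xx_comp _ (nbhs y)) => //; first [exact: cvg_cst|exact: cvg_id].
  - move=> s /andP[s0 s1] /=; rewrite opprD addNKr normrN !normrZ.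
    by rewrite (ger0_norm s0) (gtr0_norm t0) (le_lt_trans _ tq)// ler_piMl// mulr_ge0// ltW.
  - by move=> y /Dq Dy; have /ADP/= [_ ->] : (A `*` D) (C, y) by split.
have seg : lagrangian f c C (xs Bh + t *: v) (ls Bh) <= lagrangian f c C (xs Bh) (ls Bh).
  by apply: lagrangian_segment => //; rewrite (ltW t0).
have t0' := ltW t0; have m0' := ltW m0.
have key : t * `|v| < Num.min e (q / 2).
  have h1 : m * (t * `|v|) ^+ 2 / 2 <= t * (n%:R * (`|w| * `|v|)).
    have := normr_vdot w v; rewrite ler_norml => /andP[h2 _].
    move: (le_trans growth seg); rewrite !vdotZl !vdotZr => h3.
    have h4 := sqr_norm_le_vdot v.
    have h5 : m * (t * `|v|) ^+ 2 <= m * (t * (t * vdot v v)).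
      by rewrite ler_wpM2l// exprMn expr2 -mulrA !ler_wpM2l.
    have h6 : t * - (n%:R * (`|w| * `|v|)) <= t * vdot w v by rewrite ler_wpM2l.
    lra.
  have h7 : m * (t * `|v|) / 2 <= n%:R * `|w|.
    have tv : 0 < t * `|v| by rewrite mulr_gt0.
    rewrite -(ler_pM2r tv); apply: le_trans (le_trans _ h1) _; last by rewrite le_eqVlt; apply/orP; left; apply/eqP; ring.
    by rewrite le_eqVlt; apply/orP; left; apply/eqP; ring.
  have h8 : n%:R * `|w| <= n.+1%:R * `|w| by rewrite ler_wpM2r// ler_nat.
  have h9 : n.+1%:R * `|w| < m / 2 * Num.min e (q / 2).
    rewrite mulrC -ltr_pdivlMr ?ltr0n// (lt_le_trans wlt)//.
    by rewrite invfM mulrA mulrAC.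
  have : m / 2 * (t * `|v|) < m / 2 * Num.min e (q / 2) by lra.
  by rewrite ltr_pM2l// divr_gt0.
(* A truncated step has length exactly [q / 2], which [key] excludes; hence the step is the full
   one. *)
move: key; rewrite lt_min /t; case: ifPn => [vq|]; rewrite -?leNgt; [by rewrite mul1r => /andP[]|move=> vq].
by rewrite divfK ?gt_eqF// ltxx andbF.
Qed.

End Program.

(** * Bordered linear systems *)

Section BorderedSystem.
Context {R : realType} {n : nat}.

(* The solution operator of [P dx + a mu = g], [b' dx = 0]. *)
Definition bordered_inv (P : 'M[R]_n) (a b : 'cV[R]_n) : 'M[R]_n :=
  (1%:M - invmx P *m a *m invmx (b^T *m invmx P *m a) *m b^T) *m invmx P.

(** Elimination of [dx] leaves the Schur complement [b' P^-1 a] for [mu]. The borders are kept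
    distinct because finite increments yield [2 xs C] in one place and [xs C + xs Bh] in the
    other. *)
Lemma bordered_invP (P : 'M[R]_n) (a b dx g : 'cV[R]_n) (mu : 'M[R]_1) :
  P \in unitmx -> b^T *m invmx P *m a \in unitmx ->
  P *m dx + a *m mu = g -> b^T *m dx = 0 -> dx = bordered_inv P a b *m g.
Proof.
move=> uP uS E bdx.
have dxE : invmx P *m g - invmx P *m a *m mu = dx.
  by rewrite -E mulmxDr mulKmx// mulmxA addrK.
have muE : mu = invmx (b^T *m invmx P *m a) *m (b^T *m invmx P *m g).
  apply: (canRL (mulKmx uS)).
  move/eqP: bdx; rewrite -dxE mulmxBr subr_eq0 !mulmxA => /eqP ->.
  by [].
by rewrite -dxE /bordered_inv -(mulmxA _ (invmx P) g) mulmxBl mul1mx muE !mulmxA.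
Qed.

Lemma cvg_bordered_inv {T : Type} {F : set_system T} {FF : Filter F}
    (P_ : T -> 'M[R]_n) (a_ b_ : T -> 'cV[R]_n) (P : 'M[R]_n) (a b : 'cV[R]_n) :
  P \in unitmx -> b^T *m invmx P *m a \in unitmx ->
  P_ @ F --> P -> a_ @ F --> a -> b_ @ F --> b ->
  bordered_inv (P_ t) (a_ t) (b_ t) @[t --> F] --> bordered_inv P a b.
Proof.
move=> uP uS cP ca cb; have ciP : invmx (P_ t) @[t --> F] --> invmx P by exact: cvg_invmx.
apply: cvg_mulmx => //; apply: cvgB; first exact: cvg_cst.
apply: cvg_mulmx; last exact: cvg_trmx.
apply: cvg_mulmx; first exact: cvg_mulmx.
apply: cvg_invmx => //; apply: cvg_mulmx => //; apply: cvg_mulmx => //; exact: cvg_trmx.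
Qed.

(** The Schur complement is the form of [P] at the nonzero vector [P^-1 a], hence positive. *)
Lemma pdmx_bordered_unit (P : 'M[R]_n) (a : 'cV[R]_n) : pdmx P -> a != 0 ->
  a^T *m invmx P *m a \in unitmx.
Proof.
move=> pdP a0; have uP := pdmx_unit pdP; have [PT Ppos] := pdP.
have v0 : invmx P *m a != 0.
  by apply: contraNneq a0 => E; rewrite -[a](mulKVmx uP) E mulmx0.
have := Ppos _ v0; rewrite unitmxE det_mx11 unitfE => pos.
rewrite gt_eqF//; move: pos; rewrite trmx_mul trmx_inv PT.
by rewrite -[X in X *m _]mulmxA mulVmx// mulmx1 mulmxA.
Qed.

Lemma unitmx_near {T : Type} {F : set_system T} {FF : Filter F} {k : nat}
    (P_ : T -> 'M[R]_k) (P : 'M[R]_k) :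
  P \in unitmx -> P_ @ F --> P -> \forall t \near F, P_ t \in unitmx.
Proof.
rewrite unitmxE unitfE => dP cP.
have : \forall t \near F, \det (P_ t) != 0 by apply: cvgr_neq0 dP; exact: cvg_det.
by apply: filterS => t; rewrite unitmxE unitfE.
Qed.

End BorderedSystem.

(** * Differentiability of the solution in the parameter *)

Section Sensitivity.
Context {R : realType} {n r : nat}.
Variables (f : 'cV[R]_r -> R) (c : R) (B : 'M[R]_(nbterms n, r)).
Variables (xs : 'M[R]_(nbterms n, r) -> 'cV[R]_n) (ls : 'M[R]_(nbterms n, r) -> R).
Variable eps : R.
Hypothesis eps_gt0 : 0 < eps.
Hypothesis f_convex : forall Bh, Vnbhd eps B Bh ->
  strictly_convex (fun x : 'cV[R]_n => f (surface Bh x)).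
Hypothesis xs_opt : forall Bh, Vnbhd eps B Bh -> unique_minimizer f c Bh (xs Bh).
Hypothesis xs_ls_kkt : forall Bh, Vnbhd eps B Bh -> forall x lam,
  kuhn_tucker f c Bh x lam <-> x = xs Bh /\ lam = ls Bh.
Hypothesis L_C2 : forall Bh, Vnbhd eps B Bh -> forall x lam,
  Vnbhd eps (stack (xs B) (ls B)) (stack x lam) ->
  [/\ has_second_derivatives f c Bh x lam,
      second_derivatives_continuous f c Bh x lam &
      pdmx (L_xx f c Bh x lam)].
Hypothesis slackness : 0 < ls B <-> enorm (xs B) ^+ 2 - c ^+ 2 = 0.

Notation regular := (regular B xs ls eps).

Let xs_cont Bh : regular Bh -> {for Bh, continuous xs}.
Proof. exact: (solution_continuous f_convex xs_opt xs_ls_kkt L_C2). Qed.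

Let cvg_solution_enorm2 Bh : regular Bh -> enorm (xs C) ^+ 2 @[C --> Bh] --> enorm (xs Bh) ^+ 2.
Proof.
move=> rB; have cn : enorm (xs C) @[C --> Bh] --> enorm (xs Bh).
  exact: (cvg_comp _ _ (xs_cont rB) (@enorm_continuous _ _ _ (xs Bh))).
rewrite expr2; under eq_fun do rewrite expr2.
exact: (@cvgM _ _ (nbhs Bh)).
Qed.

(** At an active optimum 0 the gradient of the constraint would vanish, so the multiplier could be
    raised by 1 without violating the Kuhn-Tucker conditions, against its uniqueness. *)
Lemma active_neq0 Bh : Vnbhd eps B Bh -> enorm (xs Bh) ^+ 2 = c ^+ 2 -> xs Bh != 0.
Proof.
move=> VB act; apply/eqP => x0.
have [[dg E] feas compl l0] := kkt_solution xs_ls_kkt VB.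
have : kuhn_tucker f c Bh (xs Bh) (ls Bh + 1).
  split; [split=> //|by []|by rewrite act subrr mulr0|by rewrite addr_ge0].
  by rewrite x0 scaler0 in E *; rewrite scaler0.
move/(xs_ls_kkt VB) => [_ /eqP].
by rewrite -subr_eq0 addrAC subrr add0r oner_eq0.
Qed.

(* Slope of the gradient of the Lagrangian between the two optima, with the
   multiplier frozen at [ls Bh]. *)
Lemma kkt_increment Bh : regular Bh ->
  exists S : 'M[R]_(nbterms n, r) -> 'M[R]_n,
  exists N : 'M[R]_(nbterms n, r) -> 'M[R]_(n, r * nbterms n),
  [/\ S C @[C --> Bh] --> L_xx f c Bh (xs Bh) (ls Bh),
      N C @[C --> Bh] --> L_xB f c Bh (xs Bh) (ls Bh) &
      \forall C \near Bh, S C *m (xs C - xs Bh) + (2 * (ls C - ls Bh)) *: xs C =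
        - (N C *m vec (C - Bh))].
Proof.
move=> rB; have [VB Vx] := rB.
(* The increment is split at [(C, xs Bh)]: first the point moves with the parameter already at [C],
   which calls for the parametric slope; then the parameter moves at the fixed point [xs Bh]. *)
have [M cM ME] := @hadamard R _ _ _ _ cV_unconditional_basis _ n
  (fun C x => L_x f c C x (ls Bh)) Bh (xs Bh) (near_has_jac L_C2 rB) (cvg_L_xx L_C2 rB).
have [N cN NE] := @hadamard1 R _ _ _ _ vec_unconditional_basis n
  (fun C => L_x f c C (xs Bh) (ls Bh)) Bh (near_has_jacvec L_C2 rB) (cvg_L_xB L_C2 rB).
have cpair : (C, xs C) @[C --> Bh] --> (Bh, xs Bh).
  by apply: (@cvg_pair_map _ _ _ (nbhs Bh)); [exact: cvg_id|exact: xs_cont].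
exists (fun C => M C (xs C)), N; split => //.
  exact: (cvg_comp _ _ cpair cM).
have ME' : \forall C \near Bh, L_x f c C (xs C) (ls Bh) - L_x f c C (xs Bh) (ls Bh) =
    M C (xs C) *m (xs C - xs Bh) by exact: (cpair _ ME).
near=> C.
have VC : Vnbhd eps B C by near: C; exact: Vnbhd_nbhs.
have <- : L_x f c C (xs C) (ls Bh) - L_x f c C (xs Bh) (ls Bh) =
    M C (xs C) *m (xs C - xs Bh) by near: C.
have <- : L_x f c C (xs Bh) (ls Bh) - L_x f c Bh (xs Bh) (ls Bh) = N C *m vec (C - Bh).
  by near: C.
have [[dg _] _ _ _] := kkt_solution xs_ls_kkt VC.
rewrite (L_x_solution xs_ls_kkt VB) subr0 addrAC.
rewrite -(L_x_lam _ _ _ dg) (L_x_solution xs_ls_kkt VC) ?sub0r//.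
Unshelve. all: by end_near.
Qed.

(** If the constraint is inactive, it stays so and the multipliers vanish. If it is active, pairing
    the increment equation with [xs C] and dividing by [|xs C|^2] isolates [ls C - ls Bh]; this
    works whether or not the constraint is active at [C]. *)
Lemma multiplier_continuous Bh : regular Bh -> {for Bh, continuous ls}.
Proof.
move=> rB; have [VB Vx] := rB.
have [_ feas compl l0] := kkt_solution xs_ls_kkt VB.
have cenorm := cvg_solution_enorm2 rB.
move: feas; rewrite subr_le0 le_eqVlt => /orP[/eqP act|inact]; last first.
  have ls0 C : Vnbhd eps B C -> enorm (xs C) ^+ 2 < c ^+ 2 -> ls C = 0.
    move=> VC lt; have [_ _ /eqP] := kkt_solution xs_ls_kkt VC.
    by rewrite mulf_eq0 subr_eq0 (lt_eqF lt) orbF => /eqP.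
  have lcst : ls Bh @[C --> Bh] --> ls Bh by exact: (@cvg_cst _ _ _ (nbhs Bh)).
  apply: cvg_trans lcst; apply: (@near_eq_cvg _ _ (nbhs Bh)); apply: filterS2 (Vnbhd_nbhs VB) (cvgr_lt _ cenorm _ inact) => C VC lt.
  by rewrite (ls0 Bh)// ls0.
have x0 := active_neq0 VB act.
have [S [N [cS cN E]]] := kkt_increment rB.
have cx := xs_cont rB.
have cn0 : vdot (xs C) (xs C) @[C --> Bh] --> vdot (xs Bh) (xs Bh).
  by rewrite -enorm2_vdot; under eq_fun do rewrite -enorm2_vdot.
have cw : vdot (xs C) (- (N C *m vec (C - Bh)) - S C *m (xs C - xs Bh)) @[C --> Bh] --> (0 : R).
  have cdx : xs C - xs Bh @[C --> Bh] --> (0 : 'cV[R]_n).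
    by rewrite -(subrr (xs Bh)); apply: (@cvgB _ _ _ (nbhs Bh)) => //; exact: cvg_cst.
  have cdB : vec (C - Bh) @[C --> Bh] --> (0 : 'cV[R]_(r * nbterms n)).
    apply/(@cvg_mxP _ _ (nbhs Bh)) => i j; rewrite mxE.
    under eq_fun do rewrite !mxE.
    rewrite -(subrr (Bh (mxtens_unindex i).2 (mxtens_unindex i).1)).
    by apply: (@cvgB _ _ _ (nbhs Bh)); [exact: coord_continuous|exact: cvg_cst].
  have cg : - (N C *m vec (C - Bh)) - S C *m (xs C - xs Bh) @[C --> Bh] --> (0 : 'cV[R]_n).
    rewrite -(subrr 0) -{1}oppr0 -{1}(mulmx0 _ (L_xB f c Bh (xs Bh) (ls Bh))).
    rewrite -(mulmx0 _ (L_xx f c Bh (xs Bh) (ls Bh))).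
    apply: (@cvgB _ _ _ (nbhs Bh)); last exact: (@cvg_mulmx _ _ (nbhs Bh)).
    by apply: (@cvgN _ _ _ (nbhs Bh)); exact: (@cvg_mulmx _ _ (nbhs Bh)).
  have : (xs C)^T *m (- (N C *m vec (C - Bh)) - S C *m (xs C - xs Bh)) @[C --> Bh] --> (xs Bh)^T *m 0.
    by apply: (@cvg_mulmx _ _ (nbhs Bh)) => //; exact: (@cvg_trmx _ _ (nbhs Bh)).
  by rewrite mulmx0 => /(@cvg_mxP _ _ (nbhs Bh))/(_ 0 0); rewrite mxE.
have n0 : vdot (xs Bh) (xs Bh) != 0 by rewrite gt_eqF// vdot_gt0.
have cl : ls Bh + 2^-1 * (vdot (xs C) (- (N C *m vec (C - Bh)) - S C *m (xs C - xs Bh)) *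
    (vdot (xs C) (xs C))^-1) @[C --> Bh] --> ls Bh.
  rewrite -[X in _ --> X]addr0 -(mulr0 (2^-1)%R) -(mul0r (vdot (xs Bh) (xs Bh))^-1%R).
  apply: (@cvgD _ _ _ (nbhs Bh)); first exact: cvg_cst.
  apply: (@cvgM _ _ (nbhs Bh)); first exact: cvg_cst.
  by apply: (@cvgM _ _ (nbhs Bh)) => //; exact: (@cvgV _ _ (nbhs Bh)).
apply: cvg_trans cl; apply: (@near_eq_cvg _ _ (nbhs Bh)).
have nn0 : \forall C \near Bh, vdot (xs C) (xs C) != 0.
  exact: (@cvgr_neq0 _ _ _ (nbhs Bh) _ _ _ cn0 n0).
apply: filterS2 E nn0 => C EC nC; rewrite -EC.
rewrite addrAC subrr add0r vdotZr mulfK// mulKf ?pnatr_eq0//.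
by rewrite addrC subrK.
Qed.

Lemma regular_near Bh : regular Bh -> \forall C \near Bh, regular C.
Proof.
move=> rB; have [VB Vx] := rB.
have cs : stack (xs C) (ls C) @[C --> Bh] --> stack (xs Bh) (ls Bh).
  by apply: (@cvg_stack _ _ _ (nbhs Bh)); [exact: xs_cont|exact: multiplier_continuous].
apply: filterI; first exact: Vnbhd_nbhs.
exact: (cs _ (Vnbhd_nbhs Vx)).
Qed.

(** The branch depends on [B], not on [Bh]: near [B] the map is then given by one formula, whose
    continuity can be read off. *)
Definition sensitivity (Bh : 'M[R]_(nbterms n, r)) : 'M[R]_(n, r * nbterms n) :=
  let Pm := L_xx f c Bh (xs Bh) (ls Bh) in
  let Q := 2 *: xs Bh in
  let G := L_xB f c Bh (xs Bh) (ls Bh) in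
  if 0 < ls B then - (bordered_inv Pm Q Q *m G) else - (invmx Pm *m G).

Definition same_case (Bh : 'M[R]_(nbterms n, r)) : Prop :=
  if 0 < ls B then enorm (xs Bh) ^+ 2 = c ^+ 2 else enorm (xs Bh) ^+ 2 < c ^+ 2.

(** Strict complementary slackness turns each alternative into a strict inequality, [0 < ls B] or
    [|xs B| < |c|], which persists by continuity. The nested neighbourhood is the form in which
    derivatives at parameters near [B] need it. *)
Lemma same_case_near : \forall C \near B, \forall D \near C, regular D /\ same_case D.
Proof.
have rB := @regular_center _ _ _ B xs ls _ eps_gt0; have [VB _] := rB.
apply: nbhs_interior; have [lB|lB] := boolP (0 < ls B).
  have lpos : \forall C \near B, 0 < ls C by exact: (@cvgr_gt _ _ (nbhs B) _ _ _ (multiplier_continuous rB) _ lB).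
  move: lpos.
  apply: filterS2 (regular_near rB) => C rC lC; split; rewrite // /same_case lB.
  have [_ _ /eqP] := kkt_solution xs_ls_kkt (proj1 rC).
  by rewrite mulf_eq0 (gt_eqF lC)/= subr_eq0 => /eqP.
have [_ feas _ _] := kkt_solution xs_ls_kkt VB.
have lt : enorm (xs B) ^+ 2 < c ^+ 2.
  rewrite lt_neqAle -subr_le0 feas andbT -subr_eq0.
  by apply: contraNneq lB => /slackness.
have cenorm := cvg_solution_enorm2 rB.
apply: filterS2 (regular_near rB) (cvgr_lt _ cenorm _ lt) => C rC ltC.
by split; rewrite // /same_case (negbTE lB).
Qed.

Lemma solution_slope Bh : (\forall D \near Bh, regular D /\ same_case D) ->
  exists2 K : 'M[R]_(nbterms n, r) -> 'M[R]_(n, r * nbterms n),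
    K C @[C --> Bh] --> sensitivity Bh &
    \forall C \near Bh, xs C - xs Bh = K C *m vec (C - Bh).
Proof.
move=> nB; have [rB sB] := nbhs_singleton nB; have [VB Vx] := rB.
have [S [N [cS cN E]]] := kkt_increment rB.
have [_ _ pdP] := L_C2 VB Vx; have uP := pdmx_unit pdP.
have uS : \forall C \near Bh, S C \in unitmx by exact: (@unitmx_near _ _ (nbhs Bh) _ _ _ _ uP cS).
have cx := xs_cont rB.
move: sB nB; rewrite /same_case /sensitivity; case: ifPn => [lB|lB] sB nB; last first.
  exists (fun C => - (invmx (S C) *m N C)).
    apply: (@cvgN _ _ _ (nbhs Bh)); apply: (@cvg_mulmx _ _ (nbhs Bh)) => //.
    exact: (@cvg_invmx _ _ (nbhs Bh)).
  have ls0 C : Vnbhd eps B C -> enorm (xs C) ^+ 2 < c ^+ 2 -> ls C = 0.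
    move=> VC lt; have [_ _ /eqP] := kkt_solution xs_ls_kkt VC.
    by rewrite mulf_eq0 subr_eq0 (lt_eqF lt) orbF => /eqP.
  apply: filterS3 E uS nB => C EC uC [[VC _] ltC].
  move: EC; rewrite (ls0 C)// (ls0 Bh)// subrr mulr0 scale0r addr0 => EC.
  by rewrite mulNmx -mulmxA -mulmxN -EC mulKmx.
have x0 := active_neq0 VB sB.
have q0 : 2 *: xs Bh != 0 by rewrite scaler_eq0 pnatr_eq0.
have c2 : 2 *: xs C @[C --> Bh] --> 2 *: xs Bh.
  by apply: (@cvgZ _ _ _ (nbhs Bh)); [exact: cvg_cst|exact: cx].
have c1 : xs C + xs Bh @[C --> Bh] --> 2 *: xs Bh.
  rewrite scaler_nat mulr2n.
  by apply: (@cvgD _ _ _ (nbhs Bh)); [exact: cx|exact: cvg_cst].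
have uq := pdmx_bordered_unit pdP q0.
(* The two borders differ for fixed [C] but share the limit [2 xs Bh]. *)
exists (fun C => - (bordered_inv (S C) (2 *: xs C) (xs C + xs Bh) *m N C)).
  apply: (@cvgN _ _ _ (nbhs Bh)); apply: (@cvg_mulmx _ _ (nbhs Bh)) => //.
  exact: (@cvg_bordered_inv _ _ _ (nbhs Bh)).
have uT : \forall C \near Bh, (xs C + xs Bh)^T *m invmx (S C) *m (2 *: xs C) \in unitmx.
  apply: (@unitmx_near _ _ (nbhs Bh) _ _ _ _ uq); apply: (@cvg_mulmx _ _ (nbhs Bh)) => //.
  apply: (@cvg_mulmx _ _ (nbhs Bh)); first exact: (@cvg_trmx _ _ (nbhs Bh)).
  exact: (@cvg_invmx _ _ (nbhs Bh)).
near=> C.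
have EC : S C *m (xs C - xs Bh) + (2 * (ls C - ls Bh)) *: xs C = - (N C *m vec (C - Bh)).
  by near: C.
have [_ actC] : regular C /\ enorm (xs C) ^+ 2 = c ^+ 2 by near: C.
rewrite mulNmx -mulmxA -mulmxN.
(* The factor 2 of the multiplier term is carried by the border [2 xs C]. *)
apply: (@bordered_invP _ _ (S C) _ _ _ _ ((ls C - ls Bh)%:M)).
- by near: C.
- by near: C.
- by rewrite -EC mul_mx_scalar scalerA mulrC.
apply/matrixP => i j; rewrite !ord1 [RHS]mxE.
change (vdot (xs C + xs Bh) (xs C - xs Bh) = 0).
rewrite !(vdotDl, vdotDr, vdotNl, vdotNr) [vdot (xs Bh) (xs C)]vdotC.
by rewrite -!enorm2_vdot actC sB; ring.
Unshelve. all: by end_near.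
Qed.

Lemma jacvec_solution Bh : (\forall D \near Bh, regular D /\ same_case D) ->
  has_jacvec xs Bh /\ jacvec xs Bh = sensitivity Bh.
Proof.
move=> /solution_slope[K cK KE].
exact: (@coord_jac_of_slope _ _ _ _ _ vec_unconditional_basis n xs Bh K _ cK KE (@vec_basisE _ _ _)).
Qed.

Lemma sensitivity_continuous Bh : regular Bh -> same_case Bh -> {for Bh, continuous sensitivity}.
Proof.
move=> rB sB; have [VB Vx] := rB.
have [_ _ pdP] := L_C2 VB Vx; have uP := pdmx_unit pdP.
have cx := xs_cont rB; have cl := multiplier_continuous rB.
have cP : L_xx f c C (xs C) (ls C) @[C --> Bh] --> L_xx f c Bh (xs Bh) (ls Bh).
  by apply: (@cvg_L_xx_comp _ _ _ _ _ _ _ _ _ L_C2 _ (nbhs Bh)) => //; exact: cvg_id.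
have cG : L_xB f c C (xs C) (ls C) @[C --> Bh] --> L_xB f c Bh (xs Bh) (ls Bh).
  by apply: (@cvg_L_xB_comp _ _ _ _ _ _ _ _ _ L_C2 _ (nbhs Bh)) => //; exact: cvg_id.
have c2 : 2 *: xs C @[C --> Bh] --> 2 *: xs Bh.
  by apply: (@cvgZ _ _ _ (nbhs Bh)); [exact: cvg_cst|exact: cx].
rewrite /sensitivity; move: sB; rewrite /same_case; case: ifPn => lB sB.
  apply: (@cvgN _ _ _ (nbhs Bh)); apply: (@cvg_mulmx _ _ (nbhs Bh)) => //.
  apply: (@cvg_bordered_inv _ _ _ (nbhs Bh)) => //; apply: pdmx_bordered_unit => //.
  by rewrite scaler_eq0 pnatr_eq0 (negbTE (active_neq0 VB sB)).
apply: (@cvgN _ _ _ (nbhs Bh)); apply: (@cvg_mulmx _ _ (nbhs Bh)) => //.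
exact: (@cvg_invmx _ _ (nbhs Bh)).
Qed.

Lemma jacvec_solution_continuous Bh : (\forall D \near Bh, regular D /\ same_case D) ->
  {for Bh, continuous (jacvec xs)}.
Proof.
move=> nB; have [rB sB] := nbhs_singleton nB.
have := sensitivity_continuous rB sB.
rewrite /prop_for/= /continuous_at -(proj2 (jacvec_solution nB)).
apply: cvg_trans; apply: (@near_eq_cvg _ _ (nbhs Bh)).
by apply: filterS (nbhs_interior nB) => C /jacvec_solution[_ ->].
Qed.

Theorem sensitivity_formula : exists delta : R, [/\ 0 < delta, delta <= eps &
  forall Bh, Vnbhd delta B Bh ->
  let Pm := L_xx f c Bh (xs Bh) (ls Bh) in
  let Q := L_lamx f c Bh (xs Bh) (ls Bh) in
  let G := L_xB f c Bh (xs Bh) (ls Bh) in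
  [/\ has_jacvec xs Bh,
      {for Bh, continuous (jacvec xs)},
      enorm (xs Bh) ^+ 2 = c ^+ 2 ->
        jacvec xs Bh =
        - (1%:M - invmx Pm *m Q *m invmx (Q^T *m invmx Pm *m Q) *m Q^T)
          *m invmx Pm *m G &
      enorm (xs Bh) ^+ 2 < c ^+ 2 ->
        jacvec xs Bh = - (invmx Pm *m G)]].
Proof.
have [d d0 dS] := nbhs_Vnbhd same_case_near.
exists (Num.min d eps); split; first by rewrite lt_min d0.
  by rewrite ge_min lexx orbT.
move=> Bh VBh Pm Q G.
have dB : Vnbhd d B Bh by move: VBh; rewrite /Vnbhd/= lt_min => /andP[].
have nB := dS _ dB; have [rB sB] := nbhs_singleton nB.
have [hj jE] := jacvec_solution nB.
split => //; first exact: jacvec_solution_continuous.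
  move=> act; rewrite jE /sensitivity; move: sB; rewrite /same_case.
  case: ifPn => _ sB; last by rewrite act ltxx in sB.
  by rewrite !mulNmx /Q L_lamxE.
move=> inact; rewrite jE /sensitivity; move: sB; rewrite /same_case.
by case: ifPn => _ sB; first by rewrite sB ltxx in inact.
Qed.

End Sensitivity.

(** * Approximation by trigonometric polynomials *)

Section Bernstein.
Context {R : realType}.

(* Expectation of [g] under the binomial law with parameters [m] and [s]. *)
Fixpoint bernstein (m : nat) (s : R) (g : nat -> R) : R :=
  if m is m'.+1 then
    s * bernstein m' s (fun j => g j.+1) + (1 - s) * bernstein m' s g
  else g 0%N.

Lemma le_bernstein m (s : R) (g h : nat -> R) : 0 <= s <= 1 ->
  (forall j, (j <= m)%N -> g j <= h j) -> bernstein m s g <= bernstein m s h.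
Proof.
move=> /andP[s0 s1]; elim: m g h => [|m IH] g h gh /=; first exact: gh.
rewrite lerD// ler_wpM2l// ?subr_ge0//; apply: IH => j jm; apply: gh => //.
exact: leqW.
Qed.

Lemma bernstein_affine m (s a b : R) (g : nat -> R) :
  bernstein m s (fun j => a + b * g j) = a + b * bernstein m s g.
Proof. by elim: m g => [//|m IH] g /=; rewrite !IH; ring. Qed.

(** Squared bias plus variance of the binomial law. *)
Lemma bernstein_sqr m (s a : R) :
  bernstein m s (fun j => (j%:R - a) ^+ 2) = (m%:R * s - a) ^+ 2 + m%:R * (s * (1 - s)).
Proof.
elim: m a => [|m IH] a /=; first by rewrite !mul0r addr0.
rewrite IH; have -> : (fun j : nat => (j.+1%:R - a) ^+ 2) = (fun j => (j%:R - (a - 1)) ^+ 2).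
  by apply/funext => j; rewrite -[j.+1]addn1 natrD; ring.
by rewrite IH -[m.+1]addn1 natrD; ring.
Qed.

(** The quadratic majorant is averaged exactly: the variance of [j / m] is [s (1 - s) / m], at most
    [1 / m]. The additive constant [a] makes the estimate fit for iteration over coordinates. *)
Lemma bernstein_error m (s a b v : R) (g : nat -> R) : (0 < m)%N -> 0 <= s <= 1 -> 0 <= b ->
  (forall j, (j <= m)%N -> `|g j - v| <= a + b * (j%:R / m%:R - s) ^+ 2) ->
  `|bernstein m s g - v| <= a + b / m%:R.
Proof.
move=> m0 s01 b0 H; have mR : 0 < m%:R :> R by rewrite ltr0n.
have E : bernstein m s (fun j => a + b * (j%:R / m%:R - s) ^+ 2) <= a + b / m%:R.
  have -> : (fun j : nat => a + b * (j%:R / m%:R - s) ^+ 2) =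
      (fun j => a + (b / m%:R ^+ 2) * (j%:R - m%:R * s) ^+ 2).
    by apply/funext => j; congr (_ + _); field; rewrite gt_eqF.
  rewrite bernstein_affine bernstein_sqr subrr expr0n add0r lerD2l.
  have -> : b / m%:R ^+ 2 * (m%:R * (s * (1 - s))) = b / m%:R * (s * (1 - s)).
    by field; rewrite gt_eqF.
  rewrite ler_piMr//; first by rewrite divr_ge0// ltW.
  by move: s01 => /andP[? ?]; nra.
pose w (j : nat) : R := a + b * (j%:R / m%:R - s) ^+ 2.
have lo : v + -1 * bernstein m s w <= bernstein m s g.
  rewrite -bernstein_affine; apply: le_bernstein => // j /H.
  by rewrite ler_norml => /andP[h _]; rewrite /w; lra.
have hi : bernstein m s g <= v + 1 * bernstein m s w.
  rewrite -bernstein_affine; apply: le_bernstein => // j /H.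
  by rewrite ler_norml => /andP[_ h]; rewrite /w; lra.
move: E; rewrite -/w ler_norml => E; apply/andP; split; lra.
Qed.

(** Expectation over independent binomial counts, one for each entry of [ss]: the tensor-product
    Bernstein operator. *)
Fixpoint mbernstein (m : nat) (ss : seq R) (g : seq nat -> R) : R :=
  if ss is s :: ss' then
    bernstein m s (fun j => mbernstein m ss' (fun js => g (j :: js)))
  else g [::].

Lemma mbernstein_error m (ss : seq R) (a b v : R) (g : seq nat -> R) :
  (0 < m)%N -> all (fun s => 0 <= s <= 1) ss -> 0 <= b ->
  (forall js, size js = size ss -> all (fun j => j <= m)%N js ->
     `|g js - v| <= a + b * \sum_(i < size ss) ((nth 0%N js i)%:R / m%:R - nth 0 ss i) ^+ 2) ->
  `|mbernstein m ss g - v| <= a + b * (size ss)%:R / m%:R.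
Proof.
move=> m0; elim: ss a g => [|s ss IH] a g /= ss01 b0 H.
  by have := H [::] erefl isT; rewrite big_ord0 !mulr0 mul0r.
case/andP: ss01 => s01 ss01.
have -> : a + b * (size ss).+1%:R / m%:R = (a + b * (size ss)%:R / m%:R) + b / m%:R.
  by rewrite -[(size ss).+1]addn1 natrD; ring.
apply: bernstein_error => // j jm.
(* For the remaining coordinates, the deviation of the first one is part of the constant [a]. *)
have -> : a + b * (size ss)%:R / m%:R + b * (j%:R / m%:R - s) ^+ 2 =
  (a + b * (j%:R / m%:R - s) ^+ 2) + b * (size ss)%:R / m%:R by ring.
apply: IH => // js sjs ajs; have := H (j :: js).
rewrite /= sjs jm ajs => /(_ erefl isT); rewrite big_ord_recl/= mulrDr addrA.
by [].
Qed.

Lemma normr_mbernstein m (ss : seq R) (K : R) (g : seq nat -> R) :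
  all (fun s => 0 <= s <= 1) ss -> (forall js, `|g js| <= K) -> `|mbernstein m ss g| <= K.
Proof.
elim: ss g => [|s ss IH] g /= ss01 H; first exact: H.
case/andP: ss01 => s01 ss01.
have K1 j : `|mbernstein m ss (fun js => g (j :: js))| <= K by exact: IH.
have cst (a : R) : bernstein m s (fun=> a) = a.
  have := bernstein_affine m s a 0 (fun=> 0); under eq_fun do rewrite mul0r addr0.
  by rewrite mul0r addr0.
rewrite ler_norml; apply/andP; split.
  rewrite -[leLHS]cst; apply: le_bernstein => // j _.
  by have := K1 j; rewrite ler_norml => /andP[].
rewrite -[leRHS]cst; apply: le_bernstein => // j _.
by have := K1 j; rewrite ler_norml => /andP[].
Qed.

End Bernstein.

Section TrigonometricPolynomials.
Context {R : realType} {k : nat}.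
Implicit Types (g h : 'cV[R]_k -> R).

(** Triples of amplitude, frequency and phase. Phases provide the sines and keep the class closed
    under products. *)
Definition trig_sum (s : seq (R * 'cV[R]_k * R)) (x : 'cV[R]_k) : R :=
  \sum_(u <- s) u.1.1 * cos (vdot u.1.2 x + u.2).

Definition trig_poly g : Prop := exists s, g = trig_sum s.

Lemma trig_polyD g h : trig_poly g -> trig_poly h -> trig_poly (fun x => g x + h x).
Proof.
move=> [s ->] [t ->]; exists (s ++ t); apply/funext => x.
by rewrite /trig_sum big_cat.
Qed.

Lemma trig_poly_cst (a : R) : trig_poly (fun=> a).
Proof.
exists [:: (a, 0, 0)]; apply/funext => x.
by rewrite /trig_sum big_seq1/= /vdot trmx0 mul0mx mxE addr0 cos0 mulr1.
Qed.

Lemma trig_polyM g h : trig_poly g -> trig_poly h -> trig_poly (fun x => g x * h x).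
Proof.
move=> [s ->] [t ->].
exists ([seq (u.1.1 * v.1.1 / 2, u.1.2 + v.1.2, u.2 + v.2) | u <- s, v <- t] ++
        [seq (u.1.1 * v.1.1 / 2, u.1.2 - v.1.2, u.2 - v.2) | u <- s, v <- t]).
apply/funext => x; rewrite /trig_sum big_cat/= !big_allpairs_dep/= -big_split/=.
rewrite mulr_suml; apply: eq_bigr => u _; rewrite mulr_sumr -big_split/=.
apply: eq_bigr => v _; rewrite !vdotDl vdotNl.
have -> : vdot u.1.2 x + vdot v.1.2 x + (u.2 + v.2) =
  (vdot u.1.2 x + u.2) + (vdot v.1.2 x + v.2) by ring.
have -> : vdot u.1.2 x - vdot v.1.2 x + (u.2 - v.2) =
  (vdot u.1.2 x + u.2) - (vdot v.1.2 x + v.2) by ring.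
by move: (_ + u.2) (_ + v.2) => y z; rewrite cosD cosB; field.
Qed.

Lemma trig_poly_sin (t : 'cV[R]_k) : trig_poly (fun x => sin (vdot t x)).
Proof.
exists [:: (1, t, - (pi / 2))]; apply/funext => x.
by rewrite /trig_sum big_seq1/= mul1r cosBpihalf.
Qed.

Lemma trig_poly_bernstein m (s : 'cV[R]_k -> R) (g : nat -> 'cV[R]_k -> R) :
  trig_poly s -> (forall j, trig_poly (g j)) ->
  trig_poly (fun x => bernstein m (s x) (fun j => g j x)).
Proof.
move=> ts; elim: m g => [|m IH] g tg /=; first exact: tg.
apply: trig_polyD; first by apply: trig_polyM => //; exact: (IH (fun j => g j.+1)).
apply: trig_polyM; last exact: IH.
have -> : (fun x => 1 - s x) = (fun x => 1 + -1 * s x).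
  by apply/funext => x; rewrite mulN1r.
by apply: trig_polyD; [|apply: trig_polyM]; rewrite //; exact: trig_poly_cst.
Qed.

Lemma trig_poly_mbernstein (I : Type) m (idx : seq I) (s : I -> 'cV[R]_k -> R)
    (g : seq nat -> R) : (forall i, trig_poly (s i)) ->
  trig_poly (fun x => mbernstein m [seq s i x | i <- idx] g).
Proof.
move=> ts; elim: idx g => [|i idx IH] g /=; first exact: trig_poly_cst.
exact: (@trig_poly_bernstein m (s i)
  (fun j x => mbernstein m [seq s i x | i <- idx] (fun js => g (j :: js)))).
Qed.

End TrigonometricPolynomials.

Lemma box_compact {R : realType} {k : nat} (L : R) :
  compact (fun x : 'cV[R]_k => forall i, `|x i 0| <= L).
Proof.
pose D : set 'rV[R]_k := fun v => forall i, `[- L, L]%classic (v ord0 i).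
have -> : (fun x : 'cV[R]_k => forall i, `|x i 0| <= L) = trmx @` D.
  apply/seteqP; split => [x xL|_ [v vL <-] i].
    exists x^T; last exact: trmxK.
    by move=> i; rewrite mxE /= in_itv/= -ler_norml; exact: xL.
  by have := vL i; rewrite /= in_itv/= -ler_norml mxE.
apply: continuous_compact.
  apply: continuous_subspaceT => v.
  by apply: (@cvg_trmx _ _ (nbhs v)); exact: cvg_id.
apply: (@rV_compact _ _ (fun=> `[- L, L]%classic)).
by move=> _; exact: segment_compact.
Qed.

(** Only [x] is confined to the box: in the delta method [y] is the scaled error itself, on which no
    bound is available. *)
Lemma unif_continuous_box {R : realType} {k : nat} (h : 'cV[R]_k -> R) (L eps : R) :
  continuous h -> 0 < eps -> exists2 delta : R, 0 < delta &
    forall x y : 'cV[R]_k, (forall i, `|x i 0| <= L) -> `|x - y| <= delta -> `|h x - h y| <= eps.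
Proof.
move=> ch eps0.
have [d /= d0 dP] : \forall delta \near (0 : R)^'+, forall x : 'cV[R]_k, (forall i, `|x i 0| <= L) ->
    forall y, `|x - y| <= delta -> `|h x - h y| <= eps.
  apply: ((compact_near_coveringP _).1 (@box_compact R k L) R (0^'+)
    (fun delta x => forall y, `|x - y| <= delta -> `|h x - h y| <= eps)) => x _.
  have e2 : 0 < eps / 2 by rewrite divr_gt0.
  move/(@cvgrPdist_lt _ _ _ (nbhs x)): (ch x) => /(_ _ e2) /nbhs_normP[r /= r0 rP].
  have r2 : 0 < r / 2 by rewrite divr_gt0.
  exists (ball_ Num.norm x (r / 2), (fun e : R => (e < r / 2) : Prop)).
    split; first by apply/(@nbhs_normP R 'cV[R]_k); exists (r / 2).
    by exists (r / 2) => // e /=; rewrite sub0r normrN => /ltr_normlW.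
  move=> [x' e] /= [xx' er] y x'y.
  have h1 : `|h x - h x'| < eps / 2.
    by apply: rP => /=; rewrite (lt_trans xx')// ltr_pdivrMr// mulr2n mulrDr mulr1 ltrDl.
  have h2 : `|h x - h y| < eps / 2.
    apply: rP => /=; rewrite -(subrK x' x) -addrA (le_lt_trans (ler_normD _ _))//.
    have := le_lt_trans x'y er; lra.
  rewrite (_ : h x' - h y = (h x - h y) - (h x - h x')); last by ring.
  by rewrite (le_trans (ler_normB _ _))//; lra.
exists (d / 2); first by rewrite divr_gt0.
move=> x y xL xy; apply: (dP (d / 2)) => //=; last by rewrite divr_gt0.
by rewrite sub0r normrN gtr0_norm ?divr_gt0// ltr_pdivrMr// mulr2n mulrDr mulr1 ltrDl.
Qed.

(** On [[-1, 1]] the derivative of [sin] is at least [cos 1]. This quantitative injectivity lets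
    sines serve as coordinates on a box. *)
Lemma sin_dist {R : realType} (x y : R) : `|x| <= 1 -> `|y| <= 1 ->
  cos 1 * `|x - y| <= `|sin x - sin y|.
Proof.
wlog xy : x y / x <= y => [H|] x1 y1.
  have [/H|] := boolP (x <= y); first exact.
  rewrite -ltNge => /ltW/H {}H.
  by rewrite distrC [leRHS]distrC; exact: H.
have [|z zI E] := @MVT_segment _ sin cos _ _ xy.
  exact/continuous_subspaceT/continuous_sin.
have z1 : `|z| <= 1.
  move: x1 y1 zI; rewrite !ler_norml in_itv/= => /andP[? ?] /andP[? ?] /andP[? ?].
  by apply/andP; split; lra.
have cz : cos 1 <= cos z.
  rewrite -(cos_norm z) leNgt ltr_cos ?in_itv/= -?leNgt// ?normr_ge0 ?ler01//=.
    by rewrite (le_trans _ (pi_ge2 _))// ler1n.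
  by rewrite (le_trans z1)// (le_trans _ (pi_ge2 _))// ler1n.
have yx : 0 <= y - x by rewrite subr_ge0.
rewrite distrC [leRHS]distrC E normrM (ger0_norm yx) ler_wpM2r//.
by rewrite (le_trans cz)// ler_norm.
Qed.

(** Bernstein approximation in the variables [s i x], which lie in [[0, 1]] for all [x] and separate
    the points of the box. Being an average of coefficients, the approximant keeps the bound [K] on
    the whole space, as dominated convergence later demands. *)
Lemma trig_approx {R : realType} {k : nat} (h : 'cV[R]_k -> R) (K L eps : R) :
  continuous h -> (forall x, `|h x| <= K) -> 0 < L -> 0 < eps ->
  exists g, [/\ trig_poly g, forall x, `|g x| <= K &
    forall x : 'cV[R]_k, (forall i, `|x i 0| <= L) -> `|g x - h x| <= eps].
Proof.
move=> ch hK L0 eps0.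
have e2 : 0 < eps / 2 by rewrite divr_gt0.
have [d d0 dP] := unif_continuous_box L ch e2.
pose s (i : 'I_k) (x : 'cV[R]_k) : R := (1 + sin (vdot (delta_mx i 0) (L^-1 *: x))) / 2.
have sE i x : s i x = (1 + sin (x i 0 / L)) / 2.
  rewrite /s vdotC vdotE (bigD1 i)//= big1 => [|j ji].
    by rewrite !mxE !eqxx /= mulr1 addr0 [L^-1 * _]mulrC.
  by rewrite !mxE (negbTE ji) mulr0.
have s01 i x : 0 <= s i x <= 1.
  by rewrite /s; have := sin_geN1 (vdot (delta_mx i 0) (L^-1 *: x));
    have := sin_le1 (vdot (delta_mx i 0) (L^-1 *: x)); move=> ? ?; apply/andP; split; lra.
have c1 : 0 < cos 1 :> R := cos1_gt0 R.
(* Chosen so that a difference of at most [2 * e] in [s i] forces a difference of at most [d] in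
   coordinate [i], by [sin_dist] after division by [L]. *)
pose e := cos 1 * d / (4 * L).
have e0 : 0 < e by rewrite divr_gt0 ?mulr_gt0.
have sep (x y : 'cV[R]_k) : (forall i, `|x i 0| <= L) -> (forall i, `|y i 0| <= L) ->
    (forall i, `|s i x - s i y| <= 2 * e) -> `|h x - h y| <= eps / 2.
  move=> xL yL sxy; apply: dP => //; apply: mx_norm_le (ltW d0) _ => i j.
  rewrite !mxE (ord1 j); have := sxy i; rewrite !sE.
  have -> : (1 + sin (x i 0 / L)) / 2 - (1 + sin (y i 0 / L)) / 2 =
    (sin (x i 0 / L) - sin (y i 0 / L)) / 2 by field.
  rewrite normrM (_ : `|(2^-1)%R| = 2^-1%R :> R); last by rewrite gtr0_norm// invr_gt0.
  have div1 (a : R) : `|a| <= L -> `|a / L| <= 1.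
    by rewrite normrM normfV (gtr0_norm L0) ler_pdivrMr// mul1r.
  have := sin_dist (div1 _ (xL i)) (div1 _ (yL i)).
  rewrite -mulrBl normrM normfV (gtr0_norm L0).
  set D := `|x i 0 - y i 0|; set S := `|_ - _| => h1 h2.
  have h3 : cos 1 * (D / L) <= cos 1 * (d / L).
    apply: (le_trans h1); move: h2; rewrite /e ler_pdivrMr// => /le_trans; apply.
    rewrite le_eqVlt; apply/orP; left; apply/eqP; field; exact: lt0r_neq0.
  by move: h3; rewrite ler_pM2l// ler_pM2r// invr_gt0.
have K0 : 0 <= K by apply: le_trans (hK 0).
(* If some coordinate deviates by more than [e], the crude bound [2 * K] is below [b] times the
   squared deviation. *)
pose b := 2 * K / e ^+ 2.
have b0 : 0 <= b by rewrite /b divr_ge0 ?sqr_ge0// mulr_ge0.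
have [m m0 mP] : exists2 m, (0 < m)%N & b * k%:R / m%:R <= eps / 2.
  exists (Num.truncn (b * k%:R / (eps / 2))).+1 => //.
  rewrite ler_pdivrMr ?ltr0n// [leRHS]mulrC -ler_pdivrMr//.
  by rewrite ltW// truncnS_gt.
pose near (js : seq nat) (y : 'cV[R]_k) := (forall i, `|y i 0| <= L) /\
  forall i : 'I_k, `|(nth 0%N js i)%:R / m%:R - s i y| <= e.
(* The coefficient at a grid point is the value of [h] at some point of the box with nearly these
   coordinates, or 0 if there is none. *)
have /choice[G GP] : forall js, exists v : R, `|v| <= K /\
    ((exists y, near js y) -> exists2 y, near js y & v = h y).
  move=> js; have [[y ny]|nn] := pselect (exists y, near js y).
    by exists (h y); split => // _; exists y.
  by exists 0; split; rewrite ?normr0.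
exists (fun x => mbernstein m [seq s i x | i <- enum 'I_k] G); split.
- apply: trig_poly_mbernstein => i.
  have -> : s i = fun x => (2^-1 : R) * (1 + sin (vdot (L^-1 *: delta_mx i 0) x)).
    by apply/funext => x; rewrite /s vdotZr vdotZl mulrC.
  apply: trig_polyM; first exact: trig_poly_cst.
  by apply: trig_polyD; [exact: trig_poly_cst|exact: trig_poly_sin].
- move=> x; apply: normr_mbernstein; last by move=> js; case: (GP js).
  by rewrite all_map; apply/allP => i _; exact: s01.
move=> x xL.
have sz : size [seq s i x | i <- enum 'I_k] = k by rewrite size_map size_enum_ord.
have : `|mbernstein m [seq s i x | i <- enum 'I_k] G - h x| <= eps / 2 + b * k%:R / m%:R.
  rewrite -[in k%:R]sz; apply: mbernstein_error => //.
    by rewrite all_map; apply/allP => i _; exact: s01.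
  rewrite sz => js sjs _.
  have -> : \sum_(i < k) ((nth 0%N js i)%:R / m%:R - nth 0 [seq s i x | i <- enum 'I_k] i) ^+ 2 =
      \sum_(i < k) ((nth 0%N js i)%:R / m%:R - s i x) ^+ 2.
    apply: eq_bigr => i _; rewrite (nth_map i) ?size_enum_ord//.
    by rewrite nth_ord_enum.
  have [jx|] := pselect (forall i : 'I_k, `|(nth 0%N js i)%:R / m%:R - s i x| <= e).
    have [_ /(_ (ex_intro _ x (conj xL jx)))[y [yL jy] ->]] := GP js.
    rewrite distrC; have := sep x y xL yL; move=> /(_ _)/le_trans-> //.
      move=> i; rewrite (_ : s i x - s i y = ((nth 0%N js i)%:R / m%:R - s i y) - ((nth 0%N js i)%:R / m%:R - s i x)).
        by rewrite (le_trans (ler_normB _ _))// mulr2n mulrDl mul1r lerD.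
      by ring.
    by rewrite lerDl mulr_ge0// sumr_ge0// => i _; exact: sqr_ge0.
  move=> /existsNP[i /negP]; rewrite -ltNge => far.
  have [Gk _] := GP js.
  apply: (@le_trans _ _ (2 * K)).
    by rewrite (le_trans (ler_normB _ _))// mulr2n mulrDl mul1r lerD.
  apply: (@le_trans _ _ (b * \sum_(i < k) ((nth 0%N js i)%:R / m%:R - s i x) ^+ 2)); last first.
    by rewrite lerDr ltW.
  apply: (@le_trans _ _ (b * e ^+ 2)).
    by rewrite /b divfK// gt_eqF// exprn_gt0.
  rewrite ler_wpM2l// (bigD1 i)//= -[leLHS]addr0 lerD//.
    rewrite -[leRHS]real_normK ?num_real// ler_sqr ?nnegrE// ltW//.
  by apply: sumr_ge0 => j _; exact: sqr_ge0.
move=> /le_trans; apply.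
lra.
Qed.

(** * Random vectors and their projections *)

Section RandomVectors.
Context {R : realType} {d : measure_display} {T : measurableType d} {k : nat}.
Implicit Types (X : T -> 'cV[R]_k) (P : probability T R).

Lemma measurable_vdot (t : 'cV[R]_k) X : random_matrix X ->
  measurable_fun setT (fun w => vdot t (X w)).
Proof.
move=> mX; under eq_fun do rewrite vdotE.
apply: measurable_sum => i; apply: measurable_funM; last exact: mX.
exact: measurable_cst.
Qed.

Lemma bounded_integrable P (Y : T -> R) (K : R) : measurable_fun setT Y ->
  (forall w, `|Y w| <= K) -> P.-integrable setT (EFin \o Y).
Proof.
move=> mY YK; apply: measurable_bounded_integrable => //.
  by rewrite (le_lt_trans (probability_le1 P measurableT))// ltry.
exists K; split; first exact: num_real.
by move=> M KM w _; apply: le_trans (YK w) (ltW KM).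
Qed.

Lemma measurable_cos_vdot (t : 'cV[R]_k) (a : R) X : random_matrix X ->
  measurable_fun setT (fun w => cos (vdot t (X w) + a)).
Proof.
move=> mX; apply: (measurableT_comp (f := cos)).
  by apply: continuous_measurable_fun; exact: continuous_cos.
by apply: measurable_funD; [exact: measurable_vdot|exact: measurable_cst].
Qed.

Lemma trig_poly_measurable (g : 'cV[R]_k -> R) X : trig_poly g -> random_matrix X ->
  measurable_fun setT (g \o X).
Proof.
move=> [s ->] mX; apply: measurable_sum => u.
apply: measurable_funM; first exact: measurable_cst.
exact: measurable_cos_vdot.
Qed.

End RandomVectors.

Lemma trig_approx_seq {R : realType} {k : nat} (h : 'cV[R]_k -> R) (K : R) :
  continuous h -> (forall x, `|h x| <= K) ->
  exists g : nat -> 'cV[R]_k -> R, [/\ forall m, trig_poly (g m),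
    forall m x, `|g m x| <= K & forall x, g m x @[m --> \oo] --> h x].
Proof.
move=> ch hK.
have /choice[g gP] : forall m : nat, exists g, [/\ trig_poly g, forall x, `|g x| <= K &
    forall x : 'cV[R]_k, (forall i, `|x i 0| <= m.+1%:R) -> `|g x - h x| <= (m.+1%:R^-1)%R].
  by move=> m; apply: trig_approx => //; rewrite ?ltr0n// invr_gt0 ltr0n.
exists g; split=> [m|m x|x]; [by case: (gP m)|by case: (gP m)|].
apply/cvgrPdist_le => e e0.
near=> m; have [_ _ /(_ x)] := gP m.
rewrite distrC => /(_ _)/le_trans; apply.
  move=> i; rewrite (le_trans (ler_mxE_norm _ _ _))// ltW//.
  near: m; exists (Num.truncn `|x|).+1 => // m /= xm.
  rewrite (lt_le_trans (truncnS_gt _))// ler_nat.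
  exact: leqW.
rewrite -[leRHS]invrK lef_pV2 ?posrE ?invr_gt0 ?ltr0n//.
near: m; exists (Num.truncn e^-1).+1 => // m /= xm.
by rewrite ltW// (lt_le_trans (truncnS_gt _))// ler_nat leqW.
Unshelve. all: by end_near. Qed.

(** Measurability of [X] is only entrywise; it passes to [h] through pointwise limits of
    trigonometric polynomials in the projections. *)
Lemma continuous_random {R : realType} {d : measure_display} {T : measurableType d}
    {k : nat} (h : 'cV[R]_k -> R) (K : R) (X : T -> 'cV[R]_k) :
  continuous h -> (forall x, `|h x| <= K) -> random_matrix X ->
  measurable_fun setT (h \o X).
Proof.
move=> ch hK mX; have [g [gt gK gh]] := trig_approx_seq ch hK.
apply: (@measurable_fun_cvg _ _ _ _ (fun m => g m \o X)) => [m|w _].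
  exact: trig_poly_measurable.
exact: gh.
Qed.

Section CramerWold.
Context {R : realType} {d d' : measure_display} {T : measurableType d}
  {T' : measurableType d'} {k : nat}.
Variables (P : probability T R) (P' : probability T' R).
Variables (X : T -> 'cV[R]_k) (X' : T' -> 'cV[R]_k).
Hypothesis mX : random_matrix X.
Hypothesis mX' : random_matrix X'.
Hypothesis same_projections : forall (t : 'cV[R]_k) (A : set R), measurable A ->
  pushforward P (fun w => vdot t (X w)) A = pushforward P' (fun w => vdot t (X' w)) A.

Lemma expectation_projection (t : 'cV[R]_k) (g : R -> R) (K : R) :
  measurable_fun setT g -> (forall x, `|g x| <= K) ->
  (\int[P]_w (g (vdot t (X w)))%:E = \int[P']_w (g (vdot t (X' w)))%:E)%E.
Proof.
move=> mg gK.
have E dd (TT : measurableType dd) (Q : probability TT R) (Z : TT -> 'cV[R]_k) :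
    random_matrix Z ->
    (\int[Q]_w (g (vdot t (Z w)))%:E = \int[pushforward Q (fun w => vdot t (Z w))]_x (g x)%:E)%E.
  move=> mZ; rewrite (integral_pushforward (measurable_vdot t mZ))//.
  - exact/measurable_EFinP.
  - rewrite preimage_setT.
    exact: (@bounded_integrable _ _ _ _ (g \o (fun w => vdot t (Z w))) K
      (measurableT_comp mg (measurable_vdot t mZ)) (fun w => gK _)).
rewrite !E//; apply: eq_measure_integral; [exact: measurable_vdot|exact: measurable_vdot|].
by move=> mX1 mX2 A mA _; exact: same_projections.
Qed.

(** Each cosine depends on a single projection, whose law is the same on both sides. *)
Lemma expectation_trig_poly (g : 'cV[R]_k -> R) : trig_poly g ->
  (\int[P]_w (g (X w))%:E = \int[P']_w (g (X' w))%:E)%E.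
Proof.
move=> [s ->].
have E dd (TT : measurableType dd) (Q : probability TT R) (Z : TT -> 'cV[R]_k) :
    random_matrix Z ->
    (\int[Q]_w (trig_sum s (Z w))%:E =
     \sum_(u <- s) u.1.1%:E * \int[Q]_w (cos (vdot u.1.2 (Z w) + u.2))%:E)%E.
  move=> mZ; rewrite /trig_sum; under eq_integral do rewrite -sumEFin.
  have ic u : Q.-integrable setT (fun w => (cos (vdot u.1.2 (Z w) + u.2))%:E).
    by apply: (@bounded_integrable _ _ _ _ _ 1); [exact: measurable_cos_vdot|move=> w; exact: cos_max].
  rewrite integral_sum//=; last first.
    by move=> u; under eq_fun do rewrite EFinM; exact: integrableZl.
  apply: eq_bigr => u _; under eq_integral do rewrite EFinM.
  by rewrite integralZl.
rewrite !E//; apply: eq_bigr => u _; congr (_ * _)%E.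
apply: (expectation_projection u.1.2 (g := fun x => cos (x + u.2)) (K := 1)).
  apply: (measurableT_comp (f := cos)).
    by apply: continuous_measurable_fun; exact: continuous_cos.
  by apply: measurable_funD; [exact: measurable_id|exact: measurable_cst].
by move=> x; exact: cos_max.
Qed.

Lemma cramer_wold (h : 'cV[R]_k -> R) (K : R) :
  continuous h -> (forall x, `|h x| <= K) ->
  'E_P[fun w => h (X w)]%E = 'E_P'[fun w => h (X' w)]%E.
Proof.
move=> ch hK; have [g [gt gK gh]] := trig_approx_seq ch hK.
have E dd (TT : measurableType dd) (Q : probability TT R) (Z : TT -> 'cV[R]_k) :
    random_matrix Z ->
    (\int[Q]_w (g m (Z w))%:E @[m --> \oo] --> \int[Q]_w (h (Z w))%:E)%E.
  move=> mZ; have mg m : measurable_fun setT (g m \o Z) by exact: trig_poly_measurable.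
  have mh : measurable_fun setT (h \o Z) by exact: continuous_random hK mZ.
  have [|||||//] := @dominated_convergence _ _ _ Q setT measurableT (fun m w => (g m (Z w))%:E)
    (fun w => (h (Z w))%:E) (cst K%:E).
  - by move=> m; apply/measurable_EFinP; exact: mg.
  - by apply/measurable_EFinP; exact: mh.
  - by apply: aeW => w _; apply/fine_cvgP; split; [exact: nearW|exact: gh].
  - exact: (@bounded_integrable _ _ _ _ (cst K) `|K|).
  - by apply: aeW => w m _; rewrite lee_fin; exact: gK.
rewrite unlock; apply: cvg_unique (E _ _ P X mX) _ => //.
have := E _ _ P' X' mX'; rewrite (_ : (fun m => _) = (fun m => \int[P]_w (g m (X w))%:E)%E)//.
by apply/funext => m; rewrite expectation_trig_poly.
Qed.

End CramerWold.

(** * Moments of the normal law *)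

Section NormalMoments.
Context {R : realType}.
Notation mu := (@lebesgue_measure R).

Lemma Rintegral_derive (F f : R -> R) (a b : R) : a < b ->
  (forall x : R, is_derive x 1 F (f x)) -> continuous f ->
  (\int[mu]_(x in `[a, b]) (f x)%:E = (F b - F a)%:E)%E.
Proof.
move=> ab dF cf; rewrite (@continuous_FTC2 _ f F)//.
- exact: continuous_subspaceT.
- have cF x : {for x, continuous F}.
    by have [/derivable1_diffP/differentiable_continuous] := dF x.
  split=> [x _||]; first by case: (dF x).
    apply: cvg_at_right_filter; exact: cF.
  apply: cvg_at_left_filter; exact: cF.
- by move=> x _; rewrite derive1E; case: (dF x).
Qed.

(** Monotone convergence; it reduces moments to compact intervals, where the fundamental theorem of
    calculus applies. *)
Lemma cvg_integral_symmetric_itv (nu : {measure set (measurableTypeR R) -> \bar R}) (g : R -> R) :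
  measurable_fun setT g -> (forall x, 0 <= g x) ->
  (\int[nu]_(x in `[(- m%:R : R)%R, m%:R%R]) (g x)%:E)%E @[m --> \oo] --> (\int[nu]_x (g x)%:E)%E.
Proof.
move=> mg g0.
rewrite (_ : setT = bigcup (@setT nat) (fun m => `[(- m%:R : R)%R, m%:R]%classic)); last first.
  apply/esym/seteqP; split => // x _; exists (Num.truncn `|x|).+1 => //=.
  by rewrite in_itv/= -ler_norml ltW// truncnS_gt.
apply: ge0_nondecreasing_set_cvg_integral => //.
- move=> m m' mm'; apply/subsetPset => x /=; rewrite !in_itv/= -!ler_norml => /le_trans; apply.
  by rewrite ler_nat.
- by move=> m; apply/measurable_EFinP; exact: measurable_funTS.
- by move=> m x _; rewrite lee_fin.
Qed.

Variable s : R.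
Hypothesis s0 : s != 0.
Notation phi := (normal_pdf 0 s).

Lemma normal_pdf0E x : phi x = normal_peak s * expR (- (s ^+ 2 *+ 2)^-1 * x ^+ 2).
Proof.
by rewrite normal_pdfE// /normal_fun subr0; congr (_ * expR _); ring.
Qed.

Lemma is_derive_normal_pdf (x : R) : is_derive x 1 phi (- (s ^+ 2)^-1 * x * phi x).
Proof.
have E : phi = normal_peak s *: (expR \o (- (s ^+ 2 *+ 2)^-1 *: (@id R ^+ 2))).
  by apply/funext => y; rewrite normal_pdf0E.
have D1 : is_derive x 1 (- (s ^+ 2 *+ 2)^-1 *: (@id R ^+ 2)) (- (s ^+ 2 *+ 2)^-1 * (2 * x)).
  apply: is_derive_eq; rewrite /GRing.scale/= expr1; ring.
have D2 := is_derive1_comp (is_derive_expR _) D1.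
have D3 := is_deriveZ (normal_peak s) D2.
rewrite [X in is_derive _ _ X]E; apply: (is_derive_eq D3).
rewrite normal_pdf0E /GRing.scale/=.
have -> : - (s ^+ 2 *+ 2)^-1 *: ((@id R) ^+ 2) x = - (s ^+ 2 *+ 2)^-1 * x ^+ 2 by [].
by field.
Qed.

Lemma normal_pdf_continuous : continuous phi.
Proof. exact: continuous_normal_pdf. Qed.

(* Integration by parts against [phi' = - x phi / s^2]. *)
Lemma normal_recurrence (k : nat) (a : R) : 0 < a -> ~~ odd k ->
  (\int[mu]_(x in `[(- a)%R, a]) (x ^+ k.+2 * phi x)%:E =
   (k.+1%:R * s ^+ 2)%:E * (\int[mu]_(x in `[(- a)%R, a]) (x ^+ k * phi x)%:E)
   - (2 * s ^+ 2 * (a ^+ k.+1 * phi a))%:E)%E.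
Proof.
move=> a0 ek.
have cX j : continuous (fun x : R => x ^+ j * phi x).
  move=> x; apply: cvgM; last exact: normal_pdf_continuous.
  exact: exprn_continuous.
pose F (x : R) : R := - s ^+ 2 * (x ^+ k.+1 * phi x).
pose f (x : R) : R := x ^+ k.+2 * phi x - (k.+1%:R * s ^+ 2) * (x ^+ k * phi x).
have dF (x : R) : is_derive x 1 F (f x).
  have D := is_derive_normal_pdf x.
  have -> : F = (- s ^+ 2) *: (((@id R) ^+ k.+1) * phi).
    by apply/funext => y; rewrite /F !fctE.
  apply: is_derive_eq; rewrite /f /GRing.scale/= !fctE.
  by rewrite [x ^+ k.+2]exprS [x ^+ k.+1]exprS; field.
have cf : continuous f.
  by move=> x; apply: cvgB; [exact: cX|apply: cvgM; [exact: cvg_cst|exact: cX]].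
have := Rintegral_derive (_ : - a < a) dF cf.
have iX j : mu.-integrable `[- a, a] (fun x => (x ^+ j * phi x)%:E).
  apply: continuous_compact_integrable; first exact: segment_compact.
  exact: continuous_subspaceT.
rewrite /f; under eq_integral do rewrite EFinB (EFinM (k.+1%:R * s ^+ 2)).
rewrite integralB//=; last by apply: integrableZl => //; exact: iX.
rewrite integralZl// => /(_ _) H.
have {}H := H (gtrN a0).
rewrite -[LHS](@subeK _ _ ((k.+1%:R * s ^+ 2)%:E * \int[mu]_(x in `[(- a)%R, a]) (x ^+ k * phi x)%:E)%E).
  rewrite H addeC; congr (_ + _)%E; congr (_%:E).
  rewrite /F !normal_pdf0E sqrrN (exprS (- a)).
  have -> : (- a) ^+ k = a ^+ k by rewrite exprNn -signr_odd (negbTE ek) expr0 mul1r.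
  by rewrite [a ^+ k.+1]exprS; move: (expR _) => E; ring.
by rewrite fin_numM// integrable_fin_num.
Qed.

(** From [y^2 / 2 <= exp y] at [y = c m^2] one gets [m^3 phi(m) <= C / m]. The exponents 1 and 3 are
    those of the boundary terms for the second and fourth moments. *)
Lemma cvg_normal_boundary (k : nat) : (k <= 3)%N ->
  m%:R ^+ k * phi m%:R @[m --> \oo] --> (0 : R).
Proof.
move=> k3; pose c : R := (s ^+ 2 *+ 2)^-1%R.
have s2 : 0 < s ^+ 2 by rewrite exprn_even_gt0.
have c0 : 0 < c by rewrite invr_gt0 mulrn_wgt0.
pose C := normal_peak s * (2 / c ^+ 2).
have p0 := normal_peak_gt0 s0.
have C0 : 0 < C by rewrite mulr_gt0// divr_gt0// exprn_gt0.
apply/cvgrPdist_le => e e0.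
exists (Num.truncn (C / e)).+1 => // m /= Cm.
have m0 : 0 < m%:R :> R by rewrite ltr0n; exact: leq_trans Cm.
have m1 : 1 <= m%:R :> R by rewrite ler1n -(ltr0n R).
have Cem : C / m%:R <= e.
  rewrite ler_pdivrMr// mulrC -ler_pdivrMr//.
  by rewrite ltW// (lt_le_trans (truncnS_gt _))// ler_nat.
rewrite sub0r normrN ger0_norm; last by rewrite mulr_ge0 ?normal_pdf_ge0// exprn_ge0// ltW.
apply: le_trans Cem.
apply: (@le_trans _ _ (m%:R ^+ 3 * phi m%:R)).
  by rewrite ler_wpM2r ?normal_pdf_ge0// ler_weXn2l.
rewrite normal_pdf0E -/c mulrCA /C -[leRHS]mulrA ler_wpM2l//; first exact: ltW.
rewrite mulNr expRN ler_pdivrMr ?expR_gt0//.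
have cm : 0 <= c * m%:R ^+ 2 by rewrite mulr_ge0 ?sqr_ge0// ltW.
have := expR_ge1Dxn 1 cm; rewrite -[2`!]/2%N => H.
apply: (@le_trans _ _ (2 / c ^+ 2 / m%:R * ((c * m%:R ^+ 2) ^+ 2 / 2))).
  rewrite le_eqVlt; apply/orP; left; apply/eqP; field.
  by rewrite !gt_eqF.
rewrite ler_wpM2l//; last by apply: le_trans H; rewrite lerDr.
by rewrite !mulr_ge0 ?invr_ge0 ?exprn_ge0 ?ltW.
Qed.

Lemma cvg_normal_moment (k : nat) (l : R) : (k <= 2)%N -> ~~ odd k ->
  (\int[mu]_(x in `[(- m%:R : R)%R, m%:R%R]) (x ^+ k * phi x)%:E)%E @[m --> \oo] --> l%:E ->
  (\int[mu]_(x in `[(- m%:R : R)%R, m%:R%R]) (x ^+ k.+2 * phi x)%:E)%E @[m --> \oo] -->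
    (k.+1%:R * s ^+ 2 * l)%:E.
Proof.
move=> k2 ek cl.
have cb : 2 * s ^+ 2 * (m%:R ^+ k.+1 * phi m%:R) @[m --> \oo] --> (0 : R).
  rewrite -[X in _ --> X](mulr0 (2 * s ^+ 2)).
  by apply: cvgM; [exact: cvg_cst|exact: cvg_normal_boundary].
have c1 : ((k.+1%:R * s ^+ 2)%:E * (\int[mu]_(x in `[(- m%:R : R)%R, m%:R%R]) (x ^+ k * phi x)%:E)
    - (2 * s ^+ 2 * (m%:R ^+ k.+1 * phi m%:R))%:E)%E @[m --> \oo] --> (k.+1%:R * s ^+ 2 * l)%:E.
  rewrite -[X in _ --> X]sube0 [in X in _ --> X]EFinM.
  apply: cvgeB => //; first exact: cvgeZl.
  by apply: cvg_EFin => //; exact: nearW.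
apply: cvg_trans c1; apply: near_eq_cvg.
exists 1%N => // m /= m1; rewrite normal_recurrence//.
by rewrite ltr0n.
Qed.

Lemma cvg_normal_mass :
  (\int[mu]_(x in `[(- m%:R : R)%R, m%:R%R]) (x ^+ 0 * phi x)%:E)%E @[m --> \oo] --> (1 : R)%:E.
Proof.
under eq_fun do under eq_integral do rewrite expr0 mul1r.
rewrite -(integral_normal_pdf 0 s).
apply: cvg_integral_symmetric_itv; first exact: measurable_normal_pdf.
by move=> x; exact: normal_pdf_ge0.
Qed.

(** The Radon-Nikodym derivative of [normal_prob] agrees almost everywhere with the density, both
    having the same integrals over measurable sets. *)
Lemma integral_normal_prob (f : R -> \bar R) (U : set R) : measurable U ->
  (normal_prob 0 s).-integrable U f ->
  (\int[normal_prob 0 s]_(x in U) f x = \int[mu]_(x in U) (f x * (phi x)%:E))%E.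
Proof.
move=> mU fi; have mf := measurable_int _ fi.
rewrite -(Radon_Nikodym_change_of_variables (normal_prob_dominates 0 s))//=.
apply: ae_eq_integral => //.
- apply: emeasurable_funM => //; apply: (measurable_int mu).
  apply: (integrableS _ _ (@subsetT _ _)) => //=.
  by apply: Radon_Nikodym_integrable; exact: normal_prob_dominates.
- apply: emeasurable_funM => //=; apply/measurableT_comp => //=.
  by apply/measurable_funTS; exact: measurable_normal_pdf.
- apply: ae_eqe_mul2l => /=.
  rewrite Radon_NikodymE//=; first exact: normal_prob_dominates.
  move=> abmu.
  case: cid => /= h [h1 h2 h3].
  apply: integral_ae_eq => //=.
  + exact: integrableS h2.
  + by apply/measurable_funTS/measurableT_comp => //; exact: measurable_normal_pdf.
  + by move=> E E01 mE; rewrite -h3.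
Qed.

Lemma normal_even_moment (k : nat) (l : R) : ~~ odd k ->
  (\int[mu]_(x in `[(- m%:R : R)%R, m%:R%R]) (x ^+ k * phi x)%:E)%E @[m --> \oo] --> l%:E ->
  (\int[normal_prob 0 s]_x (x ^+ k)%:E = l%:E)%E.
Proof.
move=> ek cl.
have mX : measurable_fun setT (fun x : R => x ^+ k) by exact: measurable_funX.
have c1 : (\int[normal_prob 0 s]_(x in `[(- m%:R : R)%R, m%:R%R]) (x ^+ k)%:E)%E @[m --> \oo] -->
    (\int[normal_prob 0 s]_x (x ^+ k)%:E)%E.
  by apply: cvg_integral_symmetric_itv => // x; rewrite exprn_even_ge0.
apply: cvg_unique c1 _ => //.
apply: cvg_trans cl; apply: near_eq_cvg; apply: nearW => m.
rewrite integral_normal_prob//.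
apply: measurable_bounded_integrable => //.
  by rewrite (le_lt_trans (probability_le1 _ _))// ltry.
exists (m%:R ^+ k); split; first exact: num_real.
move=> M Mk x /=; rewrite in_itv/= -ler_norml => xm.
by rewrite (le_trans _ (ltW Mk))// normrX lerXn2r ?nnegrE.
Qed.

Lemma normal_second_moment : (\int[normal_prob 0 s]_x (x ^+ 2)%:E = (s ^+ 2)%:E)%E.
Proof.
apply: normal_even_moment => //.
have := @cvg_normal_moment 0 1 isT isT cvg_normal_mass.
by rewrite mul1r mulr1.
Qed.

Lemma normal_fourth_moment : (\int[normal_prob 0 s]_x (x ^+ 4)%:E = (3 * s ^+ 4)%:E)%E.
Proof.
apply: normal_even_moment => //.
have c2 := @cvg_normal_moment 0 1 isT isT cvg_normal_mass.
rewrite mul1r mulr1 in c2.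
have := @cvg_normal_moment 2 _ isT isT c2.
by rewrite -mulrA -expr2 -exprM.
Qed.

End NormalMoments.

(** * A calculus of finite means *)

Section Means.
Context {R : realType} {d : measure_display} {T : measurableType d}.
Variable P : probability T R.
Implicit Types (Y Z : T -> R).

Definition has_mean Y (a : R) : Prop :=
  P.-integrable setT (EFin \o Y) /\ (\int[P]_w (Y w)%:E = a%:E)%E.

Lemma has_meanD Y Z a b : has_mean Y a -> has_mean Z b ->
  has_mean (fun w => Y w + Z w) (a + b).
Proof.
move=> [iY EY] [iZ EZ]; split.
  by apply: eq_integrable (integrableD measurableT iY iZ) => //= w _; rewrite /= EFinD.
by under eq_integral do rewrite EFinD; rewrite integralD// EY EZ.
Qed.

Lemma has_meanZ Y a (c : R) : has_mean Y a -> has_mean (fun w => c * Y w) (c * a).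
Proof.
move=> [iY EY]; split.
  by apply: eq_integrable (integrableZl measurableT c iY) => //= w _; rewrite /= EFinM.
by under eq_integral do rewrite EFinM; rewrite integralZl// EY.
Qed.

Lemma has_mean_cst (a : R) : has_mean (fun=> a) a.
Proof.
split; first exact: (@bounded_integrable _ _ _ _ (cst a) `|a|).
by rewrite integral_cst//= probability_setT mule1.
Qed.

Lemma has_mean_sum (I : Type) (s : seq I) (Y : I -> T -> R) (a : I -> R) :
  (forall i, has_mean (Y i) (a i)) ->
  has_mean (fun w => \sum_(i <- s) Y i w) (\sum_(i <- s) a i).
Proof.
move=> H; elim: s => [|i s IH].
  by rewrite big_nil; under eq_fun do rewrite big_nil; exact: has_mean_cst.
rewrite big_cons; under eq_fun do rewrite big_cons.
exact: has_meanD.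
Qed.

Lemma has_mean_ext Y Z a b : has_mean Y a -> Y =1 Z -> a = b -> has_mean Z b.
Proof. by move=> H /funext <- <-. Qed.

Lemma has_mean_measurable Y a : has_mean Y a -> measurable_fun setT Y.
Proof. by move=> [/measurable_int/measurable_EFinP]. Qed.

Lemma ge0_integral_law (Y : T -> R) (nu : {measure set (measurableTypeR R) -> \bar R})
    (g : R -> \bar R) :
  measurable_fun setT Y -> measurable_fun setT g -> (forall x, 0 <= g x)%E ->
  (forall A, measurable A -> pushforward P Y A = nu A) ->
  (\int[P]_w g (Y w) = \int[nu]_x g x)%E.
Proof.
move=> mY mg g0 law. rewrite -[LHS](@ge0_integral_pushforward _ _ T (measurableTypeR R) R Y mY P setT g measurableT mg)//.
by apply: eq_measure_integral => A mA _; exact: law.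
Qed.

Lemma markov_ge0 Y a (e : R) : has_mean Y a -> (forall w, 0 <= Y w) -> 0 < e ->
  measurable (fun w => e <= Y w : Prop) /\
  (P (fun w => (e <= Y w)%R : Prop) <= (a / e)%:E)%E.
Proof.
move=> H Y0 e0; have mY := has_mean_measurable H; have [iY EY] := H.
have mA : measurable (fun w => e <= Y w).
  have := mY measurableT _ (measurable_itv `[e, +oo[).
  by rewrite setTI; congr measurable; apply/funext => w; rewrite /preimage /= in_itv/= andbT.
split => //.
have := @le_integral_comp_abse _ _ _ P setT measurableT (EFin \o Y) e id
  (@measurable_id _ _ _) (fun r r0 => r0) (fun _ _ _ _ h => h)
  ((measurable_EFinP _ _).2 mY) e0.
rewrite setTI (_ : (fun w => (e%:E <= `|(EFin \o Y) w|)%E : Prop) = (fun w => e <= Y w : Prop)); last first.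
  by apply/funext => w; rewrite /= lee_fin ger0_norm.
under eq_integral do rewrite /= ger0_norm//.
rewrite EY => H1.
rewrite -(@lee_pmul2l _ e%:E) ?lte_fin// (le_trans H1)// -EFinM lee_fin.
by rewrite mulrC divfK// gt_eqF.
Qed.

End Means.

(** * Concentration of the squared norm of an isotropic Gaussian vector *)

Section GaussianQuadratic.
Context {R : realType} {d : measure_display} {T : measurableType d} {m : nat}.
Variables (P : probability T R) (eta : T -> 'cV[R]_m) (v : R).
Hypothesis v_gt0 : 0 < v.
Hypothesis m_eta : random_matrix eta.
Hypothesis law : forall (t : 'cV[R]_m) (A : set R), measurable A ->
  pushforward P (fun w => vdot t (eta w)) A = normal_law 0 (v * vdot t t) A.

Lemma projection_moment (t : 'cV[R]_m) (k : nat) (l : R) : t != 0 -> ~~ odd k ->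
  (\int[normal_prob 0 (Num.sqrt (v * vdot t t))]_x (x ^+ k)%:E = l%:E)%E ->
  has_mean P (fun w => vdot t (eta w) ^+ k) l.
Proof.
move=> t0 ek El; have mt := measurable_vdot t m_eta.
have mX : measurable_fun setT (fun x : R => x ^+ k) by exact: measurable_funX.
have X0 (x : R) : (0 <= (x ^+ k)%:E)%E by rewrite lee_fin exprn_even_ge0.
have EE : (\int[P]_w (vdot t (eta w) ^+ k)%:E = l%:E)%E.
  rewrite -El.
  apply: (@ge0_integral_law _ _ _ _ (fun w => vdot t (eta w)) (normal_prob 0 (Num.sqrt (v * vdot t t)))
    (fun x => (x ^+ k)%:E)) => //; first exact/measurable_EFinP.
  move=> A mA; rewrite law// /normal_law ifF//.
  by rewrite gt_eqF// mulr_gt0// vdot_gt0.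
split=> //; apply/integrableP; split.
  by apply/measurable_EFinP; exact: measurable_funX.
rewrite (eq_integral (fun w => (vdot t (eta w) ^+ k)%:E)) ?EE ?ltry//.
by move=> w _; rewrite /= ger0_norm// exprn_even_ge0.
Qed.

Let sqrtvt (t : 'cV[R]_m) : t != 0 -> Num.sqrt (v * vdot t t) != 0.
Proof. by move=> t0; rewrite gt_eqF// sqrtr_gt0 mulr_gt0// vdot_gt0. Qed.

Lemma mean_projection2 (t : 'cV[R]_m) : t != 0 ->
  has_mean P (fun w => vdot t (eta w) ^+ 2) (v * vdot t t).
Proof.
move=> t0; apply: projection_moment => //.
by rewrite normal_second_moment ?sqrtvt// sqr_sqrtr// mulr_ge0 ?vdot_ge0// ltW.
Qed.

Lemma mean_projection4 (t : 'cV[R]_m) : t != 0 ->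
  has_mean P (fun w => vdot t (eta w) ^+ 4) (3 * (v * vdot t t) ^+ 2).
Proof.
move=> t0; apply: projection_moment => //.
rewrite normal_fourth_moment ?sqrtvt//; congr ((_ * _)%:E).
have -> (s : R) : s ^+ 4 = (s ^+ 2) ^+ 2 by rewrite -exprM.
by rewrite sqr_sqrtr// mulr_ge0 ?vdot_ge0// ltW.
Qed.

(* Polarization: [12 x^2 y^2 = (x + y)^4 + (x - y)^4 - 2 x^4 - 2 y^4]. *)
Lemma mean_centered_square_product (i j : 'I_m) :
  has_mean P (fun w => (eta w i 0 ^+ 2 - v) * (eta w j 0 ^+ 2 - v))
    (if i == j then 2 * v ^+ 2 else 0).
Proof.
pose e (i : 'I_m) : 'cV[R]_m := delta_mx i 0.
have eE i0 w : vdot (e i0) (eta w) = eta w i0 0.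
  rewrite vdotE (bigD1 i0)//= big1 => [|l li].
    by rewrite mxE !eqxx mul1r addr0.
  by rewrite mxE (negbTE li) mul0r.
have ee i0 j0 : vdot (e i0) (e j0) = (i0 == j0)%:R.
  rewrite vdotE (bigD1 i0)//= big1 => [|l li].
    by rewrite !mxE !eqxx mul1r addr0 andbT.
  by rewrite mxE (negbTE li) mul0r.
have nz (t : 'cV[R]_m) : vdot t t != 0 -> t != 0.
  by apply: contraNneq => ->; rewrite /vdot mulmx0 mxE.
have e0 i0 : e i0 != 0 by apply: nz; rewrite ee eqxx oner_neq0.
have q2 i0 := mean_projection2 (e0 i0).
have q4 i0 := mean_projection4 (e0 i0).
case: (eqVneq i j) => [<-|ij].
  apply: has_mean_ext (has_meanD (q4 i) (has_meanD (has_meanZ (- (2 * v)) (q2 i))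
    (has_mean_cst P (v ^+ 2)))) _ _.
    by move=> w; rewrite eE; ring.
  by rewrite !ee !eqxx mulr1n; ring.
have ep : vdot (e i + e j) (e i + e j) = 2.
  by rewrite !(vdotDl, vdotDr) !ee !eqxx (negbTE ij) [j == i]eq_sym (negbTE ij) !(mulr1n, mulr0n); ring.
have em : vdot (e i - e j) (e i - e j) = 2.
  by rewrite !(vdotDl, vdotDr, vdotNl, vdotNr) !ee !eqxx (negbTE ij) [j == i]eq_sym (negbTE ij) !(mulr1n, mulr0n); ring.
have p4 := mean_projection4 (nz _ (eq_ind_r (fun x => x != 0) (lt0r_neq0 (ltr0Sn R 1)) ep)).
have m4 := mean_projection4 (nz _ (eq_ind_r (fun x => x != 0) (lt0r_neq0 (ltr0Sn R 1)) em)).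
apply: has_mean_ext (has_meanD (has_meanZ (12%:R)^-1 p4) (has_meanD (has_meanZ (12%:R)^-1 m4)
  (has_meanD (has_meanZ (- (6%:R)^-1) (q4 i)) (has_meanD (has_meanZ (- (6%:R)^-1) (q4 j))
  (has_meanD (has_meanZ (- v) (q2 i)) (has_meanD (has_meanZ (- v) (q2 j))
  (has_mean_cst P (v ^+ 2)))))))) _ _.
  by move=> w; rewrite !(vdotDl, vdotNl) !eE; field.
by rewrite ep em !ee !eqxx !mulr1n; field.
Qed.

(** Chebyshev's inequality: [W] is the square of the sum of centered squares. Off-diagonal products
    have mean 0, so the mean of [W] is the [m] diagonal terms [2 v^2]. *)
Lemma mean_square_concentration (e : R) : (0 < m)%N -> 0 < e ->
  exists A, [/\ measurable A, (P A <= (2 * v ^+ 2 / (m%:R * e ^+ 2))%:E)%E &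
    forall w, ~ A w -> `|m%:R^-1 * vdot (eta w) (eta w) - v| < e].
Proof.
move=> m0 e0; have mR : 0 < m%:R :> R by rewrite ltr0n.
pose W w := \sum_(i < m) \sum_(j < m) (eta w i 0 ^+ 2 - v) * (eta w j 0 ^+ 2 - v).
have HW : has_mean P W (m%:R * (2 * v ^+ 2)).
  apply: has_mean_ext (has_mean_sum (index_enum 'I_m) (fun i =>
    has_mean_sum (index_enum 'I_m) (fun j => mean_centered_square_product i j))) _ _ => //.
  rewrite -[RHS]sum_ord_const; apply: eq_bigr => i _.
  by rewrite (bigD1 i)//= eqxx big1 ?addr0// => j ji; rewrite eq_sym (negbTE ji).
have WE w : W w = (m%:R * (m%:R^-1 * vdot (eta w) (eta w) - v)) ^+ 2.
  rewrite /W; under eq_bigr do rewrite -mulr_sumr.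
  rewrite -mulr_suml -expr2; congr (_ ^+ 2).
  by rewrite big_split/= sumrN sum_ord_const -vdot_sum_sqr; field; rewrite gt_eqF.
have W0 w : 0 <= W w by rewrite WE sqr_ge0.
have f0 : 0 < (m%:R * e) ^+ 2 by rewrite exprn_gt0// mulr_gt0.
have [mA PA] := markov_ge0 HW W0 f0.
exists (fun w => (m%:R * e) ^+ 2 <= W w); split => //.
  apply: (le_trans PA); rewrite lee_fin le_eqVlt; apply/orP; left; apply/eqP.
  by field; rewrite !gt_eqF.
move=> w /negP; rewrite -ltNge WE -[X in X < _]real_normK ?num_real//.
rewrite ltr_sqr ?nnegrE ?mulr_ge0 ?(ltW mR) ?(ltW e0)// normrM (gtr0_norm mR).
by rewrite ltr_pM2l.
Qed.

End GaussianQuadratic.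

(** * Convergence in probability *)

Section InProbability.
Context {R : realType} {d : nat -> measure_display}
  {T : forall nu, measurableType (d nu)}.
Variable P : forall nu, probability (T nu) R.

(* Convergence in probability, as a filter on the disjoint union of the sample
   spaces: along it, the rules of calculus for limits apply unchanged. *)
Definition in_prob : set_system {nu : nat & T nu} := fun U =>
  forall delta : R, 0 < delta -> \forall nu \near \oo, exists A : set (T nu),
    [/\ measurable A, (P nu A <= delta%:E)%E & forall w, ~ A w -> U (existT _ nu w)].

Global Instance in_prob_filter : Filter in_prob.
Proof.
split.
- by move=> e e0; near=> nu; exists set0; split => //; rewrite measure0 lee_fin ltW.
- move=> U V FU FV e e0; have e2 : 0 < e / 2 by rewrite divr_gt0.
  have := FU _ e2; apply: filterS2 (FV _ e2) => nu [A [mA PA AV]] [A' [mA' PA' AU]].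
  exists (A `|` A'); split; first exact: measurableU.
    rewrite (le_trans (@measureU2 _ _ _ (P nu) _ _ mA mA'))//.
    have -> : e = e / 2 + e / 2 by field.
    by rewrite EFinD leeD.
  by move=> w /not_orP[? ?]; split; [exact: AU|exact: AV].
- move=> U V UV FU e e0; apply: filterS (FU _ e0) => nu [A [mA PA AU]].
  by exists A; split => // w /AU/UV.
Unshelve. all: by end_near.
Qed.

Lemma cvg_tag : tag @ in_prob --> \oo.
Proof.
move=> U oU e e0; apply: filterS oU => nu Unu.
by exists set0; split => //; rewrite measure0 lee_fin ltW.
Qed.

End InProbability.

(** * Consistency of the empirical noise covariance *)

Section Regression.
Context {R : realType} {d : nat -> measure_display} {T : forall nu, measurableType (d nu)}.
Variables (P : forall nu, probability (T nu) R) (N : nat -> nat) (r : nat).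
Variables (E : forall nu, T nu -> 'M[R]_(N nu, r)) (Sigma : 'M[R]_r).
Hypothesis N_infty : N @ \oo --> \oo.
Hypothesis Sigma_pd : pdmx Sigma.
Hypothesis E_normal : forall nu, matrix_normal (P nu) (@E nu) 0 (1%:M *t Sigma).

(** The direction along which [vec E'] projects to [t'Eu]. The ascribed type identifies the [1 * 1]
    columns of the tensor product with one column. *)
Definition tens_cV (m : nat) (t : 'cV[R]_m) (u : 'cV[R]_r) : 'cV[R]_(m * r) := t *t u.

Lemma vdot_tens (m : nat) (A : 'M[R]_(m, r)) (t : 'cV[R]_m) (u : 'cV[R]_r) :
  ((tens_cV t u)^T *m vec A^T) 0 0 = vdot t (A *m u).
Proof.
rewrite mxE (reindex (@mxtens_index m r)); last first.
  by exists (@mxtens_unindex m r) => k _; [exact: mxtens_indexK|exact: mxtens_unindexK].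
transitivity (\sum_(p : 'I_m * 'I_r) t p.1 0 * (A p.1 p.2 * u p.2 0)).
  by apply: eq_bigr => -[i j] _; rewrite !mxE !mxtens_indexK/= !ord1; ring.
rewrite -(pair_bigA _ (fun i j => t i 0 * (A i j * u j 0))) vdotE.
by apply: eq_bigr => i _; rewrite mxE mulr_sumr.
Qed.

Lemma quadratic_tens (m : nat) (t : 'cV[R]_m) (u : 'cV[R]_r) :
  quadratic (1%:M *t Sigma) (tens_cV t u) = quadratic Sigma u * vdot t t.
Proof.
have -> : quadratic (1%:M *t Sigma) (tens_cV t u) =
    (((t^T *t u^T) *m (1%:M *t Sigma)) *m (t *t u)) 0 0.
  have tT : (tens_cV t u)^T = t^T *t u^T by exact: (trmx_tens t u).
  by rewrite /quadratic tT.
rewrite !tensmx_mul mulmx1 mxE !ord1 mulrC.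
by congr (_ * _); congr (fun_of_matrix _ _ _); apply/val_inj.
Qed.

(** The vector [E u] is isotropic: its projection on [t] has variance [(u' Sigma u) t't]. The
    concentration bound therefore applies to it. *)
Lemma mean_square_cvg (u : 'cV[R]_r) : u != 0 ->
  (fun s : {nu & T nu} => (N (tag s))%:R^-1 *
     vdot (E (tagged s) *m u) (E (tagged s) *m u)) @ in_prob P --> quadratic Sigma u.
Proof.
move=> u0; have v0 : 0 < quadratic Sigma u by exact: Sigma_pd.2.
set v := quadratic Sigma u in v0 *.
apply/cvgrPdist_lt => e e0 delta delta0.
(* From this size on the Chebyshev bound [2 v^2 / (N e^2)] is at most [delta]; the added 1 makes [N]
   positive. *)
have NP : \forall nu \near \oo, 2 * v ^+ 2 / (e ^+ 2 * delta) + 1 <= (N nu)%:R.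
  exact: (N_infty (nbhs_infty_ger _)).
have c0 : 0 <= 2 * v ^+ 2 / (e ^+ 2 * delta).
  by rewrite divr_ge0// mulr_ge0// ?sqr_ge0// ltW.
apply: filterS NP => nu NP.
have N0 : 0 < (N nu)%:R :> R by apply: lt_le_trans NP; rewrite ltr_wpDl.
have [mE psd lE] := E_normal nu.
have mEu : random_matrix (fun w : T nu => E w *m u).
  move=> i j; under eq_fun do rewrite mxE.
  apply: measurable_sum => k; apply: measurable_funM; last exact: measurable_cst.
  have := mE (mxtens_index (i, k)) 0.
  by under eq_fun do rewrite !mxE mxtens_indexK/=.
have lEu (t : 'cV[R]_(N nu)) (A : set R) : measurable A ->
    pushforward (P nu) (fun w : T nu => vdot t (E w *m u)) A = normal_law 0 (v * vdot t t) A.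
  move=> mA; have := lE (tens_cV t u) A mA.
  rewrite -/(quadratic _ _) quadratic_tens trmx0 (_ : vec 0 = 0) ?mulmx0; last first.
    by apply/colP => k; rewrite !mxE.
  by rewrite mxE; under [X in pushforward _ X]eq_fun do rewrite vdot_tens.
have [|A [mA PA AP]] := mean_square_concentration v0 mEu lEu _ e0.
  by rewrite -(ltr0n R).
exists A; split => //; last by move=> w /AP; rewrite distrC.
apply: (le_trans PA); rewrite lee_fin ler_pdivrMr ?mulr_gt0 ?exprn_gt0//.
rewrite -ler_pdivrMl// mulrC.
move: NP; rewrite -lerBrDr.
have -> : 2 * v ^+ 2 / (e ^+ 2 * delta) = 2 * v ^+ 2 / delta / e ^+ 2.
  by field; rewrite !gt_eqF.
move=> NP; rewrite -ler_pdivrMr ?exprn_gt0//.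
by rewrite (le_trans NP)// lerBlDr lerDl.
Qed.

Lemma noise_covariance_cvg :
  (fun s : {nu & T nu} => (N (tag s))%:R^-1 *: ((E (tagged s))^T *m E (tagged s)))
    @ in_prob P --> Sigma.
Proof.
pose q (u : 'cV[R]_r) (s : {nu & T nu}) :=
  (N (tag s))%:R^-1 * vdot (E (tagged s) *m u) (E (tagged s) *m u).
pose e (a : 'I_r) : 'cV[R]_r := delta_mx a 0.
have Eab (m : nat) (A : 'M[R]_(m, r)) (a b : 'I_r) : vdot (A *m e a) (A *m e b) = (A^T *m A) a b.
  by rewrite -!colE vdotE mxE; apply: eq_bigr => i _; rewrite !mxE.
have Sab a b : (e a)^T *m Sigma *m e b = (Sigma a b)%:M.
  by rewrite -colE trmx_delta -rowE; apply/matrixP => i j; rewrite !ord1 !mxE eqxx.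
have ST := Sigma_pd.1.
have e0 (a : 'I_r) : e a != 0.
  by apply/eqP => /matrixP/(_ a 0)/eqP; rewrite !mxE !eqxx oner_eq0.
(* Includes [a = b], where the sum is twice a basis vector: the diagonal entries need no separate
   treatment. *)
have e2 (a b : 'I_r) : e a + e b != 0.
  apply/eqP => /matrixP/(_ a 0)/eqP; rewrite !mxE !eqxx/=.
  by case: (a == b); rewrite ?addr0 ?oner_eq0// (_ : 1 + 1 = 2) ?pnatr_eq0.
apply/cvg_mxP => a b.
have -> : Sigma a b = 2^-1 * (quadratic Sigma (e a + e b) -
    (quadratic Sigma (e a) + quadratic Sigma (e b))).
  have Sba : Sigma b a = Sigma a b by rewrite -[in LHS]ST mxE.
  have ab : (e a + e b)^T = (e a)^T + (e b)^T by rewrite linearD.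
  rewrite /quadratic ab 2!mulmxDl !mulmxDr !Sab !mxE Sba !eqxx !mulr1n; lra.
have -> : (fun s : {nu & T nu} => ((N (tag s))%:R^-1 *: ((E (tagged s))^T *m E (tagged s))) a b) =
    (fun s => 2^-1 * (q (e a + e b) s - (q (e a) s + q (e b) s))).
  apply/funext => -[nu w]; rewrite /q/= mxE !mulmxDr !(vdotDl, vdotDr) !Eab.
  have -> : ((E w)^T *m E w) b a = ((E w)^T *m E w) a b.
    by rewrite -[in LHS](trmxK (E w)) -trmx_mul mxE trmxK.
  by move: ((N nu)%:R^-1 : R)%R => y; field.
apply: cvgM; first exact: cvg_cst.
apply: cvgB; first exact: mean_square_cvg.
by apply: cvgD; exact: mean_square_cvg.
Qed.

End Regression.

Lemma cvge0P {R : realType} (u : nat -> \bar R) : (forall n, 0 <= u n)%E ->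
  (u @ \oo --> 0%E) <->
  (forall delta : R, 0 < delta -> \forall n \near \oo, (u n <= delta%:E)%E).
Proof.
move=> u0; split=> [/fine_cvgP[uf /cvgrPdist_lt cu] e e0|H].
  apply: filterS2 uf (cu _ e0) => n fn /=.
  by rewrite sub0r normrN => /(le_lt_trans (ler_norm _))/ltW; rewrite -lee_fin fineK.
apply/fine_cvgP; split.
  by apply: filterS (H 1 ltr01) => n un; rewrite ge0_fin_numE// (le_lt_trans un)// ltry.
apply/cvgrPdist_le => e e0; apply: filterS (H e e0) => n un /=.
have fn : u n \is a fin_num by rewrite ge0_fin_numE// (le_lt_trans un)// ltry.
by rewrite sub0r normrN ger0_norm ?fine_ge0// -lee_fin fineK.
Qed.

Section InProbabilityConsequences.
Context {R : realType} {d : nat -> measure_display}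
  {T : forall nu, measurableType (d nu)}.
Variable P : forall nu, probability (T nu) R.

Lemma cvg_in_outer_probability_of_cvg {m n : nat} (S : forall nu, T nu -> 'M[R]_(m, n))
    (S0 : 'M[R]_(m, n)) :
  (fun s : {nu & T nu} => S (tag s) (tagged s)) @ in_prob P --> S0 ->
  cvg_in_outer_probability P S S0.
Proof.
move=> cS e e0; apply/cvge0P => [nu|delta delta0]; first exact: mu_ext_ge0.
have cE : (fun s : {nu & T nu} => enorm (S (tag s) (tagged s) - S0)) @ in_prob P --> (0 : R).
  rewrite -(@enorm0 R m n) -(subrr S0).
  apply: (@cvg_comp _ _ _ (fun s : {nu & T nu} => S (tag s) (tagged s) - S0) (@enorm R m n));
    last exact: enorm_continuous.
  by apply: cvgB => //; exact: cvg_cst.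
have H : \forall nu \near \oo, exists A : set (T nu), [/\ measurable A,
    (P nu A <= delta%:E)%E & forall w, ~ A w -> enorm (S nu w - S0) < e].
  exact: (cvgr_lt _ cE _ e0) _ delta0.
apply: filterS H => nu [A [mA PA AS]].
rewrite (le_trans _ PA)// -(measurable_mu_extE (P nu) mA).
apply: le_mu_ext => w /=; apply: contraPP => /AS /=.
by rewrite ltNge => /negP.
Qed.

Lemma expectation_cvg0 (Y : forall nu, T nu -> R) (K : R) :
  (forall nu, measurable_fun setT (Y nu)) -> (forall nu w, `|Y nu w| <= K) ->
  (fun s : {nu & T nu} => Y (tag s) (tagged s)) @ in_prob P --> (0 : R) ->
  'E_(P nu)[Y nu]%E @[nu --> \oo] --> 0%E.
Proof.
move=> mY YK cY.
apply/cvg_abse0P; apply/cvge0P => [nu|e e0]; first exact: abse_ge0.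
have e2 : 0 < e / 2 by rewrite divr_gt0.
have d0 : 0 < e / 2 / (`|K| + 1) by rewrite divr_gt0// ltr_wpDl.
have H : \forall nu \near \oo, exists A : set (T nu), [/\ measurable A,
    (P nu A <= (e / 2 / (`|K| + 1))%:E)%E & forall w, ~ A w -> `|Y nu w| <= e / 2].
  exact: ((cvgr0Pnorm_le _).1 cY _ e2) _ d0.
apply: filterS H => nu [A [mA PA AY]].
have mYE := (measurable_EFinP _ _).2 (mY nu).
rewrite unlock (le_trans (le_abse_integral _ measurableT mYE))//.
(* Off [A] the integrand is at most [e / 2], on [A] at most [|K|]. *)
apply: (@le_trans _ _ (\int[P nu]_w ((e / 2)%:E + (`|K|)%:E * (\1_A w)%:E))%E).
  apply: ge0_le_integral => //.
  - exact: measurableT_comp.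
  - apply: emeasurable_funD => //; apply: measurable_funeM.
    by apply/measurable_EFinP; exact: measurable_indic.
  - move=> w _; rewrite -EFinM -EFinD lee_fin indicE.
    have [Aw|nAw] := boolP (w \in A).
      rewrite mulr1 (le_trans (YK nu w))// (le_trans (ler_norm K))// lerDr.
      exact: ltW.
    by rewrite mulr0 addr0; apply: AY; rewrite notin_setE in nAw.
rewrite ge0_integralD//; last 2 first.
- by move=> w _; rewrite lee_fin ltW.
- by apply: measurable_funeM; apply/measurable_EFinP; exact: measurable_indic.
rewrite integral_cst//= probability_setT mule1 ge0_integralZl_EFin//; last first.
  by apply/measurable_EFinP; exact: measurable_indic.
rewrite integral_indic// setIT.
apply: (@le_trans _ _ ((e / 2)%:E + (`|K|)%:E * (e / 2 / (`|K| + 1))%:E)%E).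
  by rewrite leeD2l// lee_wpmul2l// lee_fin.
rewrite -EFinM -EFinD lee_fin [leRHS](_ : e = e / 2 + e / 2); last by field.
rewrite lerD2l mulrCA ler_piMr ?(ltW e2)// ler_pdivrMr ?ltr_wpDl//.
by rewrite mul1r lerDl.
Qed.

(** Slutsky's argument in the case where the comparison variables [Y'] all have the same
    expectation, so that no limit has to be taken for them. *)
Lemma expectation_cvg (Y Y' : forall nu, T nu -> R) (K : R) (a : \bar R) :
  (forall nu, measurable_fun setT (Y nu)) -> (forall nu, measurable_fun setT (Y' nu)) ->
  (forall nu w, `|Y nu w| <= K) -> (forall nu w, `|Y' nu w| <= K) ->
  (fun s : {nu & T nu} => Y (tag s) (tagged s) - Y' (tag s) (tagged s)) @ in_prob P --> (0 : R) ->
  (forall nu, 'E_(P nu)[Y' nu]%E = a) ->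
  'E_(P nu)[Y nu]%E @[nu --> \oo] --> a.
Proof.
move=> mY mY' YK Y'K cY EY'.
have iY nu := bounded_integrable (P nu) (mY nu) (YK nu).
have iY' nu := bounded_integrable (P nu) (mY' nu) (Y'K nu).
have c0 := expectation_cvg0 (K := K + K)
  (fun nu => measurable_funB (mY nu) (mY' nu))
  (fun nu w => le_trans (ler_normB _ _) (lerD (YK nu w) (Y'K nu w))) cY.
have -> : (fun nu => 'E_(P nu)[Y nu]%E) =
    (fun nu => 'E_(P nu)[Y nu \- Y' nu]%E + a)%E.
  apply/funext => nu; rewrite -(EY' nu) !unlock integralB_EFin// subeK//.
  exact: integrable_fin_num.
rewrite -[X in _ --> X]add0e; apply: (cvgeD _ c0 (cvg_cst a)).
exact: fin_num_adde_defr.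
Qed.

End InProbabilityConsequences.

(** * Tightness of vectors with a common law *)

Section Tightness.
Context {R : realType} {d : nat -> measure_display} {T : forall nu, measurableType (d nu)}.
Variables (P : forall nu, probability (T nu) R) (k : nat) (Z : forall nu, T nu -> 'cV[R]_k).
Hypothesis mZ : forall nu, random_matrix (@Z nu).
Hypothesis same_law : forall nu (t : 'cV[R]_k) (A : set R), measurable A ->
  pushforward (P nu) (fun w => vdot t (Z w)) A = pushforward (P 0) (fun w => vdot t (Z w)) A.

(** Continuity of measure from above gives [M] for the first sample space; equality of the laws
    carries it to all others. *)
Lemma tight_projection (t : 'cV[R]_k) (delta : R) : 0 < delta ->
  exists M : nat, forall nu, exists A : set (T nu),
    [/\ measurable A, (P nu A <= delta%:E)%E & forall w, ~ A w -> `|vdot t (Z w)| <= M%:R].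
Proof.
move=> d0.
pose C (m : nat) : set R := ~` [set` `[- m%:R, m%:R]].
have mC m : measurable (C m) by apply: measurableC; exact: measurable_itv.
pose F nu (m : nat) := (fun w : T nu => vdot t (Z w)) @^-1` C m.
have mF nu m : measurable (F nu m).
  have := measurable_vdot t (mZ (nu := nu)) measurableT (mC m).
  by rewrite setTI.
have : (P 0 \o F 0) @ \oo --> P 0 (bigcap setT (F 0)).
  apply: nonincreasing_cvg_mu => //.
  - by rewrite (le_lt_trans (probability_le1 _ (mF _ _)))// ltry.
  - exact: bigcap_measurableType.
  - move=> m m' mm'; apply/subsetPset => w; rewrite /F /C/= !in_itv/= => /negP H.
    apply/negP; apply: contra H => /andP[H1 H2].
    have mmR : m%:R <= m'%:R :> R by rewrite ler_nat.
    by rewrite (le_trans _ H1) ?lerN2//= (le_trans H2).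
have -> : bigcap setT (F 0) = set0.
  apply/seteqP; split=> // w H.
  have := H (Num.bound `|vdot t (Z w)|) I; rewrite /F /C/= in_itv/= -ler_norml.
  by rewrite ltW// archi_boundP.
rewrite measure0 => /cvge0P => /(_ (fun n => measure_ge0 _ _) _ d0)[M _ HM].
exists M => nu; exists (F nu M); split => //.
  rewrite (le_trans _ (HM M _))//=.
  by have := same_law nu t (mC M); rewrite /pushforward => ->.
move=> w; rewrite /F /C /= in_itv/= => /contrapT.
by rewrite ler_norml.
Qed.

Lemma tight (delta : R) : 0 < delta ->
  exists2 M : R, 0 <= M & forall nu, exists A : set (T nu),
    [/\ measurable A, (P nu A <= delta%:E)%E & forall w, ~ A w -> `|Z w| <= M].
Proof.
(* Induction over a list of coordinates, half of the allowed probability going to each new one. *)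
move=> d0; suff H (s : seq 'I_k) (e : R) : 0 < e ->
    exists2 M : R, 0 <= M & forall nu, exists A : set (T nu),
    [/\ measurable A, (P nu A <= e%:E)%E &
        forall w, ~ A w -> forall i, i \in s -> `|Z w i 0| <= M].
  have [M M0 HM] := H (enum 'I_k) _ d0; exists M => // nu.
  have [A [mA PA AM]] := HM nu; exists A; split => // w /AM Zw.
  by apply: mx_norm_le => // i j; rewrite (ord1 j) Zw// mem_enum.
elim: s e => [|i s IH] e e0.
  by exists 0 => // nu; exists set0; split => //; rewrite measure0 lee_fin ltW.
have e2 : 0 < e / 2 by rewrite divr_gt0.
have [M M0 HM] := IH _ e2; have [M' HM'] := tight_projection (delta_mx i 0) e2.
exists (M + M'%:R) => [|nu]; first by rewrite addr_ge0.
have [A [mA PA AM]] := HM nu; have [A' [mA' PA' AM']] := HM' nu.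
exists (A `|` A'); split; first exact: measurableU.
  rewrite (le_trans (@measureU2 _ _ _ (P nu) _ _ mA mA'))//.
  have -> : e = e / 2 + e / 2 by field.
  by rewrite EFinD leeD.
move=> w /not_orP[/AM Hs /AM' Hi] j; rewrite in_cons => /orP[/eqP ->|js].
  have <- : vdot (delta_mx i 0) (Z w) = Z w i 0.
    by rewrite /vdot trmx_delta -rowE mxE.
  by rewrite (le_trans Hi)// lerDr.
by rewrite (le_trans (Hs j js))// lerDl.
Qed.

End Tightness.

(** * Asymptotics of least squares *)

Section LeastSquares.
Context {R : realType} {N p r : nat}.
Variables (X : 'M[R]_(N, p)) (B : 'M[R]_(p, r)) (E : 'M[R]_(N, r)).
Hypothesis X_rank : \rank X = p.

Lemma gram_unit : X^T *m X \in unitmx.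
Proof.
apply: pdmx_unit; split; first by rewrite trmx_mul trmxK.
move=> t t0; rewrite mulmxA -trmx_mul -mulmxA.
apply: (vdot_gt0 (t := X *m t)); apply: contraNneq t0 => Xt0.
have /row_fullP[C CX] : row_full X by rewrite /row_full X_rank.
by rewrite -[t]mul1mx -CX -mulmxA Xt0 mulmx0.
Qed.

Lemma lse_error : lse X (X *m B + E) - B = invmx (X^T *m X) *m X^T *m E.
Proof.
by rewrite /lse mulmxDr -!mulmxA [X^T *m (X *m B)]mulmxA mulKmx ?gram_unit// addrC addKr.
Qed.

(** Pythagoras for the residuals: the noise cross-product minus a form quadratic in the estimation
    error, which is negligible in the limit. *)
Lemma sigma_hatE : sigma_hat X (X *m B + E) = (N%:R - p%:R)^-1 *:
  (E^T *m E - (lse X (X *m B + E) - B)^T *m (X^T *m X) *m (lse X (X *m B + E) - B)).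
Proof.
rewrite lse_error /sigma_hat; congr (_ *: _).
set G := X^T *m X; set H := X *m invmx G *m X^T.
have HX : H *m X = X by rewrite /H -mulmxA mulmxKV ?gram_unit.
have GT : (invmx G)^T = invmx G by rewrite trmx_inv /G trmx_mul trmxK.
have XH : X^T *m H = X^T by rewrite /H !mulmxA mulmxV ?gram_unit// mul1mx.
have -> : (invmx G *m X^T *m E)^T = E^T *m X *m invmx G.
  by rewrite !trmx_mul trmxK GT mulmxA.
have -> : (X *m B + E)^T *m (1%:M - H) = E^T *m (1%:M - H).
  rewrite (_ : (X *m B + E)^T = (X *m B)^T + E^T); last exact: linearD.
  by rewrite mulmxDl trmx_mul -[_ *m X^T *m _]mulmxA mulmxBr mulmx1 XH subrr mulmx0 add0r.
rewrite mulmxDr.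
have -> : E^T *m (1%:M - H) *m (X *m B) = 0.
  by rewrite -mulmxA [_ *m (X *m B)]mulmxA mulmxBl mul1mx HX subrr mul0mx mulmx0.
rewrite add0r mulmxBr mulmx1 mulmxBl; congr (_ - _).
rewrite -[_ *m invmx G *m G]mulmxA mulVmx ?gram_unit// mulmx1 /H.
by rewrite !mulmxA.
Qed.

End LeastSquares.

Lemma vec_norm {R : realType} {m n : nat} (A : 'M[R]_(m, n)) : `|vec A| = `|A|.
Proof.
apply/le_anti/andP; split; apply: mx_norm_le => // i j.
  by rewrite mxE ler_mxE_norm.
have -> : A i j = vec A (mxtens_index (j, i)) 0 by rewrite mxE mxtens_indexK.
exact: ler_mxE_norm.
Qed.

Lemma mvnormal_linear {R : realType} {d : measure_display} {T : measurableType d}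
    {k l : nat} (P : probability T R) (X : T -> 'cV[R]_k) (S : 'M[R]_k) (M : 'M[R]_(l, k)) :
  mvnormal P X 0 S -> mvnormal P (fun w => M *m X w) 0 (M *m S *m M^T).
Proof.
move=> [mX [ST S0] lX]; split.
- move=> i j; under eq_fun do rewrite mxE.
  apply: measurable_sum => a; apply: measurable_funM; last exact: mX.
  exact: measurable_cst.
- split; first by rewrite !trmx_mul trmxK ST mulmxA.
  by move=> t; have := S0 (M^T *m t); rewrite trmx_mul trmxK !mulmxA.
move=> t A mA; have := lX (M^T *m t) A mA.
rewrite trmx_mul trmxK !mulmx0 !mulmxA => <-.
by congr (pushforward P _ A); apply/funext => w; rewrite mulmxA.
Qed.

Section Asymptotics.
Context {R : realType} {d : nat -> measure_display} {T : forall nu, measurableType (d nu)}.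
Variables (P : forall nu, probability (T nu) R) (N : nat -> nat) (p r : nat).
Variables (X : forall nu, 'M[R]_(N nu, p)) (B : 'M[R]_(p, r)) (Sigma : 'M[R]_r).
Variables (E Y : forall nu, T nu -> 'M[R]_(N nu, r)) (Theta : 'M[R]_(p * r)).
Hypothesis N_infty : N @ \oo --> \oo.
Hypothesis X_rank : forall nu, \rank (X nu) = p.
Hypothesis Sigma_pd : pdmx Sigma.
Hypothesis E_normal : forall nu, matrix_normal (P nu) (@E nu) 0 (1%:M *t Sigma).
Hypothesis Y_model : forall nu w, Y w = X nu *m B + @E nu w.
Hypothesis lse_normal : forall nu, matrix_normal (P nu)
  (fun w => Num.sqrt (N nu)%:R *: (lse (X nu) (Y w) - B)) 0 Theta.
Hypothesis ThetaE : forall nu, (N nu)%:R^-1 *: Theta = invmx ((X nu)^T *m X nu) *t Sigma.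

Let V nu (w : T nu) : 'cV[R]_(r * p) := vec (Num.sqrt (N nu)%:R *: (lse (X nu) (Y w) - B)).

Lemma scaled_error_normal nu :
  mvnormal (P nu) (@V nu) 0 (commutation p r *m Theta *m (commutation p r)^T).
Proof.
have := lse_normal nu; rewrite /matrix_normal trmx0 (_ : vec 0 = 0); last first.
  by apply/colP => k; rewrite !mxE.
move=> /(mvnormal_linear (commutation p r)); congr (mvnormal _ _ _ _).
by apply/funext => w; rewrite commutation_vec.
Qed.

Lemma scaled_error_tight (delta : R) : 0 < delta ->
  exists2 M : R, 0 <= M & forall nu, exists A : set (T nu),
    [/\ measurable A, (P nu A <= delta%:E)%E & forall w, ~ A w -> `|V w| <= M].
Proof.
apply: tight => [nu|nu t A mA]; first by case: (scaled_error_normal nu).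
have [_ _ l1] := scaled_error_normal nu; have [_ _ l0] := scaled_error_normal 0.
by rewrite /vdot l1// l0.
Qed.

Lemma sample_size_large (a : R) : \forall nu \near \oo, a <= (N nu)%:R.
Proof. exact: (N_infty (nbhs_infty_ger a)). Qed.

Lemma sample_size_large_tag (a : R) : \forall s \near in_prob P, a <= (N (tag s))%:R.
Proof. exact: (@cvg_tag _ _ _ P _ (sample_size_large a)). Qed.

(** Consistency from tightness: outside a small event the error is at most [M / sqrt N], which falls
    below [e] once [N] exceeds [(M / e)^2]. *)
Lemma lse_cvg :
  (fun s : {nu & T nu} => lse (X (tag s)) (Y (tagged s))) @ in_prob P --> B.
Proof.
apply/cvgrPdist_lt => e e0 delta d0; have [M M0 HM] := scaled_error_tight d0.
apply: filterS (sample_size_large ((M / e) ^+ 2 + 1)) => nu Nnu.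
have [A [mA PA AM]] := HM nu; exists A; split => // w /AM.
rewrite /V vec_norm normrZ ger0_norm ?sqrtr_ge0// [`|B - _|]distrC => HV.
have N0 : (M / e) ^+ 2 < (N nu)%:R by rewrite (lt_le_trans _ Nnu)// ltrDl.
have lt : M / e < Num.sqrt (N nu)%:R.
  by rewrite -(ger0_norm (divr_ge0 M0 (ltW e0))) -sqrtr_sqr ltr_sqrt// (le_lt_trans _ N0)// sqr_ge0.
have s0 : 0 < Num.sqrt (N nu)%:R :> R by apply: le_lt_trans lt; rewrite divr_ge0// ltW.
rewrite -(ltr_pM2l s0) (le_lt_trans HV)//.
by rewrite -ltr_pdivrMr.
Qed.

Lemma inv_sample_size_cvg : 
  (fun s : {nu & T nu} => (((N (tag s))%:R : R)^-1)%R) @ in_prob P --> (0 : R).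
Proof.
apply: (@cvg_comp _ _ _ tag (fun nu => (((N nu)%:R : R)^-1)%R) _ _ _ (cvg_tag P)).
apply/cvgrPdist_lt => e e0; apply: filterS (sample_size_large ((e^-1)%R + 1)) => nu Nnu.
have lt : (e^-1)%R < (N nu)%:R by rewrite (lt_le_trans _ Nnu)// ltrDl.
have N0 : 0 < (N nu)%:R :> R by rewrite (lt_trans _ lt)// invr_gt0.
by rewrite sub0r normrN gtr0_norm ?invr_gt0// invf_plt.
Qed.

Section NonemptyResponse.
Variable a : 'I_r.

(** As [Theta] is the same for all [nu], [ThetaE] forces [N (X'X)^-1] to be constant. Its value is
    read off the blocks of [Theta] at a positive diagonal entry of [Sigma], hence the response index
    [a]. *)
Definition gram_inv_limit : 'M[R]_p :=
  \matrix_(i, j) (Theta (mxtens_index (i, a)) (mxtens_index (j, a)) / Sigma a a).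

Let Saa : Sigma a a != 0.
Proof.
have := Sigma_pd.2 (delta_mx a 0); rewrite -colE trmx_delta -rowE !mxE => H.
rewrite gt_eqF// H//; apply/eqP => /matrixP/(_ a 0)/eqP.
by rewrite !mxE !eqxx oner_eq0.
Qed.

Lemma scaled_gram_inv nu : (0 < N nu)%N -> (N nu)%:R *: invmx ((X nu)^T *m X nu) = gram_inv_limit.
Proof.
move=> N0; have NR : (N nu)%:R != 0 :> R by rewrite pnatr_eq0 -lt0n.
apply/matrixP => i j; rewrite !mxE.
have /matrixP/(_ (mxtens_index (i, a)) (mxtens_index (j, a))) := ThetaE nu.
rewrite tensmxE !mxE => H; apply: (mulIf Saa); rewrite divfK// -mulrA -H.
by rewrite mulrA divff// mul1r.
Qed.

Lemma theta_limit : Theta = gram_inv_limit *t Sigma.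
Proof.
have [nu _ /(_ nu (leqnn _)) Nnu] := sample_size_large 1.
have N0 : (0 < N nu)%N by rewrite -(ltr0n R) (lt_le_trans _ Nnu).
rewrite -(scaled_gram_inv N0); apply/matrixP => i j.
have := ThetaE nu => /matrixP/(_ i j); rewrite !mxE => H.
by rewrite -mulrA -H mulrA divff ?mul1r// pnatr_eq0 -lt0n.
Qed.

Lemma sigma_hat_cvg :
  (fun s : {nu & T nu} => sigma_hat (X (tag s)) (Y (tagged s))) @ in_prob P --> Sigma.
Proof.
pose D (s : {nu & T nu}) := lse (X (tag s)) (Y (tagged s)) - B.
(* [sigma_hat] with [N] factored out: the degrees of freedom contribute [(1 - p / N)^-1], and
   [X'X / N] is the inverse of [gram_inv_limit]. *)
pose S (s : {nu & T nu}) := (1 - p%:R * (N (tag s))%:R^-1)^-1 *: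
  ((N (tag s))%:R^-1 *: ((E (tagged s))^T *m E (tagged s)) - (D s)^T *m invmx gram_inv_limit *m D s).
have cD : D @ in_prob P --> (0 : 'M[R]_(p, r)).
  by rewrite -(subrr B); apply: cvgB; [exact: lse_cvg|exact: cvg_cst].
have cS : S @ in_prob P --> Sigma.
  have -> : Sigma = (1 - p%:R * 0)^-1 *: (Sigma - 0^T *m invmx gram_inv_limit *m 0).
    by rewrite mulmx0 mulr0 !subr0 invr1 scale1r.
  apply: cvgZ.
    apply: cvgV; first by rewrite mulr0 subr0 oner_neq0.
    apply: cvgB; first exact: cvg_cst.
    by apply: cvgM; [exact: cvg_cst|exact: inv_sample_size_cvg].
  apply: cvgB; first exact: noise_covariance_cvg.
  apply: cvg_mulmx => //; apply: cvg_mulmx; last exact: cvg_cst.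
  exact: cvg_trmx.
apply: cvg_trans cS; apply: near_eq_cvg.
apply: (@filterS _ (in_prob P) _ _ _ _ (sample_size_large_tag 1)) => -[nu w] /= Nnu.
have N0 : (0 < N nu)%N by rewrite -(ltr0n R) (lt_le_trans _ Nnu).
have NR : (N nu)%:R != 0 :> R by rewrite pnatr_eq0 -lt0n.
rewrite /S /D/= Y_model sigma_hatE// -(scaled_gram_inv N0).
rewrite invmxZ; last by rewrite unitmxZ ?unitfE// unitmx_inv gram_unit.
rewrite invmxK -scalemxAr -scalemxAl -scalerBr scalerA; congr (_ *: _).
by rewrite -invfM; congr (GRing.inv _); field.
Qed.

End NonemptyResponse.

Lemma theta_hat_cvg :
  (fun s : {nu & T nu} => theta_hat (X (tag s)) (Y (tagged s))) @ in_prob P --> Theta.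
Proof.
(* Passing to entries serves only to produce a response index [a]; with no responses there is no
   entry to treat. *)
apply/cvg_mxP => k l; pose a := (mxtens_unindex k).2.
move: k l {a}(a : 'I_r) => + + a; apply/cvg_mxP.
rewrite [X in _ --> X](theta_limit a).
have H : (fun s : {nu & T nu} => gram_inv_limit a *t sigma_hat (X (tag s)) (Y (tagged s)))
    @ in_prob P --> gram_inv_limit a *t Sigma.
  by apply: cvg_tensmx; [exact: cvg_cst|exact: sigma_hat_cvg].
apply: cvg_trans H; apply: near_eq_cvg.
apply: (@filterS _ (in_prob P) _ _ _ _ (sample_size_large_tag 1)) => -[nu w] /= Nnu.
have N0 : (0 < N nu)%N by rewrite -(ltr0n R) (lt_le_trans _ Nnu).
rewrite -(scaled_gram_inv a N0) /theta_hat.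
by apply/matrixP => i j; rewrite !mxE mulrA.
Qed.

(** * The delta method for a map Frechet differentiable at the true parameter *)

Section DeltaMethod.
Context {n : nat}.
Variables (g : 'M[R]_(p, r) -> 'cV[R]_n) (J : 'M[R]_(n, r * p)).
Hypothesis g_meas : forall nu, random_matrix (fun w : T nu => g (lse (X nu) (Y w))).
Hypothesis g_frechet : forall e : R, 0 < e ->
  \forall C \near B, `|g C - g B - J *m vec (C - B)| <= e * `|C - B|.

Lemma delta_method : cvg_to_normal P
  (fun nu w => Num.sqrt (N nu)%:R *: (g (lse (X nu) (Y w)) - g B))
  0 (delta_covariance J Theta).
Proof.
pose A nu (w : T nu) := Num.sqrt (N nu)%:R *: (g (lse (X nu) (Y w)) - g B).
have JV_normal nu : mvnormal (P nu) (fun w : T nu => J *m V w) 0 (delta_covariance J Theta).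
  exact: mvnormal_linear (scaled_error_normal nu).
(* The law of [J V] does not depend on [nu], so the first sample space already carries the limit
   variable. *)
exists (d 0), (T 0), (P 0), (fun w : T 0 => J *m V w); split => //.
move=> h ch [K hK].
have mA nu : random_matrix (@A nu).
  move=> i j; rewrite /A; under eq_fun do rewrite !mxE.
  apply: measurable_funM; first exact: measurable_cst.
  by apply: measurable_funB; [exact: g_meas|exact: measurable_cst].
apply: (@expectation_cvg _ _ _ P (fun nu w => h (A nu w)) (fun nu w => h (J *m V w)) K) => //.
- by move=> nu; exact: (continuous_random ch hK (mA nu)).
- by move=> nu; apply: (continuous_random ch hK); case: (JV_normal nu).
- apply/cvgr0Pnorm_le => e e0 delta d0; have d2 : 0 < delta / 2 by rewrite divr_gt0.
  have [M M0 HM] := scaled_error_tight d2.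
  (* The radius bounds the entries of [J V] on the event [|V| <= M]. *)
  have [rho rho0 hrho] := unif_continuous_box ((r * p)%:R * (`|J| * M)) ch e0.
  have M1 : 0 < M + 1 by rewrite ltr_wpDl.
  (* With this slope the scaled Frechet remainder is at most [rho / (M + 1) * |V|], hence at most
     [rho] when [|V| <= M]. *)
  have r1 : 0 < rho / (M + 1) by rewrite divr_gt0.
  have HF : \forall nu \near \oo, exists F : set (T nu), [/\ measurable F,
      (P nu F <= (delta / 2)%:E)%E & forall w, ~ F w ->
      `|g (lse (X nu) (Y w)) - g B - J *m vec (lse (X nu) (Y w) - B)| <=
      rho / (M + 1) * `|lse (X nu) (Y w) - B|].
    exact: (lse_cvg (g_frechet r1)) _ d2.
  apply: filterS HF => nu [F [mF PF HF]]; have [F' [mF' PF' HF']] := HM nu.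
  exists (F `|` F'); split; first exact: measurableU.
    rewrite (le_trans (@measureU2 _ _ _ (P nu) _ _ mF mF'))//.
    have -> : delta = delta / 2 + delta / 2 by field.
    by rewrite EFinD leeD.
  move=> w /not_orP[/HF Fw /HF' Vw] /=; rewrite distrC; apply: hrho => [i|].
    rewrite mxE (le_trans (ler_norm_sum _ _ _))//.
    rewrite -[leRHS]sum_ord_const ler_sum// => j _.
    by rewrite normrM ler_pM// ?ler_mxE_norm// (le_trans (ler_mxE_norm _ _ _)).
  have s0 := sqrtr_ge0 ((N nu)%:R : R).
  have VE : V w = Num.sqrt (N nu)%:R *: vec (lse (X nu) (Y w) - B).
    by apply/colP => k; rewrite !mxE.
  rewrite distrC VE -scalemxAr -scalerBr normrZ (ger0_norm s0).
  apply: (@le_trans _ _ (rho / (M + 1) * `|V w|)).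
    by rewrite VE normrZ (ger0_norm s0) vec_norm mulrCA ler_wpM2l.
  apply: (@le_trans _ _ (rho / (M + 1) * (M + 1))); last by rewrite divfK// gt_eqF.
  by rewrite ler_pM2l// (le_trans Vw)// lerDl.
- move=> nu; apply: (@cramer_wold _ _ _ _ _ _ (P nu) (P 0) _ _ _ _ _ h K) => //.
  + by case: (JV_normal nu).
  + by case: (JV_normal 0).
  move=> t S mS; have [_ _ l1] := JV_normal nu; have [_ _ l0] := JV_normal 0.
  by rewrite /vdot l1// l0.
Qed.

End DeltaMethod.

Lemma delta_covariance_cvg {n : nat} (Jac : 'M[R]_(p, r) -> 'M[R]_(n, r * p)) :
  {for B, continuous Jac} ->
  cvg_in_outer_probability P
    (fun nu w => delta_covariance (Jac (lse (X nu) (Y w))) (theta_hat (X nu) (Y w)))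
    (delta_covariance (Jac B) Theta).
Proof.
move=> cJ; apply: (@cvg_in_outer_probability_of_cvg _ _ _ P).
have cJac : (fun s : {nu & T nu} => Jac (lse (X (tag s)) (Y (tagged s)))) @ in_prob P --> Jac B.
  exact: (cvg_comp _ _ lse_cvg cJ).
apply: cvg_mulmx; last exact: cvg_trmx.
apply: cvg_mulmx => //; apply: cvg_mulmx; last exact: cvg_cst.
by apply: cvg_mulmx; [exact: cvg_cst|exact: theta_hat_cvg].
Qed.

End Asymptotics.

Theorem theorem5p1 (R : realType) (n r : nat)
  (* data *)
  (d : nat -> measure_display) (Omega : forall nu, measurableType (d nu))
  (P : forall nu, probability (Omega nu) R)
  (N : nat -> nat)
  (X : forall nu, 'M[R]_(N nu, nbterms n))
  (B : 'M[R]_(nbterms n, r)) (Sigma : 'M[R]_r)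
  (E Y : forall nu, Omega nu -> 'M[R]_(N nu, r))
  (Theta : 'M[R]_(nbterms n * r))
  (f : 'cV[R]_r -> R) (prec : 'cV[R]_r -> 'cV[R]_r -> Prop) (c : R)
  (xs : 'M[R]_(nbterms n, r) -> 'cV[R]_n) (ls : 'M[R]_(nbterms n, r) -> R)
  (eps : R)
  (* the regression model *)
  (N_infty : N @ \oo --> \oo)
  (X_rank : forall nu, \rank (X nu) = nbterms n)
  (Sigma_pd : pdmx Sigma)
  (E_normal : forall nu, matrix_normal (P nu) (E nu) 0 (1%:M *t Sigma))
  (Y_model : forall nu w, Y nu w = X nu *m B + E nu w)
  (* the convex program, for parameters in V_eps(B) *)
  (eps_gt0 : 0 < eps)
  (f_scalarizes : forall Bh, Vnbhd eps B Bh -> forall x0 x1 : 'cV[R]_n, x0 != x1 ->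
     prec (surface Bh x0) (surface Bh x1) <->
     f (surface Bh x0) < f (surface Bh x1))
  (f_convex : forall Bh, Vnbhd eps B Bh ->
     strictly_convex (fun x : 'cV[R]_n => f (surface Bh x)))
  (xs_opt : forall Bh, Vnbhd eps B Bh -> unique_minimizer f c Bh (xs Bh))
  (xs_ls_kkt : forall Bh, Vnbhd eps B Bh -> forall x lam,
     kuhn_tucker f c Bh x lam <-> x = xs Bh /\ lam = ls Bh)
  (xs_meas : forall nu,
     random_matrix (fun w => xs (lse (X nu) (Y nu w))))
  (* second-order conditions *)
  (sosc : forall Bh, Vnbhd eps B Bh ->
     second_order_sufficient f c Bh (xs Bh) (ls Bh))
  (L_C2 : forall Bh, Vnbhd eps B Bh -> forall x lam,
     Vnbhd eps (stack (xs B) (ls B)) (stack x lam) ->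
     [/\ has_second_derivatives f c Bh x lam,
         second_derivatives_continuous f c Bh x lam &
         pdmx (L_xx f c Bh x lam)])
  (* normality of the estimator *)
  (lse_normal : forall nu, matrix_normal (P nu)
     (fun w => Num.sqrt (N nu)%:R *: (lse (X nu) (Y nu w) - B)) 0 Theta)
  (ThetaE : forall nu,
     (N nu)%:R^-1 *: Theta = invmx ((X nu)^T *m X nu) *t Sigma)
  (* strict complementary slackness *)
  (slackness : 0 < ls B <-> enorm (xs B) ^+ 2 - c ^+ 2 = 0) :
  [/\ cvg_to_normal P
        (fun nu w => Num.sqrt (N nu)%:R *: (xs (lse (X nu) (Y nu w)) - xs B))
        0 (delta_covariance (jacvec xs B) Theta),
      cvg_in_outer_probability P
        (fun nu w => delta_covariance (jacvec xs (lse (X nu) (Y nu w)))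
                                      (theta_hat (X nu) (Y nu w)))
        (delta_covariance (jacvec xs B) Theta) &
      exists delta : R, [/\ 0 < delta, delta <= eps &
        forall Bh, Vnbhd delta B Bh ->
        let Pm := L_xx f c Bh (xs Bh) (ls Bh) in
        let Q := L_lamx f c Bh (xs Bh) (ls Bh) in
        let G := L_xB f c Bh (xs Bh) (ls Bh) in
        [/\ has_jacvec xs Bh,
            {for Bh, continuous (jacvec xs)},
            enorm (xs Bh) ^+ 2 = c ^+ 2 ->
              jacvec xs Bh =
              - (1%:M - invmx Pm *m Q *m invmx (Q^T *m invmx Pm *m Q) *m Q^T)
                *m invmx Pm *m G &
            enorm (xs Bh) ^+ 2 < c ^+ 2 ->
              jacvec xs Bh = - (invmx Pm *m G)]]].

Proof.
(* The nested neighbourhood taken at its centre: all parameters near [B] are regular and in the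
   slackness case of [B]. *)
have nB := nbhs_singleton (same_case_near eps_gt0 f_convex xs_opt xs_ls_kkt L_C2 slackness).
split.
- apply: (delta_method N_infty lse_normal xs_meas) => e e0.
  have [K cK KE] := solution_slope f_convex xs_opt xs_ls_kkt L_C2 nB.
  have [_ JE] := jacvec_solution f_convex xs_opt xs_ls_kkt L_C2 nB.
  rewrite JE.
  exact: (frechet_of_slope vec_unconditional_basis cK KE e0).
- apply: (delta_covariance_cvg N_infty X_rank Sigma_pd E_normal Y_model lse_normal ThetaE).
  exact: (jacvec_solution_continuous f_convex xs_opt xs_ls_kkt L_C2 nB).
- exact: sensitivity_formula eps_gt0 f_convex xs_opt xs_ls_kkt L_C2 slackness.
Qed.
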